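(* Let $\sigma:\mathbb R\to\mathbb R$ be continuous and non-affine. Assume there is $\tilde x\in\mathbb R$ at which $\sigma$ is differentiable with $\sigma'(\tilde x)\neq0$. Then for every $\delta>0$ there exist multilayer perceptrons $g_1,\dots,g_K:\mathbb R^D\to\mathbb R$ with the following properties: - each has activation $\sigma$; - each has width at most $D+4$; - the congruent functions $f_k=g_k-\sum_{j=1}^K\lambda_j g_j$ (restricted to $\mathcal Y$) satisfy $$\sum_{k=1}^K\lambda_k\,\mathrm{KL}(\pi_k^*\,\|\,\pi^{f_k})=\frac{\mathcal L^*-\mathcal L(f_1,\dots,f_K)}{\epsilon}<\frac{\delta}{\epsilon}.$$
   Context: Setting: - For $k=1,\dots,K$, $\mathcal X_k\subset\mathbb R^{D_k}$ is compact and $\mathcal Y\subset\mathbb R^D$ is compact with positive Lebesgue measure. - $\mathbb P_k$ are absolutely continuous probability measures on $\mathcal X_k$. - $c_k$ are continuous on $\mathcal X_k\times\mathcal Y$. - $\lambda_k>0$ with $\sum\lambda_k=1$, and $\epsilon>0$. Entropy and EOT. $H(\mu)=-\int\log\frac{d\mu}{dy}\,d\mu$ for absolutely continuous $\mu$, and $-\infty$ otherwise. Define $$\mathrm{EOT}_{c,\epsilon}(\mathbb P,\mathbb Q)=\min_{\pi\in\Pi(\mathbb P,\mathbb Q)}\Big\{\int c\,d\pi-\epsilon\int H(\pi(\cdot\mid x))\,d\mathbb P(x)\Big\}.$$ Barycenter. $\mathcal L^*=\inf_{\mathbb Q}\sum_k\lambda_k\mathrm{EOT}_{c_k,\epsilon}(\mathbb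 P_k,\mathbb Q)$, assumed finite for some $\mathbb Q$. The unique barycenter is $\mathbb Q^*$, and $\pi_k^*$ is the EOT-optimal coupling of $\mathbb P_k$ and $\mathbb Q^*$. Transforms and plans. For $f\in\mathcal C(\mathcal Y)$: - $f^{C_k}(x)=\inf_{\mu\in\mathcal P(\mathcal Y)}\{\int c_k(x,\cdot)\,d\mu-\epsilon H(\mu)-\int f\,d\mu\}=-\epsilon\log\int_{\mathcal Y}e^{(f(y)-c_k(x,y))/\epsilon}\,dy$. - $\mathcal L(f_1,\dots,f_K)=\sum_k\lambda_k\int f_k^{C_k}\,d\mathbb P_k$. - $\mu^f_x$ has density proportional to $e^{(f(y)-c_k(x,y))/\epsilon}$ on $\mathcal Y$. - $d\pi^{f_k}(x,y)=d\mu^{f_k}_x(y)\,d\mathbb P_k(x)$. Multilayer perceptrons. A multilayer perceptron with activation $\sigma$ is a composition $A_L\circ\sigma\circ A_{L-1}\circ\cdots\circ\sigma\circ A_1$, where the $A_i$ are affine maps and $\sigma$ acts componentwise. Its width is the maximum dimension of the hidden layers. *)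

(* Defs.v *)
From HB Require Import structures.
From mathcomp Require Import all_boot all_order all_algebra.
From mathcomp Require Import all_classical all_reals all_analysis.
Import Order.TTheory GRing.Theory Num.Theory.
Import numFieldNormedType.Exports.

Set Implicit Arguments.
Unset Strict Implicit.
Unset Printing Implicit Defensive.

Local Open Scope classical_set_scope.
Local Open Scope ring_scope.

Section Defs.
Variable R : realType.

Definition borel_set {T : topologicalType} (A : set T) : Prop :=
  <<s [set: T], [set U | open U] >> A.

Definition borel_fun {T : topologicalType} (f : T -> R) : Prop :=
  forall B : set R, borel_set B -> borel_set (f @^-1` B).

Definition indic {T} (A : set T) (t : T) : R := if `[< A t >] then 1 else 0.

(* Lebesgue integral on R^n, defined for nonnegative integrands by     *)
(* iterated one-dimensional Lebesgue integration (Tonelli), R^0 being  *)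
(* a single point.                                                     *)
Fixpoint lintp (n : nat) : ('rV[R]_n -> \bar R) -> \bar R :=
  match n with
  | 0 => fun f => f 0
  | n'.+1 => fun f =>
      (\int[@lebesgue_measure R]_x
          lintp (fun v : 'rV[R]_n' => f (row_mx (const_mx x : 'rV[R]_1) v)))%E
  end.

Definition lint (n : nat) (f : 'rV[R]_n -> \bar R) : \bar R :=
  (lintp (fun v => maxe (f v) 0) - lintp (fun v => maxe (- f v) 0))%E.

Definition lint_on (n : nat) (A : set 'rV[R]_n) (f : 'rV[R]_n -> \bar R) :=
  lint (fun v => if `[< A v >] then f v else 0%E).

Definition leb_vol (n : nat) (A : set 'rV[R]_n) : \bar R :=
  lintp (fun v => ((indic A v)%:E)).

Definition lint2p (a b : nat) (f : 'rV[R]_a -> 'rV[R]_b -> \bar R) : \bar R :=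
  lintp (fun x => lintp (fun y => f x y)).
Definition lint2 (a b : nat) (f : 'rV[R]_a -> 'rV[R]_b -> \bar R) : \bar R :=
  (lint2p (fun x y => maxe (f x y) 0) - lint2p (fun x y => maxe (- f x y) 0))%E.

(* Absolutely continuous probability measures on A (subset of R^n),    *)
(* given by their Lebesgue density.                                     *)
Definition is_density (n : nat) (A : set 'rV[R]_n) (p : 'rV[R]_n -> R) : Prop :=
  [/\ borel_fun p, (forall v, 0 <= p v), (forall v, ~ A v -> p v = 0)
    & lint (fun v => (p v)%:E) = 1%E].

Definition entropy (n : nat) (r : 'rV[R]_n -> R) : \bar R :=
  (- lint (fun y => (r y * ln (r y))%:E))%E.

(* A coupling pi in Pi(P, Q) with absolutely continuous conditionals, where
   P has density p on X and Q has density q on Y: pi(dx,dy) = p(x) kappa(x,y) dx dy,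
   i.e. pi(.|x) has Lebesgue density kappa(x,.). *)
Definition is_coupling (a b : nat) (X : set 'rV[R]_a) (Y : set 'rV[R]_b)
    (p : 'rV[R]_a -> R) (q : 'rV[R]_b -> R) (kappa : 'rV[R]_a -> 'rV[R]_b -> R) :=
  [/\ borel_fun (fun z : 'rV[R]_a * 'rV[R]_b => kappa z.1 z.2),
      (forall x y, 0 <= kappa x y),
      (forall x y, ~ Y y -> kappa x y = 0),
      (forall x, X x -> lint (fun y => (kappa x y)%:E) = 1%E)
    & (forall B : set 'rV[R]_b, borel_set B ->
         lint2 (fun x y => (p x * kappa x y * indic B y)%:E)
         = lint (fun y => (q y * indic B y)%:E))].

Definition eot_cost (a b : nat) (p : 'rV[R]_a -> R) (c : 'rV[R]_a -> 'rV[R]_b -> R)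
    (eps : R) (kappa : 'rV[R]_a -> 'rV[R]_b -> R) : \bar R :=
  (lint2 (fun x y => (c x y * (p x * kappa x y))%:E)
   - eps%:E * lint (fun x => (p x)%:E * entropy (kappa x)))%E.

Definition EOT (a b : nat) (X : set 'rV[R]_a) (Y : set 'rV[R]_b)
    (p : 'rV[R]_a -> R) (q : 'rV[R]_b -> R) (c : 'rV[R]_a -> 'rV[R]_b -> R)
    (eps : R) : \bar R :=
  ereal_inf [set eot_cost p c eps kappa | kappa in is_coupling X Y p q].

Definition bary_obj (K : nat) (Dk : 'I_K -> nat) (D : nat)
    (X : forall k, set 'rV[R]_(Dk k)) (Y : set 'rV[R]_D)
    (P : forall k, 'rV[R]_(Dk k) -> R) (c : forall k, 'rV[R]_(Dk k) -> 'rV[R]_D -> R)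
    (lam : 'I_K -> R) (eps : R) (q : 'rV[R]_D -> R) : \bar R :=
  (\sum_(k < K) (lam k)%:E * EOT (X k) Y (P k) q (c k) eps)%E.

Definition Lstar (K : nat) (Dk : 'I_K -> nat) (D : nat)
    (X : forall k, set 'rV[R]_(Dk k)) (Y : set 'rV[R]_D)
    (P : forall k, 'rV[R]_(Dk k) -> R) (c : forall k, 'rV[R]_(Dk k) -> 'rV[R]_D -> R)
    (lam : 'I_K -> R) (eps : R) : \bar R :=
  ereal_inf [set bary_obj X Y P c lam eps q | q in is_density Y].

(* partition function  \int_Y exp((f(y) - c(x,y))/eps) dy  (finite here) *)
Definition Zpart (a b : nat) (Y : set 'rV[R]_b) (c : 'rV[R]_a -> 'rV[R]_b -> R)
    (eps : R) (f : 'rV[R]_b -> R) (x : 'rV[R]_a) : R :=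
  fine (lint_on Y (fun y => (expR ((f y - c x y) / eps))%:E)).

Definition Ctrans (a b : nat) (Y : set 'rV[R]_b) (c : 'rV[R]_a -> 'rV[R]_b -> R)
    (eps : R) (f : 'rV[R]_b -> R) (x : 'rV[R]_a) : R :=
  - eps * ln (Zpart Y c eps f x).

Definition Ldual (K : nat) (Dk : 'I_K -> nat) (D : nat)
    (Y : set 'rV[R]_D)
    (P : forall k, 'rV[R]_(Dk k) -> R) (c : forall k, 'rV[R]_(Dk k) -> 'rV[R]_D -> R)
    (lam : 'I_K -> R) (eps : R) (f : 'I_K -> 'rV[R]_D -> R) : \bar R :=
  (\sum_(k < K) (lam k)%:E * lint (fun x => (P k x * Ctrans Y (c k) eps (f k) x)%:E))%E.

Definition mu_dens (a b : nat) (Y : set 'rV[R]_b) (c : 'rV[R]_a -> 'rV[R]_b -> R)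
    (eps : R) (f : 'rV[R]_b -> R) (x : 'rV[R]_a) (y : 'rV[R]_b) : R :=
  indic Y y * expR ((f y - c x y) / eps) / Zpart Y c eps f x.

Definition KL2 (a b : nat) (alpha beta : 'rV[R]_a -> 'rV[R]_b -> R) : \bar R :=
  lint2 (fun x y => if alpha x y == 0 then 0%E
                    else if beta x y == 0 then +oo%E
                    else (alpha x y * ln (alpha x y / beta x y))%:E).

(* Multilayer perceptrons R^n -> R:
   A_L o sigma o A_{L-1} o ... o sigma o A_1.  [hidden W b net] is the
   affine map x |-> x W + b into R^m (a hidden layer of dimension m),
   followed by sigma componentwise, followed by [net];  [out w b] is the
   final affine map x |-> x . w + b. *)
Inductive mlp : nat -> Type :=
| out (n : nat) : 'rV[R]_n -> R -> mlp n
| hidden (n m : nat) : 'M[R]_(n, m) -> 'rV[R]_m -> mlp m -> mlp n.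

Fixpoint mlp_eval (sigma : R -> R) (n : nat) (g : mlp n) : 'rV[R]_n -> R :=
  match g with
  | out n w b => fun x => (x *m w^T) 0 0 + b
  | hidden n m W b g' => fun x => mlp_eval sigma g' (map_mx sigma (x *m W + b))
  end.

Fixpoint mlp_width (n : nat) (g : mlp n) : nat :=
  match g with
  | out _ _ _ => 0%N
  | hidden _ m _ _ g' => maxn m (mlp_width g')
  end.

Definition affine_fun (s : R -> R) : Prop := exists a b : R, forall x, s x = a * x + b.

End Defs.

(* Main.v *)
(* One has [eps KL(pi_k | pi^{f_k}) = cost(pi_k) - int f_k dQ - int f_k^C dP_k],
   and the middle terms cancel because [sum_k lam_k f_k = 0].  So it remains to
   find congruent network potentials whose dual value is within [delta] of
   [L^*], which needs a near-optimal bounded, uniformly continuous dual family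
   and universal approximation in width [D + 4].

   Duality.  Let [q_k] be the second marginal of [pi^{f_k}].  The step
   [f_k |-> eps (sum_j lam_j ln h_j - ln h_k)], where [q_k = e^{f_k/eps} h_k],
   produces congruent potentials whose modulus of continuity is controlled by
   that of the costs, and by Jensen it raises the dual value by at least
   [- eps ln int prod_k q_k^{lam_k}].  At a potential that is nearly optimal in
   the class of such potentials, the weighted geometric mean of the [q_k] thus
   has mass almost one, so all the [q_k] are close to it; thinning the plans
   [pi^{f_k}] and redistributing the lost mass uniformly gives plans with a
   common second marginal and cost close to the dual value.

   Approximation.  Residual maps [z + u sigma(w . z + b)] can be realised in
   width [dim z + 1], as [sigma] is close to a multiple of the identity near the
   point of differentiability.  With [dim z = D + 3] the input is carried along
   with three registers.  Sums of residual maps with [w . u = 0] yield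
   [z + u (w . z)^2], because [t |-> t^2] is a limit of linear combinations of
   translates and dilates of [sigma]; squares give products, hence polynomials,
   and Bernstein polynomials approximate a Lipschitz extension of the target. *)
Require Import Defs.
From HB Require Import structures.
From mathcomp Require Import all_boot all_order all_algebra.
From mathcomp Require Import all_classical all_reals all_analysis.
From mathcomp Require Import measurable_realfun ring lra.
Import Order.TTheory GRing.Theory Num.Theory.
Import numFieldNormedType.Exports.
Set Implicit Arguments.
Unset Strict Implicit.
Unset Printing Implicit Defensive.

Local Open Scope classical_set_scope.
Local Open Scope ring_scope.

(** No maximiser of the dual problem is sought. A potential within a small margin of the supremum
    suffices, since the ascent step stays in its class and so cannot exceed that supremum. The class
    is cut out by the modulus that the step produces from any bounded start: what the step returns
    depends on [y] only through the costs. This makes the potentials accessible to uniform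
    approximation, whereas arbitrary near-optimal potentials need not be continuous. Only one half
    of strong duality enters, the bound of [Lstar] by a dual value plus an error, through explicit
    competitors; the Kullback-Leibler identity accounts for the rest. The duality argument is run
    for abstract positive linear functionals on bounded measurable functions, with costs and
    potentials divided by [eps], so that logarithms and quotients raise no integrability question.
    Infinite values have to be faced only for the given optimal couplings, whose costs are shown
    finite by comparison with a competitor. On the network side, [w . u = 0] lets successive
    residual maps read the same argument, so that their terms add up. *)

(** * Uniform continuity on compact sets and of networks on bounded sets *)

Lemma compact_unif_cont (R : realType) (T : pseudoMetricType R) (A : set T)
    (f : T -> R) (e : R) :
  compact A -> {within A, continuous f} -> 0 < e ->
  exists2 d : R, 0 < d & forall x y, A x -> A y -> ball x d y -> `|f x - f y| < e.
Proof.
move=> /compact_near_coveringP cA /subspace_continuousP cf e0.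
pose P (d : R) (x : T) := A x -> forall y, A y -> ball x d y -> `|f x - f y| < e.
(* Compactness in near-covering form, with [d] tending to 0 from the right as the parameter, yields
   one radius for all of [A]. *)
have /cA : forall x, A x -> \forall x' \near x & d \near (0:R)^'+, P d x'.
  move=> x Ax; have e20 : 0 < e / 2 by rewrite divr_gt0.
  have /nbhs_ballP[r /= r0 rP] : \forall t \near x, A t -> `|f x - f t| < e / 2.
    by have /fcvgrPdist_lt/(_ _ e20) := cf x Ax.
  have r2 : 0 < r / 2 by rewrite divr_gt0.
  exists (ball x (r / 2), [set d | d < r / 2]) => /=.
    split; first exact: nbhsx_ballx.
    exact: nbhs_right_lt.
  move=> [x' d] /= [xx' dr] Ax' y Ay x'y.
  have h1 : `|f x - f x'| < e / 2.
    by apply: rP => //; apply: le_ball xx'; lra.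
  have h2 : `|f x - f y| < e / 2.
    apply: rP => //; apply: ball_split xx' _.
    exact: le_ball (ltW dr) _ x'y.
  by rewrite (le_lt_trans (ler_distD (f x) _ _))// (splitr e) ltrD// distrC.
move=> H.
have [d [d0 dP]] : exists d : R, 0 < d /\ A `<=` P d.
  have /filter_ex[d [d0 dP]] : \forall d \near (0:R)^'+, 0 < d /\ A `<=` P d.
    by near=> d; split; near: d => //; exact: nbhs_right_gt.
  by exists d.
by exists d => // x y Ax Ay xy; apply: dP.
Unshelve. all: by end_near. Qed.

Section bounded_vectors.
Variable R : realType.

(** Entrywise, so that blocks and single coordinates inherit the bound; [bnd d (x - y)] also serves
    as closeness. *)
Definition bnd m n (M : R) (x : 'M[R]_(m, n)) := forall i j, `|x i j| <= M.

Definition locbdd m n p q (F : 'M[R]_(m, n) -> 'M[R]_(p, q)) :=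
  forall M, exists M', forall x, bnd M x -> bnd M' (F x).

Lemma bnd_ge m n (M M' : R) (x : 'M[R]_(m, n)) : M <= M' -> bnd M x -> bnd M' x.
Proof. by move=> MM' xM i j; exact: le_trans (xM i j) MM'. Qed.

Lemma bndD m n (M M' : R) (x y : 'M[R]_(m, n)) :
  bnd M x -> bnd M' y -> bnd (M + M') (x + y).
Proof. by move=> xM yM i j; rewrite mxE (le_trans (ler_normD _ _))// lerD. Qed.

Definition mxsum1 m n (A : 'M[R]_(m, n)) : R := \sum_i \sum_j `|A i j|.

Lemma mxsum1_ge0 m n (A : 'M[R]_(m, n)) : 0 <= mxsum1 A.
Proof. by apply: sumr_ge0 => i _; apply: sumr_ge0. Qed.

Lemma bnd_mxsum1 m n (A : 'M[R]_(m, n)) : bnd (mxsum1 A) A.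
Proof.
move=> i j; rewrite /mxsum1 (bigD1 i)//= (bigD1 j)//= -addrA lerDl.
by rewrite addr_ge0 ?sumr_ge0// => k _; rewrite sumr_ge0.
Qed.

Lemma bnd_mul m n p (M : R) (x : 'M[R]_(m, n)) (A : 'M[R]_(n, p)) :
  bnd M x -> bnd (M * mxsum1 A) (x *m A).
Proof.
move=> xM i j; rewrite mxE (le_trans (ler_norm_sum _ _ _))//.
rewrite /mxsum1 mulr_sumr ler_sum// => k _; rewrite normrM ler_pM//.
by rewrite (bigD1 j)//= lerDl sumr_ge0.
Qed.

End bounded_vectors.

Section mlp_continuity.
Variables (R : realType) (sigma : R -> R).
Hypothesis csigma : continuous sigma.

Lemma sigma_unif_cont (M e : R) : 0 < e ->
  exists2 d : R, 0 < d & forall s t, `|s| <= M -> `|t| <= M -> `|s - t| <= d ->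
    `|sigma s - sigma t| <= e.
Proof.
move=> e0.
have cs : {within `[- M, M], continuous sigma} by apply: continuous_subspaceT.
have [d d0 dP] := compact_unif_cont (@segment_compact R (- M) M) cs e0.
exists (d / 2); first by rewrite divr_gt0.
move=> s t sM tM st; apply/ltW/dP; rewrite /= ?in_itv/= -?ler_norml//.
by rewrite /ball/= (le_lt_trans st)//; lra.
Qed.

Lemma sigma_bnd (M : R) : exists S, forall s, `|s| <= M -> `|sigma s| <= S.
Proof.
have cs : {within `[- M, M], continuous sigma} by apply: continuous_subspaceT.
have [/= S [Sr SP]] := compact_bounded (continuous_compact cs (@segment_compact R (- M) M)).
exists (S + 1) => s sM; apply: (SP (S + 1)); first by rewrite ltrDl.
by exists s => //=; rewrite in_itv/= -ler_norml.
Qed.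

(** This modulus absorbs an error made in front of a network. As [sigma] is merely continuous, there
    is no Lipschitz constant to propagate, and the tolerances are chosen from the last layer
    backwards. *)
Lemma mlp_unif_cont n (g : mlp R n) (M e : R) : 0 < e ->
  exists2 d : R, 0 < d & forall x y, bnd M x -> bnd M y -> bnd d (x - y) ->
    `|mlp_eval sigma g x - mlp_eval sigma g y| <= e.
Proof.
elim: g M e => {n} [n w b|n m W b g IH] M e e0.
  have s0 : 0 < mxsum1 w^T + 1 by rewrite ltr_wpDl ?mxsum1_ge0.
  (* The added 1 keeps the denominator positive when all weights vanish. *)
  exists (e / (mxsum1 w^T + 1)); first by rewrite divr_gt0.
  move=> x y _ _ xy /=; rewrite opprD addrACA subrr addr0.
  have -> : (x *m w^T) 0 0 - (y *m w^T) 0 0 = ((x - y) *m w^T) 0 0.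
    by rewrite mulmxBl !mxE.
  apply: (le_trans (bnd_mul _ xy _ _)).
  by rewrite -mulrA ger_pMr// mulrC ler_pdivrMr// mul1r lerDl.
have bm x : bnd M x -> bnd (M * mxsum1 W + mxsum1 b) (x *m W + b).
  by move=> xM; apply: bndD; [exact: bnd_mul|exact: bnd_mxsum1].
have [S SP] := sigma_bnd (M * mxsum1 W + mxsum1 b).
have [d1 d10 d1P] := IH S e e0.
have [d2 d20 d2P] := sigma_unif_cont (M * mxsum1 W + mxsum1 b) d10.
have s0 : 0 < mxsum1 W + 1 by rewrite ltr_wpDl ?mxsum1_ge0.
exists (d2 / (mxsum1 W + 1)); first by rewrite divr_gt0.
move=> x y xM yM xy /=; apply: d1P.
- by move=> i j; rewrite mxE; apply: SP; apply: bm.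
- by move=> i j; rewrite mxE; apply: SP; apply: bm.
- have E (u v : 'rV[R]_m) i j :
      (map_mx sigma u - map_mx sigma v) i j = sigma (u i j) - sigma (v i j).
    by rewrite !mxE.
  move=> i j; rewrite E; apply: d2P; [exact: bm|exact: bm|].
  have -> : (x *m W + b) i j - (y *m W + b) i j = ((x - y) *m W) i j.
    by rewrite mulmxBl !mxE opprD addrACA subrr addr0.
  apply: (le_trans (bnd_mul _ xy _ _)).
  by rewrite -mulrA ger_pMr// mulrC ler_pdivrMr// mul1r lerDl.
Qed.

End mlp_continuity.

(** * Universal approximation in width D + 4 *)

Section good.
Variables (R : realType) (sigma : R -> R).
Hypothesis csigma : continuous sigma.
Variable w : nat.

(* [F] can be composed in front of any network of width at most [w]: the result
   is approximated, uniformly on bounded sets, by networks of width at most [w]. *)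
Definition good n m (F : 'rV[R]_n -> 'rV[R]_m) :=
  locbdd F /\
  forall (g : mlp R m), (mlp_width g <= w)%N -> forall M e : R, 0 < e ->
  exists g' : mlp R n, (mlp_width g' <= w)%N /\
    forall x, bnd M x -> `|mlp_eval sigma g' x - mlp_eval sigma g (F x)| <= e.

Lemma good_ext n m (F G : 'rV[R]_n -> 'rV[R]_m) : F =1 G -> good F -> good G.
Proof. by move=> /funext ->. Qed.

Lemma good_comp n m p (F : 'rV[R]_n -> 'rV[R]_m) (G : 'rV[R]_m -> 'rV[R]_p) :
  good F -> good G -> good (G \o F).
Proof.
move=> [bF hF] [bG hG]; split.
  move=> M; have [M1 h1] := bF M; have [M2 h2] := bG M1.
  by exists M2 => x xM; apply/h2/h1.
move=> g gw M e e0; have e20 : 0 < e / 2 by rewrite divr_gt0.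
have [M1 h1] := bF M.
have [g1 [g1w g1P]] := hG g gw M1 _ e20.
have [g2 [g2w g2P]] := hF g1 g1w M _ e20.
exists g2; split => // x xM.
rewrite (le_trans (ler_distD (mlp_eval sigma g1 (F x)) _ _))// (splitr e).
by rewrite lerD// ?g2P// g1P//; apply: h1.
Qed.

(** An affine map costs no layer: it merges with the first affine map of the network behind it.
    Hence there is no condition on the dimension [m]. *)
Lemma good_affine n m (A : 'M[R]_(n, m)) (c : 'rV[R]_m) :
  good (fun x => x *m A + c).
Proof.
split.
  move=> M; exists (M * mxsum1 A + mxsum1 c) => x xM.
  by apply: bndD; [exact: bnd_mul|exact: bnd_mxsum1].
move=> g gw M e e0; case: g A c gw => [p v b|p q W b g] A c gw.
  exists (out (v *m A^T) ((c *m v^T) 0 0 + b)); split => // x _ /=.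
  rewrite trmx_mul trmxK mulmxDl mulmxA.
  by rewrite [in X in _ - X]mxE addrA subrr normr0 ltW.
exists (hidden (A *m W) (c *m W + b) g); split => // x _ /=.
by rewrite mulmxDl mulmxA addrA subrr normr0 ltW.
Qed.

Lemma good_layer n k (W : 'M[R]_(n, k)) (b : 'rV[R]_k) : (k <= w)%N ->
  good (fun x => map_mx sigma (x *m W + b)).
Proof.
move=> kw; split.
  move=> M; have [S SP] := sigma_bnd csigma (M * mxsum1 W + mxsum1 b).
  exists S => x xM i j; rewrite mxE; apply: SP.
  by apply: bndD; [exact: bnd_mul|exact: bnd_mxsum1].
move=> g gw M e e0; exists (hidden W b g); split => /=.
  by rewrite geq_max kw.
by move=> x _; rewrite subrr normr0 ltW.
Qed.

(** The network behind [F] is uniformly continuous on the bounded set that contains the values of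
    [F] and, within distance 1, those of its approximants. *)
Lemma good_lim n m (F : 'rV[R]_n -> 'rV[R]_m) : locbdd F ->
  (forall M e : R, 0 < e -> exists F', good F' /\
     forall x, bnd M x -> bnd e (F' x - F x)) -> good F.
Proof.
move=> bF h; split => // g gw M e e0; have e20 : 0 < e / 2 by rewrite divr_gt0.
have [M1 h1] := bF M.
have [d d0 dP] := mlp_unif_cont csigma g (M1 + 1) e20.
have dm : 0 < Num.min d 1 by rewrite lt_min d0 ltr01.
have [F' [[_ gF'] F'P]] := h M _ dm.
have [g' [g'w g'P]] := gF' g gw M _ e20.
exists g'; split => // x xM.
rewrite (le_trans (ler_distD (mlp_eval sigma g (F' x)) _ _))// (splitr e).
rewrite lerD// ?g'P//; apply: dP.
- have -> : F' x = F x + (F' x - F x) by rewrite addrC subrK.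
  apply: bndD; first exact: h1.
  by apply: bnd_ge (F'P _ xM); rewrite ge_min lexx orbT.
- by apply: bnd_ge (h1 _ xM); rewrite lerDl.
- by apply: bnd_ge (F'P _ xM); rewrite ge_min lexx.
Qed.

Variable xt : R.
Hypothesis dsigma : derivable sigma xt 1.
Hypothesis dsigma0 : derive1 sigma xt != 0.

(** The scale [h] depends on [M]: it keeps [h * t] where the difference quotient at [xt] is close to
    the derivative. The tolerance on the quotient is multiplied by [|t| / |s|] in the end, which
    explains the factor [|s| / (|M| + 1)]. *)
Lemma id_approx (M e : R) : 0 < e -> exists2 h, h != 0 & forall t, `|t| <= M ->
  `|(h * derive1 sigma xt)^-1 * (sigma (h * t + xt) - sigma xt) - t| <= e.
Proof.
move=> e0; set s := derive1 sigma xt.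
have M0 : 0 < `|M| + 1 by rewrite ltr_wpDl.
have n0 : 0 < e * `|s| / (`|M| + 1) by rewrite divr_gt0// mulr_gt0// normr_gt0.
have cs : h^-1 *: (sigma (h + xt) - sigma xt) @[h --> 0^'] --> s.
  move: dsigma; rewrite /derivable /s /derive1 /=.
  by under eq_fun do rewrite /= scaler1.
have /nbhs_ballP[r /= r0 rP] : \forall k \near (0:R), k != 0 ->
    `|s - k^-1 *: (sigma (k + xt) - sigma xt)| < e * `|s| / (`|M| + 1).
  by have /fcvgrPdist_lt/(_ _ n0) := cs.
have h0 : 0 < r / (`|M| + 1) by rewrite divr_gt0.
exists (r / 2 / (`|M| + 1)); first by rewrite gt_eqF// !divr_gt0.
set h := r / 2 / (`|M| + 1) => t tM.
have hh : 0 < h by rewrite !divr_gt0.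
have [->|t0] := eqVneq t 0; first by rewrite mulr0 add0r subrr mulr0 subrr normr0 ltW.
have hb : `|h * t| < r.
  have tM' : `|t| <= `|M| + 1 by rewrite (le_trans tM)// (le_trans (ler_norm _))// lerDl.
  rewrite normrM gtr0_norm// (@le_lt_trans _ _ (r / 2))//; last by lra.
  by rewrite /h -mulrA ger_pMr ?divr_gt0// mulrC ler_pdivrMr// mul1r.
have ht0 : h * t != 0 by rewrite mulf_neq0// gt_eqF.
have := rP (h * t); rewrite /ball/= sub0r normrN => /(_ hb ht0).
rewrite /GRing.scale/= => H.
have -> : (h * s)^-1 * (sigma (h * t + xt) - sigma xt) - t =
    - (t / s) * (s - (h * t)^-1 * (sigma (h * t + xt) - sigma xt)).
  by field; rewrite dsigma0 t0 gt_eqF.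
rewrite normrM normrN normrM normfV.
apply: (@le_trans _ _ (`|t| / `|s| * (e * `|s| / (`|M| + 1)))).
  by rewrite ler_wpM2l ?divr_ge0 //; exact: ltW.
have -> : `|t| / `|s| * (e * `|s| / (`|M| + 1)) = e * (`|t| / (`|M| + 1)).
  by field; rewrite gt_eqF//= normr_eq0.
rewrite ger_pMr// ler_pdivrMr// mul1r (le_trans tM)// (le_trans (ler_norm _))//.
by rewrite lerDl.
Qed.

(** One hidden layer: [m] neurons carry [z] through the nearly linear part of [sigma], and one more
    computes the [sigma] term exactly. The next affine map undoes the scaling and adds the multiple
    of [u], so the only error is that of [id_approx]. *)
Lemma good_residual m (a : 'cV[R]_m) (b : R) (u : 'rV[R]_m) : (m.+1 <= w)%N ->
  good (fun z => z + sigma ((z *m a) 0 0 + b) *: u).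
Proof.
move=> mw; apply: good_lim.
  move=> M; have [S SP] := sigma_bnd csigma (M * mxsum1 a + `|b|).
  exists (M + `|S| * mxsum1 u) => x xM; apply: bndD => // i j.
  rewrite mxE normrM ler_pM//; last exact: bnd_mxsum1.
  rewrite (le_trans _ (ler_norm _))//; apply: SP.
  by rewrite (le_trans (ler_normD _ _))// lerD//; apply: bnd_mul.
move=> M e e0; have [h h0 hP] := id_approx M e0.
set s := derive1 sigma xt.
pose W := row_mx (h%:M : 'M[R]_m) a.
pose bb := row_mx (const_mx xt : 'rV[R]_m) (b%:M : 'rV[R]_1).
pose A := col_mx ((h * s)^-1%:M : 'M[R]_m) u.
pose c : 'rV[R]_m := const_mx (- ((h * s)^-1 * sigma xt)).
exists (fun z => map_mx sigma (z *m W + bb) *m A + c); split.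
  apply: (good_comp (good_layer W bb _) (good_affine A c)).
  by rewrite addn1.
move=> x xM i j.
have -> : (map_mx sigma (x *m W + bb) *m A + c - (x + sigma ((x *m a) 0 0 + b) *: u)) i j
   = (h * s)^-1 * (sigma (h * x i j + xt) - sigma xt) - x i j.
  rewrite /W /bb /A mul_mx_row add_row_mx map_row_mx mul_row_col !mul_mx_scalar.
  rewrite [X in X *m u]mx11_scalar mul_scalar_mx.
  have -> : map_mx sigma (x *m a + b%:M) 0 0 = sigma ((x *m a) 0 0 + b).
    by rewrite mxE [X in sigma X]mxE [b%:M 0 0]mxE mulr1n.
  by rewrite !mxE; ring.
by apply: hP.
Qed.

End good.

(** * Continuous functions with vanishing second differences *)

Section midpoint.
Variables (R : realType) (f : R -> R).
Hypothesis cf : continuous f.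
Hypothesis f2 : forall t h, 0 < h -> f (t + 2 * h) - 2 * f (t + h) + f t = 0.

(** Maximum principle. Centre a second difference at a maximum point [c], with a step reaching the
    nearer endpoint: the value at the opposite point is [2 * g c], yet at most [g c]. *)
Lemma midpoint_le0 (g : R -> R) (a b : R) : a <= b -> continuous g ->
  (forall t h, 0 < h -> g (t + 2 * h) - 2 * g (t + h) + g t = 0) ->
  g a = 0 -> g b = 0 -> forall t, a <= t <= b -> g t <= 0.
Proof.
move=> ab cg g2 ga gb t tab.
have [c] := EVT_max ab (continuous_subspaceT cg).
rewrite in_itv/= => /andP[ac cb] cmax.
have cM s : a <= s <= b -> g s <= g c by move=> ?; apply: cmax; rewrite in_itv.
apply: (le_trans (cM _ tab)); rewrite leNgt; apply/negP => gc0.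
have ac' : a < c by rewrite lt_neqAle ac andbT; apply/eqP => E; move: gc0; rewrite -E ga ltxx.
have cb' : c < b by rewrite lt_neqAle cb andbT; apply/eqP => E; move: gc0; rewrite E gb ltxx.
have [h|h] := leP (c - a) (b - c).
- have ca0 : 0 < c - a by rewrite subr_gt0.
  have := g2 a (c - a) ca0.
  have -> : a + (c - a) = c by ring.
  have : g (a + 2 * (c - a)) <= g c by apply: cM; lra.
  lra.
- have bc0 : 0 < b - c by rewrite subr_gt0.
  have := g2 (b - 2 * (b - c)) (b - c) bc0.
  have -> : b - 2 * (b - c) + 2 * (b - c) = b by ring.
  have -> : b - 2 * (b - c) + (b - c) = c by ring.
  have : g (b - 2 * (b - c)) <= g c by apply: cM; lra.
  lra.
Qed.

Lemma midpoint_chord a b t : a < b -> a <= t <= b ->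
  f t * (b - a) = f a * (b - t) + f b * (t - a).
Proof.
move=> ab tab.
pose g s := f s * (b - a) - (f a * (b - s) + f b * (s - a)).
have cg : continuous g.
  move=> x; rewrite /g; apply: cvgB; first by apply: cvgMl; exact: cf.
  by apply: cvgD; apply: cvgMr; apply: cvgB => //; exact: cvg_cst.
have g2 s h : 0 < h -> g (s + 2 * h) - 2 * g (s + h) + g s = 0.
  move=> /(f2 s) E.
  have {}E : f (s + 2 * h) = 2 * f (s + h) - f s by lra.
  by rewrite /g E; ring.
have ga : g a = 0 by rewrite /g; ring.
have gb : g b = 0 by rewrite /g; ring.
have abW := ltW ab.
have h1 := midpoint_le0 abW cg g2 ga gb tab.
have cg' : continuous (fun s => - g s) by move=> x; apply: cvgN; exact: cg.
have h2 : - g t <= 0.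
  apply: (@midpoint_le0 (fun s => - g s) a b) => //.
  - by move=> s h /(g2 s); lra.
  - by rewrite ga oppr0.
  - by rewrite gb oppr0.
by move: h1 h2; rewrite /g; lra.
Qed.

Lemma midpoint_affine : affine_fun f.
Proof.
exists (f 1 - f 0), (f 0) => t.
have [t0|t0] := ltP t 0.
  have := @midpoint_chord t 1 0; rewrite (lt_trans t0 ltr01) (ltW t0) ler01.
  by move=> /(_ isT isT); lra.
have [t1|t1] := leP t 1.
  have := @midpoint_chord 0 1 t; rewrite ltr01 t0 t1 => /(_ isT isT); lra.
have := @midpoint_chord 0 t 1; rewrite (lt_trans ltr01 t1) (ltW t1) ler01.
by move=> /(_ isT isT); lra.
Qed.

End midpoint.

(** * Approximation of the square by translates and dilates of the activation *)

(** The base point moves from [a0] to [a] so that the lemma can be iterated: an antiderivative is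
    known to be continuous only to the right of its own base point. *)
Lemma antiderivative (R : realType) (f : R -> R) (a0 a : R) : a0 < a ->
  (forall x, a0 < x -> {for x, continuous f}) ->
  exists F : R -> R, forall x, a < x -> is_derive x 1 F (f x).
Proof.
move=> a0a cf.
exists (fun x => \int[@lebesgue_measure R]_(t in `[a, x]) f t)%R => x ax.
have xu : x < x + 1 by rewrite ltrDl.
have cw : {within `[a, x + 1], continuous f}.
  apply/subspace_continuousP => y; rewrite /= in_itv/= => /andP[ay _].
  by apply: cvg_within_filter; apply: cf; exact: lt_le_trans ay.
have intf : (@lebesgue_measure R).-integrable `[a, x + 1] (EFin \o f).
  by apply: continuous_compact_integrable => //; exact: segment_compact.
have [|dF <-] := @continuous_FTC1_closed R f a x (x + 1) xu intf ax.
  by apply: cf; exact: lt_trans ax.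
by split => //; rewrite derive1E.
Qed.

Section span.
Variables (R : realType) (sigma : R -> R).

Definition sspan (s : seq (R * R * R)) (t : R) : R :=
  \sum_(p <- s) p.1.1 * sigma (p.1.2 * t + p.2).

Definition apx (a b : R) (q : R -> R) := forall e : R, 0 < e ->
  exists s, forall t, a <= t <= b -> `|q t - sspan s t| <= e.

Lemma sspan_affine s k v b : exists s', forall t, sspan s' t = k * sspan s (v * t + b).
Proof.
exists [seq (k * p.1.1, p.1.2 * v, p.1.2 * b + p.2) | p <- s] => t.
rewrite /sspan big_map mulr_sumr; apply: eq_bigr => p _ /=.
by rewrite mulrDr !mulrA addrA.
Qed.

Lemma sspan_sum n (s : 'I_n -> seq (R * R * R)) :
  exists s', forall t, sspan s' t = \sum_i sspan (s i) t.
Proof.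
exists (flatten [seq s i | i <- enum 'I_n]) => t.
rewrite /sspan big_flatten big_map big_enum /=; exact: eq_bigr.
Qed.

Lemma apx_sigma a b : apx a b sigma.
Proof.
move=> e e0; exists [:: (1, 1, 0)] => t _.
by rewrite /sspan big_seq1 /= !mul1r addr0 subrr normr0 ltW.
Qed.

Lemma apx_sum n a b (q : 'I_n -> R -> R) (k v c : 'I_n -> R) a' b' :
  (forall i t, a <= t <= b -> a' <= v i * t + c i <= b') ->
  (forall i, apx a' b' (q i)) ->
  apx a b (fun t => \sum_i k i * q i (v i * t + c i)).
Proof.
move=> hv hq e e0; pose S := \sum_i `|k i| + 1.
have S0 : 0 < S by rewrite ltr_wpDl// sumr_ge0.
have eS : 0 < e / S by rewrite divr_gt0.
have /choice[s sP] : forall i, exists s, forall t, a' <= t <= b' ->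
    `|q i t - sspan s t| <= e / S by move=> i; exact: hq.
have /choice[s' s'P] : forall i, exists s', forall t,
   sspan s' t = k i * sspan (s i) (v i * t + c i) by move=> i; exact: sspan_affine.
have [s2 s2P] := sspan_sum s'.
exists s2 => t tab; rewrite s2P -sumrB (le_trans (ler_norm_sum _ _ _))//.
apply: (@le_trans _ _ (\sum_i `|k i| * (e / S))).
  apply: ler_sum => i _; rewrite s'P -mulrBr normrM ler_wpM2l// sP//.
  exact: hv.
rewrite -mulr_suml mulrCA ger_pMr// ler_pdivrMr// mul1r /S.
by rewrite lerDl.
Qed.

Lemma apx_lim a b (q : R -> R) : (forall e, 0 < e -> exists q', apx a b q' /\
  forall t, a <= t <= b -> `|q t - q' t| <= e) -> apx a b q.
Proof.
move=> h e e0; have e20 : 0 < e / 2 by rewrite divr_gt0.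
have [q' [aq' q'P]] := h _ e20; have [s sP] := aq' _ e20.
exists s => t tab; rewrite (le_trans (ler_distD (q' t) _ _))// (splitr e).
by rewrite lerD// ?q'P// sP.
Qed.

(** [U (t + h) - U t] is the integral of [u] over [[t, t + h]], and its Riemann sums are
    combinations of translates of [u]. Telescoping and the mean value theorem on each cell give the
    error without any integral. *)
Lemma apx_antiderivative (a b h : R) (u U : R -> R) : 0 < h -> a <= b ->
  (forall t, a <= t <= b + h -> is_derive t 1 U (u t)) ->
  (forall t, a <= t <= b + h -> {for t, continuous u}) ->
  apx a (b + h) u -> apx a b (fun t => U (t + h) - U t).
Proof.
move=> h0 ab dU cu au; apply: apx_lim => e e0.
have cw : {within `[a, b + h], continuous u}.
  by apply/subspace_continuousP => y; rewrite /= in_itv/= => yab; apply: cvg_within_filter; exact: cu.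
have eh : 0 < e / h by rewrite divr_gt0.
have [d d0 dP] := compact_unif_cont (@segment_compact R a (b + h)) cw eh.
pose N := (Num.truncn (h / d)).+1.
have N0 : 0 < N%:R :> R by rewrite ltr0n.
pose n := h / N%:R.
have n0 : 0 < n by rewrite divr_gt0.
have nd : n < d.
  by rewrite /n ltr_pdivrMr// mulrC -ltr_pdivrMr// /N truncnS_gt.
exists (fun t => \sum_(i < N) n * u (1 * t + n * i%:R)); split.
  apply: (@apx_sum N a b (fun=> u) (fun=> n) (fun=> 1) (fun i => n * i%:R) a (b + h)) => //.
  move=> i t /andP[at_ tb]; rewrite mul1r.
  have : n * i%:R <= h by rewrite /n mulrAC ler_pdivrMr// ler_pM2l// ler_nat ltnW.
  have : 0 <= n * i%:R by rewrite mulr_ge0// ltW.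
  lra.
move=> t /andP[at_ tb].
have -> : U (t + h) - U t = \sum_(i < N) (U (t + n * i.+1%:R) - U (t + n * i%:R)).
  rewrite -(big_mkord xpredT (fun i => U (t + n * i.+1%:R) - U (t + n * i%:R))).
  rewrite telescope_sumr//= mulr0 addr0; congr (U (t + _) - _).
  by rewrite /n divfK// gt_eqF.
rewrite -sumrB (le_trans (ler_norm_sum _ _ _))//.
have -> : e = \sum_(i < N) n * (e / h).
  by rewrite sumr_const card_ord -[RHS]mulr_natr /n; field; rewrite !gt_eqF.
apply: ler_sum => i _; rewrite mul1r.
have iN : n * i.+1%:R <= h by rewrite /n mulrAC ler_pdivrMr// ler_pM2l// ler_nat.
have i0 : 0 <= n * i%:R by rewrite mulr_ge0// ltW.
have iS : n * i.+1%:R = n * i%:R + n by rewrite -natr1 mulrDr mulr1.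
have lt1 : t + n * i%:R < t + n * i.+1%:R by rewrite iS; lra.
have [||c] := @MVT R U u _ _ lt1.
- by move=> x; rewrite in_itv/= => /andP[x1 x2]; apply: dU; lra.
- apply/subspace_continuousP => y; rewrite /= in_itv/= => /andP[y1 y2].
  apply: cvg_within_filter; apply: differentiable_continuous; apply/derivable1_diffP.
  by have [] : is_derive y 1 U (u y) by apply: dU; lra.
rewrite in_itv/= => /andP[c1 c2] ->.
have -> : u c * (t + n * i.+1%:R - (t + n * i%:R)) - n * u (t + n * i%:R) =
   n * (u c - u (t + n * i%:R)) by rewrite iS; ring.
rewrite normrM gtr0_norm// ler_pM2l// ltW// dP//=; rewrite ?in_itv/=; try lra.
by rewrite /ball/= gtr0_norm; lra.
Qed.

End span.

Section square.
Variables (R : realType) (sigma : R -> R).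
Hypothesis csigma : continuous sigma.
Hypothesis naff : ~ affine_fun sigma.

Definition diff2 (h : R) (f : R -> R) t := f (t + 2 * h) - 2 * f (t + h) + f t.

Lemma diff2_neq0 : exists h t, 0 < h /\ diff2 h sigma t != 0.
Proof.
apply: contrapT => H; apply: naff; apply: midpoint_affine => // t h h0.
by apply/eqP/negPn/negP => K; apply: H; exists h, t.
Qed.

Lemma is_derive_shiftr (f : R -> R) (t c d : R) :
  is_derive (t + c) 1 f d -> is_derive t 1 (fun s => f (s + c)) d.
Proof.
move=> df; rewrite -(mulr1 d).
apply: (@is_derive1_comp R f (fun s => s + c)) => //.
by rewrite -[X in is_derive _ _ _ X]addr0; apply: is_deriveD.
Qed.

Lemma is_derive_diff2 (h : R) (f f' : R -> R) (t : R) : (forall s, t <= s -> is_derive s 1 f (f' s)) ->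
  0 < h -> is_derive t 1 (diff2 h f) (diff2 h f' t).
Proof.
move=> df h0; apply: is_deriveD; last exact: df.
apply: is_deriveB; first by apply: is_derive_shiftr; apply: df; lra.
by apply: is_deriveZ; apply: is_derive_shiftr; apply: df; lra.
Qed.

(** Two applications of the mean value theorem, to the error in [y] on [[0, y]] and then to [P] on
    [[t0 - c, t0 + c]], so that continuity of the second derivative at [t0] is enough. *)
Lemma second_difference (F P Q : R -> R) (t0 e : R) : 0 < e ->
  (forall t, `|t - t0| < 1 -> is_derive t 1 F (P t)) ->
  (forall t, `|t - t0| < 1 -> is_derive t 1 P (Q t)) ->
  {for t0, continuous Q} ->
  exists2 r, 0 < r & forall y, `|y| <= r ->
    `|F (t0 + y) + F (t0 - y) - 2 * F t0 - Q t0 * y ^+ 2| <= e * y ^+ 2.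
Proof.
move=> e0 dF dP cQ; have e20 : 0 < e / 2 by rewrite divr_gt0.
have /nbhs_ballP[r /= r0 rP] : \forall t \near t0, `|Q t0 - Q t| < e / 2.
  by have /fcvgrPdist_lt/(_ _ e20) := cQ.
pose r' := Num.min (r / 2) (1 / 2).
have r'0 : 0 < r' by rewrite lt_min !divr_gt0.
have r'r : r' < r by rewrite gt_min; apply/orP; left; lra.
have r'1 : r' < 1 by rewrite gt_min; apply/orP; right; lra.
exists r' => //.
pose psi y := F (t0 + y) + F (t0 - y) - 2 * F t0 - Q t0 * y ^+ 2.
have main (y : R) : 0 < y -> y <= r' -> `|psi y| <= e * y ^+ 2.
  move=> y0 yr.
  pose psi' z := P (t0 + z) - P (t0 - z) - 2 * Q t0 * z.
  have dpsi (z : R) : -1 < z < 1 -> is_derive z 1 psi (psi' z).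
    move=> z1.
    have h1 : is_derive z 1 (fun z => F (t0 + z)) (P (t0 + z)).
      under eq_fun do rewrite addrC.
      by apply: is_derive_shiftr; rewrite addrC; apply: dF; rewrite addrAC subrr add0r ltr_norml; lra.
    have h2 : is_derive z 1 (fun z => F (t0 - z)) (- P (t0 - z)).
      rewrite -mulrN1; apply: (@is_derive1_comp R F (fun z => t0 - z)).
        by apply: dF; rewrite addrAC subrr add0r ltr_norml; lra.
      by rewrite -[X in is_derive _ _ _ X]add0r; apply: is_deriveB.
    have h3 : is_derive z 1 (fun z => Q t0 * z ^+ 2) (2 * Q t0 * z).
      rewrite (_ : 2 * Q t0 * z = Q t0 * (2 * z)); last by ring.
      apply: is_deriveZ.
      have h4 := @is_deriveM R R id id z 1 1 1 (is_derive_id _ _) (is_derive_id _ _).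
      rewrite (_ : (fun z : R => z ^+ 2) = id * id); last by apply/funext => ?; rewrite expr2.
      by apply: (is_derive_eq h4); rewrite /GRing.scale/= !mulr1 mulr_natl mulr2n.
    rewrite (_ : psi' z = P (t0 + z) + - P (t0 - z) - 0 - 2 * Q t0 * z); last by rewrite subr0.
    by apply: is_deriveB => //; apply: is_deriveB; apply: is_deriveD.
  have [||c] := @MVT R psi psi' 0 y y0.
  - by move=> z; rewrite in_itv/= => /andP[z1 z2]; apply: dpsi; lra.
  - apply/subspace_continuousP => z; rewrite /= in_itv/= => /andP[z1 z2].
    apply: cvg_within_filter; apply: differentiable_continuous; apply/derivable1_diffP.
    by have [] : is_derive z 1 psi (psi' z) by apply: dpsi; lra.
  rewrite in_itv/= => /andP[c0 cy].
  rewrite {2}/psi addr0 subr0 expr0n/= mulr0 subr0.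
  have -> : F t0 + F t0 - 2 * F t0 = 0 by ring.
  rewrite !subr0 => ->.
  have cc : t0 - c < t0 + c by lra.
  have [||z] := @MVT R P Q _ _ cc.
  - by move=> z; rewrite in_itv/= => /andP[z1 z2]; apply: dP; rewrite ltr_norml; lra.
  - apply/subspace_continuousP => z; rewrite /= in_itv/= => /andP[z1 z2].
    apply: cvg_within_filter; apply: differentiable_continuous; apply/derivable1_diffP.
    have [] // : is_derive z 1 P (Q z) by apply: dP; rewrite ltr_norml; lra.
  rewrite in_itv/= => /andP[z1 z2] E.
  have Qz : `|Q t0 - Q z| < e / 2 by apply: rP; rewrite /ball/= ltr_norml; lra.
  have -> : psi' c = (Q z - Q t0) * (2 * c) by rewrite /psi' E; ring.
  rewrite -mulrA normrM distrC.
  apply: (@le_trans _ _ (e / 2 * `|2 * c * y|)); first by rewrite ler_wpM2r// ltW.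
  rewrite gtr0_norm; last by rewrite !mulr_gt0.
  have : c * y <= y ^+ 2 by rewrite expr2 ler_pM2r// ltW.
  have -> : e / 2 * (2 * c * y) = e * (c * y) by field.
  by move=> ?; rewrite ler_pM2l.
move=> y; rewrite -/(psi y) ler_norml => /andP[y1 y2].
have [y0|y0|->] := ltgtP y 0.
- have := main (- y); rewrite oppr_gt0 y0 sqrrN => /(_ isT) H.
  suff -> : psi y = psi (- y) by apply: H; lra.
  by rewrite /psi opprK sqrrN; ring.
- exact: main.
- rewrite /psi addr0 subr0 expr0n/= !mulr0 subr0.
  by have -> : F t0 + F t0 - 2 * F t0 = 0 by [ring]; rewrite normr0.
Qed.

(** [sigma] may have no second derivative, so it is integrated twice. Differencing the double
    integral [G2] twice with step [h] leads back to limits of combinations of [sigma], now with the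
    continuous second derivative [diff2 h sigma], nonzero at [t0]. A small symmetric second
    difference of this function at [t0] is a multiple of the square up to a small error. *)
Lemma apx_square M : apx sigma (- M) M (fun t => t ^+ 2).
Proof.
have [h [t0 [h0 A0]]] := diff2_neq0.
(* [diff2] looks only to the right, so base points to the left of [t0 - 1] suffice for all
   derivatives needed on [[t0 - 1, t0 + 1]]. *)
have [|G dG] := @antiderivative R sigma (t0 - 4) (t0 - 3) _ (fun x _ => csigma (x := x)).
  lra.
have cG (x : R) : t0 - 3 < x -> {for x, continuous G}.
  move=> /dG [dGx _]; apply: differentiable_continuous; exact/derivable1_diffP.
have [|G2 dG2] := @antiderivative R G (t0 - 3) (t0 - 2) _ cG; first lra.
pose F := diff2 h G2.
have aF : apx sigma (t0 - 1) (t0 + 1) F.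
  have a1 : apx sigma (t0 - 1) (t0 + 1 + h) (fun t => G (t + h) - G t).
    apply: (apx_antiderivative (u := sigma)) => //; first by lra.
    - by move=> t /andP[t1 t2]; apply: dG; lra.
    - by move=> t _; exact: csigma.
    - exact: apx_sigma.
  have -> : F = fun t => (G2 (t + h + h) - G2 (t + h)) - (G2 (t + h) - G2 t).
    by apply/funext => t; rewrite /F /diff2 (_ : t + h + h = t + 2 * h); ring.
  apply: (@apx_antiderivative _ _ _ _ h (fun t => G (t + h) - G t)
    (fun t => G2 (t + h) - G2 t)) => //; first by lra.
  - move=> t /andP[t1 t2]; apply: is_deriveB; last by apply: dG2; lra.
    by apply: is_derive_shiftr; apply: dG2; lra.
  - move=> t /andP[t1 t2]; apply: cvgB; last by apply: cG; lra.
    apply: (@continuous_comp _ _ _ (fun t => t + h)).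
      by apply: cvgD => //; exact: cvg_cst.
    by apply: cG; lra.
set A := diff2 h sigma t0 in A0.
apply: apx_lim => e e0.
have nA : 0 < `|A| by rewrite normr_gt0.
have M1 : 0 < `|M| + 1 by rewrite ltr_wpDl.
have e1 : 0 < e * `|A| / (`|M| + 1) ^+ 2 by rewrite divr_gt0 ?exprn_gt0// mulr_gt0.
have [||| r r0 rP] := @second_difference F (diff2 h G) (diff2 h sigma) t0 _ e1.
- move=> t; rewrite ltr_norml => /andP[t1 t2]; apply: is_derive_diff2 => // s ts.
  by apply: dG2; lra.
- move=> t; rewrite ltr_norml => /andP[t1 t2]; apply: is_derive_diff2 => // s ts.
  by apply: dG; lra.
- apply: cvgD; last exact: csigma.
  apply: cvgB; last apply: cvgMr.
    by apply: (@continuous_comp _ _ _ (fun t => t + _)); [apply: cvgD => //; exact: cvg_cst|exact: csigma].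
  by apply: (@continuous_comp _ _ _ (fun t => t + _)); [apply: cvgD => //; exact: cvg_cst|exact: csigma].
(* For [|t| <= M], [s * t] stays within the radius [r] of the expansion and within distance 1 of
   zero, where [aF] applies. *)
pose s := Num.min r 1 / (`|M| + 1).
have m0 : 0 < Num.min r 1 by rewrite lt_min r0 ltr01.
have s0 : 0 < s by rewrite divr_gt0.
have sM t : - M <= t <= M -> `|s * t| <= Num.min r 1.
  rewrite -ler_norml => tM; rewrite normrM gtr0_norm// /s -mulrA ger_pMr//.
  rewrite mulrC ler_pdivrMr// mul1r (le_trans tM)// (le_trans (ler_norm _))//.
  by rewrite lerDl.
pose kk := [:: (A * s ^+ 2)^-1; (A * s ^+ 2)^-1; - (2 * (A * s ^+ 2)^-1)].
pose vv := [:: s; - s; 0].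
exists (fun t => \sum_(i < 3) kk`_i * F (vv`_i * t + t0)); split.
  apply: (@apx_sum _ sigma 3 (- M) M (fun=> F) (fun i => kk`_i) (fun i => vv`_i)
    (fun=> t0) (t0 - 1) (t0 + 1)) => // i t /sM.
  rewrite le_min => /andP[_]; rewrite ler_norml => /andP[h1 h2].
  by case: i => -[|[|[|//]]] /= _; lra.
move=> t tM; rewrite 3!big_ord_recl big_ord0 /=.
rewrite mul0r add0r addr0.
have := sM _ tM; rewrite le_min => /andP[+ _] => /rP.
rewrite -/A => H.
have -> : t ^+ 2 - ((A * s ^+ 2)^-1 * F (s * t + t0) +
    ((A * s ^+ 2)^-1 * F (- s * t + t0) + - (2 * (A * s ^+ 2)^-1) * F t0)) =
  - (A * s ^+ 2)^-1 * (F (t0 + s * t) + F (t0 - s * t) - 2 * F t0 - A * (s * t) ^+ 2).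
  rewrite (addrC t0 (s * t)) (_ : t0 - s * t = - s * t + t0); last by ring.
  by field; rewrite A0 gt_eqF.
rewrite normrM normrN normfV normrM [`|s ^+ 2|]gtr0_norm ?exprn_gt0//.
rewrite mulrC ler_pdivrMr; last by rewrite mulr_gt0// exprn_gt0.
apply: (le_trans H).
have -> : e * `|A| / (`|M| + 1) ^+ 2 * (s * t) ^+ 2 =
  e * (`|A| * s ^+ 2) * (t ^+ 2 / (`|M| + 1) ^+ 2) by field; rewrite gt_eqF.
rewrite ger_pMr; last by rewrite !mulr_gt0// exprn_gt0.
rewrite ler_pdivrMr ?exprn_gt0// mul1r -real_normK ?num_real//.
rewrite lerXn2r// ?nnegrE ?(ltW M1)//.
by move: tM; rewrite -ler_norml => tM; rewrite (le_trans tM)// (le_trans (ler_norm _))// lerDl.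
Qed.

End square.

(** * Polynomials computed with three registers *)

Section registers.
Variables (R : realType) (sigma : R -> R) (xt : R) (D : nat).
Hypothesis csigma : continuous sigma.
Hypothesis naff : ~ affine_fun sigma.
Hypothesis dsigma : derivable sigma xt 1.
Hypothesis dsigma0 : derive1 sigma xt != 0.

Local Notation good := (good sigma (D + 4)).

(** Adding a multiple of [u] leaves [z *m a] unchanged because [u *m a = 0], so the terms of the
    combination can be added one residual map at a time. *)
Lemma good_residual_sspan (s : seq (R * R * R)) (a : 'cV[R]_(D + 3)) (u : 'rV[R]_(D + 3)) :
  u *m a = 0 -> good (fun z => z + sspan sigma s ((z *m a) 0 0) *: u).
Proof.
move=> ua; elim: s => [|p s IH].
  apply: (good_ext (F := fun z => z *m 1%:M + 0)); last exact: good_affine.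
  by move=> z; rewrite mulmx1 /sspan big_nil scale0r.
have h : ((D + 3).+1 <= D + 4)%N by rewrite -addnS.
apply: good_ext (good_comp IH (good_residual csigma dsigma dsigma0
  (p.1.2 *: a) p.2 (p.1.1 *: u) h)) => z /=.
rewrite -scalemxAr mulmxDl -scalemxAl ua scaler0 addr0.
have -> : (p.1.2 *: (z *m a)) 0 0 = p.1.2 * (z *m a) 0 0 by rewrite mxE.
rewrite scalerA -addrA -scalerDl /sspan big_cons; congr (z + _ *: u).
by rewrite addrC mulrC.
Qed.

Lemma good_residual_square (k b : R) (a : 'cV[R]_(D + 3)) (u : 'rV[R]_(D + 3)) :
  u *m a = 0 -> good (fun z => z + (k * ((z *m a) 0 0 + b) ^+ 2) *: u).
Proof.
move=> ua; apply: (good_lim csigma).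
  move=> M; exists (M + `|k| * (M * mxsum1 a + `|b|) ^+ 2 * mxsum1 u) => z zM.
  apply: bndD => // i j.
  rewrite mxE normrM ler_pM//; last exact: bnd_mxsum1.
  rewrite normrM ler_wpM2l// normrX lerXn2r// ?nnegrE//.
    by rewrite addr_ge0// (le_trans (normr_ge0 ((z *m a) 0 0)) (bnd_mul a zM 0 0)).
  by rewrite (le_trans (ler_normD _ _))// lerD//; apply: bnd_mul.
move=> M e e0; pose S := mxsum1 u * `|k| + 1.
have S0 : 0 < S by rewrite ltr_wpDl// mulr_ge0// mxsum1_ge0.
have eS : 0 < e / S by rewrite divr_gt0.
have [s sP] := apx_square csigma naff (M * mxsum1 a + `|b|) eS.
have [s' s'P] := sspan_affine sigma s k 1 b.
exists (fun z => z + sspan sigma s' ((z *m a) 0 0) *: u); split.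
  exact: good_residual_sspan.
move=> z zM i j; rewrite opprD addrACA subrr add0r -scalerBl mxE s'P mul1r -mulrBr.
have H : - (M * mxsum1 a + `|b|) <= (z *m a) 0 0 + b <= M * mxsum1 a + `|b|.
  by rewrite -ler_norml (le_trans (ler_normD _ _))// lerD//; apply: bnd_mul.
have {}H := sP _ H.
rewrite !normrM distrC; apply: (@le_trans _ _ (`|k| * (e / S) * mxsum1 u)).
  by rewrite ler_pM ?mulr_ge0// ?ler_wpM2l//; apply: bnd_mxsum1.
have -> : `|k| * (e / S) * mxsum1 u = e * (mxsum1 u * `|k| / S) by ring.
by rewrite ger_pMr// ler_pdivrMr// mul1r lerDl.
Qed.

(* The input x followed by three registers: the running sum, the running
   product and a scratch cell. *)
Definition state (x : 'rV[R]_D) (s a b : R) : 'rV[R]_(D + 3) :=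
  row_mx x (\row_(i < 3) [:: s; a; b]`_i).

Definition e3 (i : 'I_3) : 'rV[R]_(D + 3) := row_mx 0 (delta_mx 0 i).

Lemma stateD x s a b s' a' b' :
  state x s a b + row_mx 0 (\row_(i < 3) [:: s'; a'; b']`_i)
  = state x (s + s') (a + a') (b + b').
Proof.
rewrite /state add_row_mx addr0; congr row_mx; apply/rowP => i; rewrite !mxE.
by case: i => -[|[|[|//]]].
Qed.

Lemma e3_scale k (i : 'I_3) :
  k *: e3 i = row_mx 0 (\row_(j < 3) (k * (i == j)%:R)).
Proof.
rewrite /e3 scale_row_mx scaler0; congr row_mx; apply/rowP => j.
by rewrite !mxE eqxx /= eq_sym.
Qed.

Lemma stateD_scratch x s a b k :
  state x s a b + k *: e3 (inord 2) = state x s a (b + k).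
Proof.
rewrite e3_scale.
rewrite (_ : \row_(j < 3) _ = \row_(i < 3) [:: 0; 0; k]`_i) ?stateD ?addr0//.
apply/rowP => i; rewrite !mxE -val_eqE/= inordK//.
by case: i => -[|[|[|//]]] /= _; rewrite ?mulr0 ?mulr1.
Qed.

(** The scratch cell has weight zero: writing into it does not disturb the reading. *)
Definition readout (v : 'rV[R]_D) (k : R) : 'cV[R]_(D + 3) :=
  col_mx v^T (\col_(i < 3) [:: 0; k; 0]`_i).

Lemma readout_state v k x s a b :
  (state x s a b *m readout v k) 0 0 = (x *m v^T) 0 0 + k * a.
Proof.
rewrite mul_row_col mxE; congr (_ + _); rewrite mxE 3!big_ord_recl big_ord0 !mxE /=.
by rewrite !mulr0 add0r !addr0 mulrC.
Qed.

Lemma readout_scratch v k : e3 (inord 2) *m readout v k = 0.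
Proof.
apply/matrixP => i j; rewrite !ord1 mul_row_col mul0mx add0r mxE.
rewrite 3!big_ord_recl big_ord0 !mxE /= -!val_eqE /= inordK//=.
by rewrite !mul0r mulr0 !addr0.
Qed.

Lemma good_registers (A : nat -> nat -> R) (c : nat -> R) :
  exists F, good F /\ forall x s a b, F (state x s a b) =
    state x (s * A 0%N 0%N + a * A 1%N 0%N + b * A 2%N 0%N + c 0%N)
            (s * A 0%N 1%N + a * A 1%N 1%N + b * A 2%N 1%N + c 1%N)
            (s * A 0%N 2%N + a * A 1%N 2%N + b * A 2%N 2%N + c 2%N).
Proof.
exists (fun z => z *m block_mx 1%:M 0 0 (\matrix_(i < 3, j < 3) A i j)
  + row_mx 0 (\row_(i < 3) c i)); split; first exact: good_affine.
move=> x s a b; rewrite /state mul_row_block !mulmx0 mulmx1 addr0 add0r.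
rewrite add_row_mx addr0; congr row_mx; apply/rowP => i.
rewrite [LHS]mxE [X in X + _]mxE 3!big_ord_recl big_ord0 !mxE /= !addr0 !addrA.
by case: i => -[|[|[|//]]].
Qed.

(* a * l = ((a + l)^2 - (a - l)^2) / 4 is accumulated in the scratch cell. *)
Lemma good_mul (v : 'rV[R]_D) (v0 : R) : exists F, good F /\
  forall x s a, F (state x s a 0) = state x s (a * ((x *m v^T) 0 0 + v0)) 0.
Proof.
(* Keep the sum, overwrite the product register by the scratch cell, and clear the latter for the
   next factor. *)
have [F3 [gF3 F3P]] := good_registers (fun i j =>
  ((i == 0) && (j == 0) || (i == 2) && (j == 1))%N%:R) (fun=> 0).
have r := readout_scratch v.
have g1 := good_residual_square (1 / 4) v0 (r 1).
have g2 := good_residual_square (- (1 / 4)) v0 (r (- 1)).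
eexists; split; first exact: (good_comp (good_comp g1 g2) gF3).
move=> x s a /=; rewrite readout_state stateD_scratch readout_state stateD_scratch F3P /=.
by congr state; field.
Qed.

Lemma good_add (k : R) : exists F, good F /\
  forall x s a, F (state x s a 0) = state x (s + k * a) 1 0.
Proof.
have [F [gF FP]] := good_registers (fun i j =>
  if j == 0%N then [:: 1; k; 0]`_i else 0) (fun j => (j == 1%N)%:R).
exists F; split => // x s a; rewrite FP /=.
by congr state; ring.
Qed.

(** Products of affine forms instead of monomials: the registers multiply by one affine form at a
    time, and Bernstein weights come factored in this way. *)
Definition lprod (ls : seq ('rV[R]_D * R)) (x : 'rV[R]_D) : R :=
  \prod_(l <- ls) ((x *m l.1^T) 0 0 + l.2).

Definition lpoly (p : seq (R * seq ('rV[R]_D * R))) (x : 'rV[R]_D) : R :=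
  \sum_(m <- p) m.1 * lprod m.2 x.

Lemma good_lprod ls : exists F, good F /\
  forall x s a, F (state x s a 0) = state x s (a * lprod ls x) 0.
Proof.
elim: ls => [|[v v0] ls [F [gF FP]]].
  exists (fun z => z *m 1%:M + 0); split; first exact: good_affine.
  by move=> x s a; rewrite mulmx1 addr0 /lprod big_nil mulr1.
have [G [gG GP]] := good_mul v v0.
exists (F \o G); split; first exact: good_comp.
by move=> x s a; rewrite /= GP FP /lprod big_cons mulrA.
Qed.

Lemma good_lpoly p : exists F, good F /\
  forall x s, F (state x s 1 0) = state x (s + lpoly p x) 1 0.
Proof.
elim: p => [|[k ls] p [F [gF FP]]].
  exists (fun z => z *m 1%:M + 0); split; first exact: good_affine.
  by move=> x s; rewrite mulmx1 addr0 /lpoly big_nil addr0.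
have [G [gG GP]] := good_lprod ls; have [H [gH HP]] := good_add k.
exists (F \o (H \o G)); split; first exact: good_comp (good_comp gG gH) gF.
by move=> x s; rewrite /= GP HP FP mul1r /lpoly big_cons /= addrA.
Qed.

Lemma mlp_lpoly p (M e : R) : 0 < e -> exists g : mlp R D,
  (mlp_width g <= D + 4)%N /\
  forall x, bnd M x -> `|mlp_eval sigma g x - lpoly p x| <= e.
Proof.
move=> e0; have [F [gF FP]] := good_lpoly p.
pose emb (x : 'rV[R]_D) : 'rV[R]_(D + 3) :=
  x *m row_mx 1%:M 0 + row_mx 0 (\row_(i < 3) [:: 0; 1; 0]`_i).
have embE x : emb x = state x 0 1 0.
  by rewrite /emb mul_mx_row mulmx1 mulmx0 add_row_mx addr0 add0r.
have [_ gFe] := good_comp (good_affine sigma (D + 4) _ _ : good emb) gF.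
have [g [gw gP]] := gFe (out (e3 (inord 0)) 0) isT M e e0.
exists g; split => // x /gP; rewrite /= embE FP add0r addr0.
rewrite (_ : (_ *m _) 0 0 = lpoly p x)//.
rewrite /e3 tr_row_mx trmx0 mul_row_col mulmx0 add0r mxE.
rewrite 3!big_ord_recl big_ord0 !mxE -!val_eqE /= !inordK//=.
by rewrite mulr1 !mulr0 !addr0.
Qed.

End registers.

(** * Bernstein approximation of Lipschitz functions *)

Section bernstein.
Variables (R : realType) (P : finType) (t : P -> R).
Hypothesis t01 : forall p, 0 <= t p <= 1.

(** The probability of the outcome [w] of independent Bernoulli trials with parameters [t p].
    Keeping the trials apart avoids binomial coefficients. *)
Definition bweight (w : {ffun P -> bool}) : R :=
  \prod_p (if w p then t p else 1 - t p).

Definition bdev (w : {ffun P -> bool}) p : R := (w p)%:R - t p.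

Lemma bweight_ge0 w : 0 <= bweight w.
Proof. by apply: prodr_ge0 => p _; have := t01 p; case: (w p); lra. Qed.

Lemma bweight_sum1 : \sum_w bweight w = 1.
Proof.
rewrite /bweight -(bigA_distr_bigA (fun p (b : bool) => if b then t p else 1 - t p)).
by apply: big1 => p _; rewrite big_bool /=; ring.
Qed.

Lemma bweight_cov p q :
  \sum_w bweight w * (bdev w p * bdev w q) = (p == q)%:R * (t p * (1 - t p)).
Proof.
(* Independence: with the summand written as a product over the trials, the sum over outcomes
   factors. *)
pose F r (b : bool) := (if b then t r else 1 - t r) *
  ((if r == p then b%:R - t r else 1) * (if r == q then b%:R - t r else 1)).
have E w : bweight w * (bdev w p * bdev w q) = \prod_r F r (w r).
  rewrite /F !big_split /=; congr (_ * (_ * _)).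
    by rewrite -big_mkcond big_pred1_eq.
  by rewrite -big_mkcond big_pred1_eq.
under eq_bigr do rewrite E.
rewrite -(bigA_distr_bigA F) (bigD1 p)//= big_bool /= {1 2}/F eqxx /=.
have [pq|pq] := eqVneq p q; last by rewrite /= mul0r; ring.
rewrite big1 => [|r rq]; first by rewrite mul1r; ring.
by rewrite big_bool /F /= -pq (negbTE rq) /=; ring.
Qed.

Lemma bweight_var (S : seq P) : uniq S ->
  \sum_w bweight w * (\sum_(p <- S) bdev w p) ^+ 2 <= (size S)%:R.
Proof.
move=> uS.
have -> : \sum_w bweight w * (\sum_(p <- S) bdev w p) ^+ 2 =
    \sum_(p <- S) \sum_(q <- S) \sum_w bweight w * (bdev w p * bdev w q).
  under [RHS]eq_bigr do rewrite exchange_big.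
  rewrite [RHS]exchange_big; apply: eq_bigr => w _.
  rewrite expr2 big_distrlr /= mulr_sumr; apply: eq_bigr => p _.
  by rewrite mulr_sumr.
rewrite -sum1_size natr_sum big_seq [leRHS]big_seq; apply: ler_sum => p pS.
under eq_bigr do rewrite bweight_cov.
rewrite (bigD1_seq p)//= big1 => [|q qp]; last by rewrite eq_sym (negbTE qp) mul0r.
rewrite eqxx mul1r addr0.
by have /andP[a b] := t01 p; rewrite mulr_ile1//; lra.
Qed.

End bernstein.

Section lipschitz_approx.
Variables (R : realType) (D : nat).

Definition dist1 (x y : 'rV[R]_D) : R := \sum_i `|x 0 i - y 0 i|.

Lemma dist1_triangle x y z : dist1 x z <= dist1 x y + dist1 y z.
Proof. by rewrite -big_split; apply: ler_sum => i _; exact: ler_distD. Qed.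

Lemma dist1_sym x y : dist1 x y = dist1 y x.
Proof. by apply: eq_bigr => i _; exact: distrC. Qed.

(** Each coordinate of [y], rescaled to a probability, is estimated by [n] trials, and the
    polynomial is the expectation of [f] at the empirical point [z w]. In place of a Chebyshev
    splitting, [|s| <= th + s^2 / th] is averaged, so that only variances occur. *)
Lemma lpoly_approx (f : 'rV[R]_D -> R) (N M e : R) : 0 < N -> 0 < M -> 0 < e ->
  (forall x y, `|f x - f y| <= N * dist1 x y) ->
  exists p, forall y, bnd M y -> `|lpoly p y - f y| <= e.
Proof.
move=> N0 M0 e0 fN.
(* [th] makes the constant part [N * D * th] at most [e / 2]; the variance part is [Q / n], and [n]
   is chosen to make it at most [e / 2] too. *)
pose th := e / (2 * (N * D%:R + 1)).
have ND : 0 <= N * D%:R by rewrite mulr_ge0// ltW.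
have th0 : 0 < th by rewrite divr_gt0// mulr_gt0// ltr_wpDl.
pose Q := 4 * N * D%:R * M ^+ 2 / th.
have Q0 : 0 <= Q by rewrite divr_ge0 ?(ltW th0)// !mulr_ge0 ?(ltW N0)// ?exprn_ge0 // ltW.
pose n := (Num.truncn (Q / (e / 2))).+1.
have n0 : 0 < n%:R :> R by rewrite ltr0n.
have nQ : Q / n%:R <= e / 2.
  rewrite ler_pdivrMr// mulrC -ler_pdivrMr ?divr_gt0// ltW// /n truncnS_gt//.
pose P : finType := ('I_D * 'I_n)%type.
pose z (w : {ffun P -> bool}) : 'rV[R]_D :=
  \row_i (- M + 2 * M / n%:R * \sum_(j < n) (w (i, j))%:R).
pose form (b : bool) (i : 'I_D) : 'rV[R]_D * R :=
  (((-1) ^+ (~~ b) / (2 * M)) *: delta_mx 0 i, 1 / 2).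
exists [seq (f (z w), [seq form (w q) q.1 | q <- enum P]) | w <- enum {ffun P -> bool}].
move=> y yM; pose t (q : P) := (y 0 q.1 + M) / (2 * M).
have t01 q : 0 <= t q <= 1.
  have := yM 0 q.1; rewrite ler_norml => /andP[y1 y2].
  by rewrite /t divr_ge0 ?ler_pdivrMr; lra.
have formE b q : (y *m (form b q.1).1^T) 0 0 + (form b q.1).2 = if b then t q else 1 - t q.
  rewrite /form /= linearZ /= trmx_delta -scalemxAr mxE -colE mxE /t.
  by case: b; rewrite ?expr0 ?expr1; field; rewrite gt_eqF.
have -> : lpoly [seq (f (z w), [seq form (w q) q.1 | q <- enum P])
    | w <- enum {ffun P -> bool}] y = \sum_w bweight t w * f (z w).
  rewrite /lpoly big_map big_enum /=; apply: eq_bigr => w _.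
  rewrite mulrC /lprod big_map big_enum /=; congr (_ * _).
  by apply: eq_bigr => q _; rewrite formE.
have -> : f y = \sum_w bweight t w * f y by rewrite -mulr_suml bweight_sum1 mul1r.
rewrite -sumrB (le_trans (ler_norm_sum _ _ _))//.
pose S i : seq P := [seq (i, j) | j <- enum 'I_n].
have zE w i : z w 0 i - y 0 i = 2 * M / n%:R * \sum_(q <- S i) bdev t w q.
  rewrite mxE big_map big_enum /= /bdev sumrB /t /= sumr_const card_ord /=.
  rewrite mulrBr -[(_ / _) *+ n]mulr_natr.
  by field; rewrite !gt_eqF.
have dev w : `|f (z w) - f y| <=
    N * \sum_i (th + (2 * M / n%:R) ^+ 2 / th * (\sum_(q <- S i) bdev t w q) ^+ 2).
  apply: (le_trans (fN _ _)); rewrite ler_pM2l//; apply: ler_sum => i _.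
  rewrite zE; set s := _ * \sum_(q <- S i) _.
  have -> : (2 * M / n%:R) ^+ 2 / th * (\sum_(q <- S i) bdev t w q) ^+ 2 = `|s| ^+ 2 / th.
    by rewrite real_normK ?num_real// /s exprMn; ring.
  have [sth|sth] := leP `|s| th.
    by rewrite ler_wpDr// divr_ge0 ?(ltW th0)// exprn_ge0.
  by rewrite ler_wpDl ?(ltW th0)// ler_pdivlMr// expr2 ler_pM2l ?(lt_trans th0)// ltW.
apply: (@le_trans _ _ (\sum_w bweight t w * (N * \sum_i (th + (2 * M / n%:R) ^+ 2 / th *
    (\sum_(q <- S i) bdev t w q) ^+ 2)))).
  apply: ler_sum => w _; rewrite -mulrBr normrM ger0_norm ?bweight_ge0//.
  by rewrite ler_wpM2l ?bweight_ge0.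
have -> : \sum_w bweight t w * (N * \sum_i (th + (2 * M / n%:R) ^+ 2 / th *
    (\sum_(q <- S i) bdev t w q) ^+ 2)) =
  N * \sum_i (th + (2 * M / n%:R) ^+ 2 / th *
     \sum_w bweight t w * (\sum_(q <- S i) bdev t w q) ^+ 2).
  under eq_bigr do rewrite mulrCA mulr_sumr.
  rewrite -mulr_sumr exchange_big /=; congr (N * _); apply: eq_bigr => i _.
  under eq_bigr do rewrite mulrDr (mulrCA _ (_ / th)).
  by rewrite big_split /= -mulr_suml bweight_sum1 mul1r -mulr_sumr.
apply: (@le_trans _ _ (N * \sum_(i < D) (th + (2 * M / n%:R) ^+ 2 / th * n%:R))).
  rewrite ler_pM2l//; apply: ler_sum => i _; rewrite lerD2l ler_wpM2l//.
    by rewrite divr_ge0 ?(ltW th0)// exprn_ge0// divr_ge0 ?mulr_ge0 ?(ltW M0).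
  have := @bweight_var R P t t01 (S i); rewrite size_map size_enum_ord; apply.
  by rewrite map_inj_uniq ?enum_uniq// => a b [].
rewrite sumr_const card_ord -[X in N * X]mulr_natr.
have -> : N * ((th + (2 * M / n%:R) ^+ 2 / th * n%:R) * D%:R) = N * D%:R * th + Q / n%:R.
  by rewrite /Q; field; rewrite !gt_eqF.
rewrite (splitr e) lerD// /th mulrA ler_pdivrMr; last by rewrite mulr_gt0// ltr_wpDl.
have -> : e / 2 * (2 * (N * D%:R + 1)) = N * D%:R * e + e by field.
by rewrite lerDl ltW.
Qed.

(* [y |-> inf_{z in Y} (f z + N * dist1 y z)] is [N]-Lipschitz and, for large
   [N], uniformly close to [f] on [Y]. *)
Lemma lipschitz_extension (Y : set 'rV[R]_D) (f : 'rV[R]_D -> R) (B d e : R) :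
  Y !=set0 -> 0 < d -> 0 <= e -> (forall y, Y y -> `|f y| <= B) ->
  (forall x y, Y x -> Y y -> bnd d (x - y) -> `|f x - f y| <= e) ->
  exists F N, [/\ 0 < N, (forall x y, `|F x - F y| <= N * dist1 x y) &
    forall y, Y y -> `|F y - f y| <= e].
Proof.
move=> [y0 Yy0] d0 e0 fB fd.
have B0 : 0 <= B by apply: le_trans (fB _ Yy0).
(* A point of [Y] not within [d] of [y] then pays at least [2 * B], the largest possible drop of
   [f]. *)
pose N := 2 * B / d + 1.
have N0 : 0 < N by rewrite ltr_wpDl// divr_ge0 ?mulr_ge0// ltW.
have dist_ge0 x y : 0 <= dist1 x y by apply: sumr_ge0.
pose E x := [set f y + N * dist1 x y | y in Y].
have Elb x : has_lbound (E x).
  exists (- B) => _ [y Yy <-]; have := fB _ Yy; rewrite ler_norml => /andP[h _].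
  by rewrite -[- B]addr0 lerD// mulr_ge0// ltW.
have En x : E x !=set0 by exists (f y0 + N * dist1 x y0), y0.
pose F x := inf (E x).
have FL x y : F x <= F y + N * dist1 x y.
  rewrite -lerBlDr; apply: lb_le_inf => // _ [z Yz <-].
  rewrite lerBlDr; apply: (@le_trans _ _ (f z + N * dist1 x z)).
    by apply: ge_inf => //; exists z.
  rewrite -addrA lerD2l -mulrDr ler_pM2l// addrC; exact: dist1_triangle.
exists F, N; split => //.
  move=> x y; rewrite ler_distl; have h1 := FL x y; have h2 := FL y x.
  by rewrite dist1_sym in h2; rewrite lerBlDr h2 h1.
move=> y Yy; rewrite ler_distl; apply/andP; split; last first.
  apply: (@le_trans _ _ (f y)); last by rewrite lerDl.
  apply: ge_inf => //; exists y => //.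
  rewrite [dist1 y y]big1 ?mulr0 ?addr0// => i _.
  by rewrite subrr normr0.
apply: lb_le_inf => // _ [z Yz <-].
have [yz|/existsNP[i /existsNP[j /negP]]] := pselect (bnd d (y - z)).
  have := fd _ _ Yy Yz yz; rewrite ler_distlC => /andP[h _].
  by rewrite ler_wpDr// mulr_ge0// ltW.
rewrite -ltNge !ord1 !mxE => dl.
have dd : d <= dist1 y z.
  by rewrite /dist1 (bigD1 j)//= ler_wpDr ?sumr_ge0// ltW.
have h1 : 2 * B <= N * dist1 y z.
  apply: (@le_trans _ _ (N * d)); last by rewrite ler_pM2l.
  have -> : N * d = 2 * B + d by rewrite /N; field; rewrite gt_eqF.
  by rewrite lerDl ltW.
have := fB _ Yy; have := fB _ Yz; rewrite !ler_norml => /andP[a1 a2] /andP[b1 b2].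
lra.
Qed.

End lipschitz_approx.

Theorem mlp_universal (R : realType) (sigma : R -> R) (xt : R) (D : nat)
    (Y : set 'rV[R]_D) (f : 'rV[R]_D -> R) (M B e : R) :
  continuous sigma -> ~ affine_fun sigma -> derivable sigma xt 1 ->
  derive1 sigma xt != 0 ->
  (forall y, Y y -> bnd M y) -> (forall y, Y y -> `|f y| <= B) ->
  (forall e, 0 < e -> exists2 d, 0 < d &
     forall x y, Y x -> Y y -> bnd d (x - y) -> `|f x - f y| <= e) ->
  0 < e ->
  exists g : mlp R D, (mlp_width g <= D + 4)%N /\
    forall y, Y y -> `|mlp_eval sigma g y - f y| <= e.
Proof.
move=> cs na ds ds0 YM fB fu e0.
have [[y0 Yy0]|/set0P/negP/negPn/eqP ->] := pselect (Y !=set0); last first.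
  by exists (out 0 0); split => // y.
have e3 : 0 < e / 3 by rewrite divr_gt0.
have [d d0 dP] := fu _ e3.
have [|F [N [N0 FN Ff]]] := @lipschitz_extension R D Y f B d _ _ d0 (ltW e3) fB dP.
  by exists y0.
have M0 : 0 < `|M| + 1 by rewrite ltr_wpDl.
have [p pP] := lpoly_approx N0 M0 e3 FN.
have [g [gw gP]] := mlp_lpoly cs na ds ds0 p (`|M| + 1) e3.
exists g; split => // y Yy.
have yM : bnd (`|M| + 1) y.
  by apply: bnd_ge (YM _ Yy); rewrite (le_trans (ler_norm _))// lerDl.
have -> : e = e / 3 + (e / 3 + e / 3) by field.
rewrite (le_trans (ler_distD (lpoly p y) _ _))// lerD ?gP//.
by rewrite (le_trans (ler_distD (F y) _ _))// lerD ?pP// Ff.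
Qed.

(** * Near-optimal plans for positive functionals *)

Section bounded_measurable.
Variable R : realType.

Definition bb d (T : measurableType d) (f : T -> R) : Prop :=
  measurable_fun setT f /\ exists C, forall x, `|f x| <= C.

(** The uniform positive lower bound makes logarithms and inverses bounded again. *)
Definition bbp d (T : measurableType d) (f : T -> R) : Prop :=
  bb f /\ exists2 a, 0 < a & forall x, a <= f x.

Variables (d : measure_display) (T : measurableType d).
Implicit Types f g : T -> R.

Lemma bbp_bb f : bbp f -> bb f. Proof. by case. Qed.

Lemma bbp_gt0 f x : bbp f -> 0 < f x.
Proof. by move=> [_ [a a0 h]]; exact: lt_le_trans (h x). Qed.

Lemma bb_cst k : bb (fun _ : T => k).
Proof. by split; [exact: measurable_cst|exists `|k|]. Qed.

Lemma bbD f g : bb f -> bb g -> bb (fun x => f x + g x).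
Proof.
move=> [mf [C fC]] [mg [C' gC]]; split; first exact: measurable_funD.
by exists (C + C') => x; rewrite (le_trans (ler_normD _ _))// lerD.
Qed.

Lemma bbM f g : bb f -> bb g -> bb (fun x => f x * g x).
Proof.
move=> [mf [C fC]] [mg [C' gC]]; split; first exact: measurable_funM.
by exists (C * C') => x; rewrite normrM ler_pM.
Qed.

Lemma bbN f : bb f -> bb (fun x => - f x).
Proof.
move=> bf; have := bbM (bb_cst (-1)) bf.
by under eq_fun do rewrite mulN1r.
Qed.

Lemma bbB f g : bb f -> bb g -> bb (fun x => f x - g x).
Proof. by move=> bf bg; exact: bbD bf (bbN bg). Qed.

Lemma bb_sum (I : Type) (s : seq I) (f : I -> T -> R) :
  (forall i, bb (f i)) -> bb (fun x => \sum_(i <- s) f i x).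
Proof.
move=> bf; elim: s => [|i s IH].
  by under eq_fun do rewrite big_nil; exact: bb_cst.
by under eq_fun do rewrite big_cons; exact: bbD.
Qed.

Lemma bb_norm f : bb f -> bb (fun x => `|f x|).
Proof.
move=> [mf [C fC]]; split; first exact: measurableT_comp.
by exists C => x; rewrite normr_id.
Qed.

Lemma bbp_expR f : bb f -> bbp (fun x => expR (f x)).
Proof.
move=> [mf [C fC]]; split; last first.
  exists (expR (- C)); first exact: expR_gt0.
  by move=> x; rewrite ler_expR; have := fC x; rewrite ler_norml => /andP[].
split; first exact: measurableT_comp.
exists (expR C) => x; rewrite gtr0_norm ?expR_gt0// ler_expR.
by have := fC x; rewrite ler_norml => /andP[].
Qed.

Lemma bb_ln f : bbp f -> bb (fun x => ln (f x)).
Proof.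
move=> [[mf [C fC]] [a a0 af]]; split; first exact: measurableT_comp.
exists (Num.max `|ln a| `|ln C|) => x.
have f0 : 0 < f x by exact: lt_le_trans (af x).
have fC' : f x <= C by rewrite (le_trans (ler_norm _)).
have h1 : ln a <= ln (f x) by rewrite ler_ln ?posrE.
have h2 : ln (f x) <= ln C by rewrite ler_ln ?posrE//; exact: lt_le_trans fC'.
rewrite ler_norml; apply/andP; split.
  rewrite lerNl (@le_trans _ _ (- ln a)) ?lerN2// (le_trans (ler_norm _))// normrN.
  by rewrite le_max lexx.
by rewrite (le_trans h2)// (le_trans (ler_norm _))// le_max lexx orbT.
Qed.

Lemma bbpE f : bbp f -> f = fun x => expR (ln (f x)).
Proof. by move=> bf; apply/funext => x; rewrite lnK// posrE; exact: bbp_gt0. Qed.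

Lemma bbpM f g : bbp f -> bbp g -> bbp (fun x => f x * g x).
Proof.
move=> bf bg; rewrite (bbpE bf) (bbpE bg).
by under eq_fun do rewrite -expRD; apply/bbp_expR/bbD; exact: bb_ln.
Qed.

Lemma bbpV f : bbp f -> bbp (fun x => (f x)^-1).
Proof.
move=> bf; rewrite (bbpE bf).
by under eq_fun do rewrite -expRN; apply/bbp_expR/bbN; exact: bb_ln.
Qed.

Lemma bbp_le f g : bb f -> bbp g -> (forall x, g x <= f x) -> bbp f.
Proof.
move=> bf [_ [a a0 ag]] gf; split => //; exists a => // x.
exact: le_trans (gf x).
Qed.

End bounded_measurable.

Section product.
Variables (R : realType) (d1 d2 : measure_display).
Variables (A : measurableType d1) (B : measurableType d2).

Definition bb2 (h : A -> B -> R) := bb (fun z : A * B => h z.1 z.2).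
Definition bbp2 (h : A -> B -> R) := bbp (fun z : A * B => h z.1 z.2).

Lemma bb2_l (h : A -> B -> R) x : bb2 h -> bb (h x).
Proof.
move=> [mh [C hC]]; split; last by exists C => y; apply: (hC (x, y)).
exact: (measurable_fun_pair2 x mh).
Qed.

Lemma bb2_r (h : A -> B -> R) y : bb2 h -> bb (fun x => h x y).
Proof.
move=> [mh [C hC]]; split; last by exists C => x; apply: (hC (x, y)).
exact: (measurable_fun_pair1 y mh).
Qed.

Lemma bb2_fst (f : A -> R) : bb f -> bb2 (fun x _ => f x).
Proof.
by move=> [mf [C fC]]; split; [exact: measurableT_comp|exists C => -[x y]; apply: fC].
Qed.

Lemma bb2_snd (f : B -> R) : bb f -> bb2 (fun _ y => f y).
Proof.
by move=> [mf [C fC]]; split; [exact: measurableT_comp|exists C => -[x y]; apply: fC].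
Qed.

Lemma bbp2_fst (f : A -> R) : bbp f -> bbp2 (fun x _ => f x).
Proof.
move=> [/bb2_fst bf [a a0 af]]; split => //.
by exists a => // -[x y]; apply: af.
Qed.

Lemma bbp2_snd (f : B -> R) : bbp f -> bbp2 (fun _ y => f y).
Proof.
move=> [/bb2_snd bf [a a0 af]]; split => //.
by exists a => // -[x y]; apply: af.
Qed.

End product.

(** * Positive functionals and Gibbs plans *)

(** Stands for integration against a finite measure; values at functions that are not bounded and
    measurable are left unconstrained. *)
Record posfun (R : realType) d (T : measurableType d) (E : (T -> R) -> R) : Prop :=
  Posfun {
    pf_lin : forall a f g, bb f -> bb g ->
      E (fun x => a * f x + g x) = a * E f + E g;
    pf_ge0 : forall f, bb f -> (forall x, 0 <= f x) -> 0 <= E f }.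

Section posfun_theory.
Variables (R : realType) (d : measure_display) (T : measurableType d).
Variable E : (T -> R) -> R.
Hypothesis pE : posfun E.
Implicit Types f g : T -> R.

Lemma pf0 : E (fun=> 0) = 0.
Proof.
have := pf_lin pE (-1) (bb_cst T 0) (bb_cst T 0).
by rewrite mulr0 addr0 mulN1r addNr.
Qed.

Lemma pfD f g : bb f -> bb g -> E (fun x => f x + g x) = E f + E g.
Proof.
move=> bf bg; have := pf_lin pE 1 bf bg.
by under eq_fun do rewrite mul1r; rewrite mul1r.
Qed.

Lemma pfZ a f : bb f -> E (fun x => a * f x) = a * E f.
Proof.
move=> bf; have := pf_lin pE a bf (bb_cst T 0).
by under eq_fun do rewrite addr0; rewrite pf0 addr0.
Qed.

Lemma pfZr a f : bb f -> E (fun x => f x * a) = E f * a.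
Proof. by move=> bf; rewrite mulrC -pfZ//; under eq_fun do rewrite mulrC. Qed.

Lemma pfN f : bb f -> E (fun x => - f x) = - E f.
Proof. by move=> bf; rewrite -mulN1r -pfZ//; under [in RHS]eq_fun do rewrite mulN1r. Qed.

Lemma pfB f g : bb f -> bb g -> E (fun x => f x - g x) = E f - E g.
Proof. by move=> bf bg; rewrite pfD ?pfN//; exact: bbN. Qed.

Lemma pf_cst k : E (fun=> k) = k * E (fun=> 1).
Proof. by rewrite -pfZ; [under [in RHS]eq_fun do rewrite mulr1|exact: bb_cst]. Qed.

Lemma pf_le f g : bb f -> bb g -> (forall x, f x <= g x) -> E f <= E g.
Proof.
move=> bf bg fg; rewrite -subr_ge0 -pfB//; apply: (pf_ge0 pE); first exact: bbB.
by move=> x; rewrite subr_ge0.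
Qed.

Lemma pf_sum (I : Type) (s : seq I) (f : I -> T -> R) : (forall i, bb (f i)) ->
  E (fun x => \sum_(i <- s) f i x) = \sum_(i <- s) E (f i).
Proof.
move=> bf; elim: s => [|i s IH].
  by under eq_fun do rewrite big_nil; rewrite big_nil pf0.
under eq_fun do rewrite big_cons.
by rewrite big_cons pfD ?IH//; exact: bb_sum.
Qed.

Lemma pf_norm_le f C : bb f -> (forall x, `|f x| <= C) -> `|E f| <= C * E (fun=> 1).
Proof.
move=> bf fC; rewrite -pf_cst ler_norml -pfN; last exact: bb_cst.
apply/andP; split; apply: pf_le => //; rewrite -?/(bb _); try exact: bb_cst.
  by move=> x; have := fC x; rewrite ler_norml => /andP[].
by move=> x; have := fC x; rewrite ler_norml => /andP[].
Qed.

End posfun_theory.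

(** The measurability fields keep partial integrals in the class on which the functionals are
    controlled. *)
Record fubini (R : realType) d1 d2 (A : measurableType d1) (B : measurableType d2)
    (E : (A -> R) -> R) (J : (B -> R) -> R) : Prop := FubiniPair {
  fub_l : forall h : A -> B -> R, bb2 h -> measurable_fun setT (fun x => J (h x));
  fub_r : forall h : A -> B -> R, bb2 h -> measurable_fun setT (fun y => E (fun x => h x y));
  fub_swap : forall h : A -> B -> R, bb2 h -> E (fun x => J (h x)) = J (fun y => E (fun x => h x y)) }.

Section fubini_theory.
Variables (R : realType) (d1 d2 : measure_display).
Variables (A : measurableType d1) (B : measurableType d2).
Variables (E : (A -> R) -> R) (J : (B -> R) -> R).
Hypotheses (pE : posfun E) (pJ : posfun J) (fEJ : fubini E J).

Lemma fub_bbl (h : A -> B -> R) : bb2 h -> bb (fun x => J (h x)).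
Proof.
move=> bh; split; first exact: fub_l fEJ _ bh.
have [_ [C hC]] := bh; exists (C * J (fun=> 1)) => x.
by apply: pf_norm_le => //; [exact: bb2_l|move=> y; apply: (hC (x, y))].
Qed.

Lemma fub_bbr (h : A -> B -> R) : bb2 h -> bb (fun y => E (fun x => h x y)).
Proof.
move=> bh; split; first exact: fub_r fEJ _ bh.
have [_ [C hC]] := bh; exists (C * E (fun=> 1)) => y.
by apply: pf_norm_le => //; [exact: bb2_r|move=> x; apply: (hC (x, y))].
Qed.

Lemma fub_bbpl (h : A -> B -> R) : 0 < J (fun=> 1) -> bbp2 h -> bbp (fun x => J (h x)).
Proof.
move=> V0 bh; split; first exact: fub_bbl (bbp_bb bh).
have [_ [a a0 ah]] := bh; exists (a * J (fun=> 1)); first exact: mulr_gt0.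
move=> x; rewrite -pf_cst//; apply: pf_le => //; [exact: bb_cst| |].
  by apply: bb2_l; exact: bbp_bb.
by move=> y; apply: (ah (x, y)).
Qed.

Lemma fub_bbpr (h : A -> B -> R) : 0 < E (fun=> 1) -> bbp2 h -> bbp (fun y => E (fun x => h x y)).
Proof.
move=> V0 bh; split; first exact: fub_bbr (bbp_bb bh).
have [_ [a a0 ah]] := bh; exists (a * E (fun=> 1)); first exact: mulr_gt0.
move=> y; rewrite -pf_cst//; apply: pf_le => //; [exact: bb_cst| |].
  by apply: bb2_r; exact: bbp_bb.
by move=> x; apply: (ah (x, y)).
Qed.

End fubini_theory.

(** Concavity: [ln] lies below its tangent at [b]. *)
Lemma le_ln1M (R : realType) (a b : R) : 0 < a -> 0 < b -> ln a <= ln b + a / b - 1.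
Proof.
move=> a0 b0; have ab : 0 < a / b by rewrite divr_gt0.
have := expR_ge1Dx (ln (a / b)); rewrite lnK ?posrE//.
by rewrite ln_div ?posrE//; lra.
Qed.

Section gibbs.
Variables (R : realType) (d1 d2 : measure_display).
Variables (A : measurableType d1) (B : measurableType d2).
Variables (E : (A -> R) -> R) (J : (B -> R) -> R).
Hypotheses (pE : posfun E) (pJ : posfun J) (fEJ : fubini E J).
Hypotheses (E1 : E (fun=> 1) = 1) (V0 : 0 < J (fun=> 1)).
Variable c : A -> B -> R.
Hypothesis bc : bb2 c.

Let V := J (fun=> 1).

Definition gweight (f : B -> R) x y := expR (f y - c x y).
Definition gpart f x := J (gweight f x).
Definition gdens f x y := gweight f x y / gpart f x.
Definition gmarg f y := E (fun x => gdens f x y).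
(** The second marginal without its factor [expR (f y)]. Here [f] enters only through the partition
    function, so the modulus of [ln (gpot f y)] in [y] comes from the cost alone. *)
Definition gpot f y := E (fun x => expR (- c x y) / gpart f x).

Section potential.
Variable f : B -> R.
Hypothesis bf : bb f.

Lemma gweight_bbp : bbp2 (gweight f).
Proof. by apply: bbp_expR; exact: bbB (bb2_snd A bf) bc. Qed.

Lemma gpart_bbp : bbp (gpart f).
Proof. exact: (fub_bbpl pJ fEJ V0 gweight_bbp). Qed.

Lemma gpart_gt0 x : 0 < gpart f x.
Proof. exact: bbp_gt0 gpart_bbp. Qed.

Lemma gdens_bbp : bbp2 (gdens f).
Proof. by apply: bbpM; [exact: gweight_bbp|exact: (bbp2_fst B (bbpV gpart_bbp))]. Qed.

Lemma gdens_gt0 x y : 0 < gdens f x y.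
Proof. exact: (bbp_gt0 (x, y) gdens_bbp). Qed.

Lemma gdens_bb2 : bb2 (gdens f). Proof. exact: bbp_bb gdens_bbp. Qed.

Lemma gdens_int x : J (gdens f x) = 1.
Proof.
rewrite /gdens pfZr//; last exact: (bb2_l _ (bbp_bb gweight_bbp)).
by rewrite divff// gt_eqF// gpart_gt0.
Qed.

Lemma gmarg_bbp : bbp (gmarg f).
Proof. by apply: (fub_bbpr pE fEJ _ gdens_bbp); rewrite E1. Qed.

Lemma gmarg_gt0 y : 0 < gmarg f y. Proof. exact: bbp_gt0 gmarg_bbp. Qed.

Lemma gmarg_int : J (gmarg f) = 1.
Proof.
rewrite /gmarg -(fub_swap fEJ gdens_bb2).
by under eq_fun do rewrite gdens_int.
Qed.

Lemma gpot_bbp2 : bbp2 (fun x y => expR (- c x y) / gpart f x).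
Proof.
apply: bbpM; first by apply: bbp_expR; exact: bbN.
by exact: (bbp2_fst B (bbpV gpart_bbp)).
Qed.

Lemma gpot_bbp : bbp (gpot f).
Proof. by apply: (fub_bbpr pE fEJ _ gpot_bbp2); rewrite E1. Qed.

Lemma gmargE y : gmarg f y = expR (f y) * gpot f y.
Proof.
rewrite /gmarg /gpot -pfZ//; last exact: (bb2_r y (bbp_bb gpot_bbp2)).
by congr E; apply/funext => x; rewrite /gdens /gweight expRD mulrA.
Qed.

Lemma ln_gmarg y : ln (gmarg f y) = f y + ln (gpot f y).
Proof. by rewrite gmargE lnM ?posrE ?expR_gt0 ?expRK// (bbp_gt0 y gpot_bbp). Qed.

Lemma gpot_le y y' e : (forall x, c x y - c x y' <= e) ->
  ln (gpot f y') - ln (gpot f y) <= e.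
Proof.
move=> ce; have p0 := bbp_gt0 y gpot_bbp; have p0' := bbp_gt0 y' gpot_bbp.
rewrite lerBlDr -[e]expRK -lnM ?posrE ?expR_gt0//.
rewrite ler_ln ?posrE ?mulr_gt0 ?expR_gt0//.
have b y := bb2_r y (bbp_bb gpot_bbp2).
rewrite /gpot -pfZ//; apply: pf_le => // [|x].
  by apply: bbM (b y); exact: bb_cst.
rewrite mulrA ler_wpM2r ?invr_ge0 ?(ltW (gpart_gt0 x))//.
by rewrite -expRD ler_expR; have := ce x; lra.
Qed.

Lemma gpot_modulus y y' e : (forall x, `|c x y - c x y'| <= e) ->
  `|ln (gpot f y) - ln (gpot f y')| <= e.
Proof.
move=> ce; rewrite ler_norml lerNl opprB; apply/andP; split; apply: gpot_le => x.
  by have := ce x; rewrite ler_norml => /andP[].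
by have := ce x; rewrite distrC ler_norml => /andP[].
Qed.

(* Jensen for the logarithm: [ln w <= ln m + w / m - 1] with [m = E w]. *)
Lemma gibbs_jensen (r : B -> R) : bbp r ->
  E (fun x => ln (J (fun y => gdens f x y * r y))) <= ln (J (fun y => gmarg f y * r y)).
Proof.
move=> br.
have br2 : bbp2 (fun (x : A) y => gdens f x y * r y).
  by apply: bbpM; [exact: gdens_bbp|exact: (bbp2_snd A br)].
have bw := fub_bbpl pJ fEJ V0 br2.
set w := fun x => J _ in bw *.
have -> : J (fun y => gmarg f y * r y) = E w.
  rewrite /w (fub_swap fEJ (bbp_bb br2)); congr J; apply/funext => y.
  by rewrite pfZr//; exact: (bb2_r y gdens_bb2).
have m0 : 0 < E w.
  have [_ [a a0 aw]] := bw; apply: (lt_le_trans a0).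
  rewrite -[a]mulr1 -E1 -pf_cst//; apply: pf_le => //; [exact: bb_cst|exact: bbp_bb].
apply: (@le_trans _ _ (E (fun x => (E w)^-1 * w x + (ln (E w) - 1)))).
  apply: pf_le => //.
  - exact: bb_ln.
  - by apply: bbD; [apply: bbM (bbp_bb bw); exact: bb_cst|exact: bb_cst].
  - move=> x; have := le_ln1M (bbp_gt0 x bw) m0.
    by rewrite [w x / _]mulrC; lra.
rewrite (pf_lin pE); [|exact: bbp_bb|exact: bb_cst].
by rewrite pf_cst// E1 mulr1 mulVf ?gt_eqF//; lra.
Qed.

Section bounds.
Variable C : R.
Hypothesis cC : forall x y, `|c x y| <= C.
Hypothesis fC : forall y y', f y - f y' <= 4 * C.

(** In the constant 6 C, 4 C is the oscillation allowed to [f] and 2 C comes from the two values of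
    the cost. *)
Let gw x y y' : gweight f x y <= expR (6 * C) * gweight f x y'.
Proof.
rewrite /gweight -expRD ler_expR.
have := fC y y'; have := cC x y; have := cC x y'.
by rewrite !ler_norml => /andP[a1 a2] /andP[a3 a4]; lra.
Qed.

Lemma gdens_le x y : gdens f x y <= expR (6 * C) / V.
Proof.
rewrite /gdens ler_pdivrMr ?gpart_gt0// mulrAC ler_pdivlMr//.
rewrite /gpart -pf_cst// -pfZ//; last exact: (bb2_l _ (bbp_bb gweight_bbp)).
apply: pf_le => //; first exact: bb_cst.
by apply: bbM; [exact: bb_cst|exact: (bb2_l _ (bbp_bb gweight_bbp))].
Qed.

Lemma gdens_ge x y : expR (- (6 * C)) / V <= gdens f x y.
Proof.
rewrite /gdens ler_pdivlMr ?gpart_gt0// mulrAC ler_pdivrMr//.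
rewrite mulrC expRN ler_pdivrMr ?expR_gt0// -mulrA [V * _]mulrC mulrA [_ * expR _]mulrC.
rewrite /gpart -pf_cst//; apply: pf_le => //.
- exact: (bb2_l _ (bbp_bb gweight_bbp)).
- exact: bb_cst.
Qed.

Lemma gmarg_le y : gmarg f y <= expR (6 * C) / V.
Proof.
have -> : expR (6 * C) / V = E (fun=> expR (6 * C) / V) by rewrite pf_cst// E1 mulr1.
apply: pf_le => //; [|exact: bb_cst|].
  exact: (bb2_r y gdens_bb2).
by move=> x; exact: gdens_le.
Qed.

Lemma gmarg_ge y : expR (- (6 * C)) / V <= gmarg f y.
Proof.
have -> : expR (- (6 * C)) / V = E (fun=> expR (- (6 * C)) / V) by rewrite pf_cst// E1 mulr1.
apply: pf_le => //; [exact: bb_cst| |].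
  exact: (bb2_r y gdens_bb2).
by move=> x; exact: gdens_ge.
Qed.

Variable r : B -> R.
Hypotheses (br : bbp r) (r1 : forall y, r y <= 1).

Definition gloss x := 1 - J (fun y => gdens f x y * r y).

(* Thinning of [gdens] by [r]; the lost mass is redistributed uniformly. *)
Definition gthin x y := gdens f x y * r y + gloss x / V.

Let br2 : bbp2 (fun (x : A) y => gdens f x y * r y).
Proof. by apply: bbpM; [exact: gdens_bbp|exact: (bbp2_snd A br)]. Qed.

Lemma gloss_bb : bb gloss.
Proof. by apply: bbB; [exact: bb_cst|exact: (bbp_bb (fub_bbpl pJ fEJ V0 br2))]. Qed.

Lemma gloss_ge0 x : 0 <= gloss x.
Proof.
rewrite /gloss subr_ge0 -(gdens_int x); apply: pf_le => //.
- exact: (bb2_l x (bbp_bb br2)).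
- exact: (bb2_l x gdens_bb2).
- by move=> y; rewrite ger_pMr// gdens_gt0.
Qed.

Lemma gthin_bbp : bbp2 gthin.
Proof.
apply: (bbp_le _ br2).
  apply: bbD; first exact: bbp_bb br2.
  by exact: (bb2_fst B (bbM gloss_bb (bb_cst _ _))).
by move=> [x y] /=; rewrite /gthin lerDl divr_ge0 ?gloss_ge0// ltW.
Qed.

Lemma gthin_gt0 x y : 0 < gthin x y.
Proof. exact: (bbp_gt0 (x, y) gthin_bbp). Qed.

Lemma gthin_int x : J (gthin x) = 1.
Proof.
rewrite /gthin pfD//; [|exact: (bb2_l x (bbp_bb br2))|exact: bb_cst].
by rewrite pf_cst// divfK ?gt_eqF// /gloss addrC subrK.
Qed.

Lemma gloss_int : E gloss = 1 - J (fun y => gmarg f y * r y).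
Proof.
rewrite /gloss pfB//; [|exact: bb_cst|exact: (bbp_bb (fub_bbpl pJ fEJ V0 br2))].
rewrite E1 (fub_swap fEJ (bbp_bb br2)); congr (_ - J _); apply/funext => y.
by rewrite pfZr//; exact: (bb2_r y gdens_bb2).
Qed.

Lemma gthin_marg y : E (fun x => gthin x y) =
  gmarg f y * r y + (1 - J (fun y => gmarg f y * r y)) / V.
Proof.
rewrite /gthin pfD//; [|exact: (bb2_r y (bbp_bb br2))|].
  by rewrite !pfZr// ?gloss_int//; [exact: gloss_bb|exact: (bb2_r y gdens_bb2)].
by apply: bbM gloss_bb _; exact: bb_cst.
Qed.

(* chi-square bound: [k ln (k / m) <= (k - m) + (k - m)^2 / m], and
   [|k - m| / m] is bounded. *)
Lemma gthin_kl :
  E (fun x => J (fun y => gthin x y * ln (gthin x y / gdens f x y)))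
  <= 2 * (1 + expR (6 * C)) * (1 - J (fun y => gmarg f y * r y)).
Proof.
set G := 1 + expR (6 * C).
have G0 : 0 < G by rewrite ltr_wpDr// expR_ge0.
(* A majorant of [|gthin - gdens|]: the mass removed plus the mass put back, each with integral
   [gloss x]. *)
pose u x y := gdens f x y * (1 - r y) + gloss x / V.
have b1 : bb2 (fun (x : A) y => gdens f x y * (1 - r y)).
  apply: bbM; first exact: gdens_bb2.
  by exact: (bb2_snd A (bbB (bb_cst _ 1) (bbp_bb br))).
have bl : bb2 (fun x (y : B) => gloss x / V).
  by exact: (bb2_fst B (bbM gloss_bb (bb_cst _ _))).
have bu : bb2 u by exact: bbD.
have Ju x : J (u x) = 2 * gloss x.
  rewrite /u pfD//; [|exact: (bb2_l x b1)|exact: bb_cst].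
  rewrite pf_cst// divfK ?gt_eqF//.
  under eq_fun do rewrite mulrBr mulr1.
  rewrite pfB//; [|exact: (bb2_l x gdens_bb2)|exact: (bb2_l x (bbp_bb br2))].
  by rewrite gdens_int -/(gloss x); ring.
have blog : bb2 (fun x y => gthin x y * ln (gthin x y / gdens f x y)).
  apply: bbM; first exact: bbp_bb gthin_bbp.
  by apply: bb_ln; apply: bbpM; [exact: gthin_bbp|exact: bbpV gdens_bbp].
have bR : bb2 (fun x y => gthin x y - gdens f x y + G * u x y).
  apply: bbD; first by apply: bbB; [exact: bbp_bb gthin_bbp|exact: gdens_bb2].
  by apply: bbM; [exact: bb_cst|].
have rhsE x : J (fun y => gthin x y - gdens f x y + G * u x y) = 2 * G * gloss x.
  rewrite pfD//; last by apply: bbM; [exact: bb_cst|exact: (bb2_l x bu)].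
    rewrite pfB//; [|exact: (bb2_l x (bbp_bb gthin_bbp))|exact: (bb2_l x gdens_bb2)].
    rewrite gthin_int gdens_int subrr add0r pfZ; [|by []|exact: (bb2_l x bu)].
    by rewrite Ju; ring.
  by apply: bbB; [exact: (bb2_l x (bbp_bb gthin_bbp))|exact: (bb2_l x gdens_bb2)].
rewrite -gloss_int -pfZ//; last exact: gloss_bb.
apply: pf_le => //; first exact: (fub_bbl pJ fEJ blog).
  exact: (bbM (bb_cst _ _) gloss_bb).
move=> x; rewrite -rhsE; apply: pf_le => //; [exact: (bb2_l x blog)|exact: (bb2_l x bR)|].
move=> y; set k := gthin x y; set m := gdens f x y.
have k0 : 0 < k by exact: gthin_gt0.
have m0 : 0 < m by exact: gdens_gt0.
have u0 : 0 <= gloss x / V by rewrite divr_ge0 ?gloss_ge0// ltW.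
have r0 : 0 < r y by exact: bbp_gt0.
have km : `|k - m| <= u x y.
  have -> : k - m = - (m * (1 - r y)) + gloss x / V by rewrite /k /gthin -/m; ring.
  have mr : 0 <= m * (1 - r y) by rewrite mulr_ge0 ?subr_ge0// ltW.
  by rewrite (le_trans (ler_normD _ _))// normrN (ger0_norm u0) (ger0_norm mr).
(* The removed part is at most [m]. The added part is at most [1 / V], which the lower bound on
   [gdens] turns into [expR (6 * C) * m]. *)
have kG : `|k - m| <= G * m.
  have hm : gloss x / V <= expR (6 * C) * m.
    have g1 : gloss x <= 1.
      rewrite /gloss lerBlDr lerDl (pf_ge0 pJ)//; first exact: (bb2_l x (bbp_bb br2)).
      by move=> z; rewrite mulr_ge0 ?ltW ?gdens_gt0// (bbp_gt0 z br).
    apply: (@le_trans _ _ (1 / V)); first by rewrite ler_pM2r ?invr_gt0.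
    have := gdens_ge x y; rewrite -/m -(ler_pM2l (expR_gt0 (6 * C))).
    by rewrite mulrA -expRD subrr expR0.
  apply: (le_trans km); rewrite (_ : G * m = m + expR (6 * C) * m); last by rewrite /G; ring.
  rewrite lerD//.
  by rewrite ger_pMr// gerBl ltW.
have := le_ln1M (divr_gt0 k0 m0) ltr01; rewrite ln1 add0r divr1.
rewrite -(ler_pM2l k0) => /le_trans; apply.
have -> : k * (k / m - 1) = (k - m) + (k - m) ^+ 2 / m by field; rewrite gt_eqF.
rewrite lerD2l ler_pdivrMr// -real_normK ?num_real// expr2.
by rewrite mulrAC ler_pM.
Qed.

End bounds.

(** Substitute [ln (gdens f x y) = f y - c x y - ln (gpart f x)]. Rows of [k] have mass one, so the
    partition function integrates out, and [f] sees only the second marginal of [k]. *)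
Lemma gibbs_cost (k : A -> B -> R) : bbp2 k -> (forall x, J (k x) = 1) ->
  E (fun x => J (fun y => c x y * k x y + k x y * ln (k x y))) =
  E (fun x => J (fun y => k x y * ln (k x y / gdens f x y))) +
  J (fun y => f y * E (fun x => k x y)) - E (fun x => ln (gpart f x)).
Proof.
move=> bk kJ.
have bk' := bbp_bb bk.
have blog : bb2 (fun x y => k x y * ln (k x y / gdens f x y)).
  apply: bbM => //.
  by apply: bb_ln; apply: bbpM => //; exact: bbpV gdens_bbp.
have bfk : bb2 (fun (x : A) y => f y * k x y).
  by apply: bbM => //; exact: (bb2_snd A bf).
have bZ : bb (fun x => ln (gpart f x)) by apply: bb_ln; exact: gpart_bbp.
have bZk : bb2 (fun x y => ln (gpart f x) * k x y).
  by apply: bbM => //; exact: (bb2_fst B bZ).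
have -> : (fun x => J (fun y => c x y * k x y + k x y * ln (k x y))) =
   fun x => J (fun y => k x y * ln (k x y / gdens f x y)) + J (fun y => f y * k x y)
      - ln (gpart f x).
  apply/funext => x.
  have -> : ln (gpart f x) = J (fun y => ln (gpart f x) * k x y).
    by rewrite pfZ ?kJ ?mulr1//; exact: (bb2_l x bk').
  rewrite -pfD//; [|exact: (bb2_l x blog)|exact: (bb2_l x bfk)].
  rewrite -pfB//; [|by apply: bbD; [exact: (bb2_l x blog)|exact: (bb2_l x bfk)]|
    exact: (bb2_l x bZk)].
  congr J; apply/funext => y.
  have k0 := bbp_gt0 (x, y) bk; have g0 := gdens_gt0 x y.
  rewrite ln_div ?posrE// /gdens ln_div ?posrE ?gpart_gt0//; last exact: expR_gt0.
  by rewrite /gweight expRK; ring.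
rewrite pfB//; last by exact: (bbD (fub_bbl pJ fEJ blog) (fub_bbl pJ fEJ bfk)).
rewrite pfD//; [|exact: (fub_bbl pJ fEJ blog)|exact: (fub_bbl pJ fEJ bfk)].
rewrite (fub_swap fEJ bfk); congr (_ + J _ - _); apply/funext => y.
by rewrite pfZ//; exact: (bb2_r y bk').
Qed.

End potential.
End gibbs.

(** * Dual ascent and near-optimal plans *)

(** The square of [|u| <= e^|u| |e^u - 1|], where the factor compensates the flatness of [exp] at
    negative [u]. *)
Lemma sqr_expRB1_ge (R : realType) (u : R) : u ^+ 2 <= expR (2 * `|u|) * (expR u - 1) ^+ 2.
Proof.
have -> : expR (2 * `|u|) = expR `|u| ^+ 2.
  by rewrite expr2 -expRD; congr expR; ring.
rewrite -exprMn -[X in X <= _]real_normK ?num_real// -[leRHS]real_normK ?num_real//.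
rewrite lerXn2r ?nnegrE// normrM [`|expR _|]gtr0_norm ?expR_gt0//.
have [u0|u0] := leP 0 u.
  have h := expR_ge1Dx u.
  rewrite (ger0_norm u0) ger0_norm; last by lra.
  apply: (@le_trans _ _ (1 * (expR u - 1))); first by lra.
  by rewrite ler_wpM2r//; lra.
have h := expR_ge1Dx (- u).
have e1 : expR u <= 1 by rewrite -expR0 ler_expR ltW.
rewrite (ltr0_norm u0) ler0_norm ?subr_le0// opprB mulrBr mulr1 -expRD addNr expR0.
lra.
Qed.

(* Quantitative AM-GM: [e^t - 1 - t >= (e^(t/2) - 1)^2]. *)
Lemma norm_le_expR (R : realType) (L th t : R) : 0 < th -> `|t| <= L ->
  `|t| <= th + expR L / th * (expR t - 1 - t).
Proof.
move=> th0 tL.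
(* The difference of the two sides is [2 (e^(t/2) - 1 - t/2)]. *)
have h1 : (expR (t / 2) - 1) ^+ 2 <= expR t - 1 - t.
  have E : expR t = expR (t / 2) ^+ 2 by rewrite expr2 -expRD -splitr.
  by have := expR_ge1Dx (t / 2); rewrite E expr2; nra.
have h2 := sqr_expRB1_ge (t / 2).
have h3 : expR (2 * `|t / 2|) <= expR L.
  rewrite ler_expR normrM [`|2^-1|]gtr0_norm ?invr_gt0//.
  by rewrite mulrCA divff ?pnatr_eq0// mulr1.
have h4 : (t / 2) ^+ 2 <= expR L * (expR t - 1 - t).
  by apply: (le_trans h2); rewrite ler_pM ?expR_ge0 ?sqr_ge0.
have h5 : `|t| * th <= th ^+ 2 + (t / 2) ^+ 2.
  have -> : (t / 2) ^+ 2 = (`|t| / 2) ^+ 2 by rewrite !exprMn real_normK ?num_real.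
  by have := sqr_ge0 (`|t| / 2 - th); rewrite !expr2; nra.
rewrite -(ler_pM2r th0).
have -> : (th + expR L / th * (expR t - 1 - t)) * th =
  th ^+ 2 + expR L * (expR t - 1 - t) by field; rewrite gt_eqF.
lra.
Qed.

Section dual.
Variables (R : realType) (dB : measure_display) (B : measurableType dB).
Variables (J : (B -> R) -> R) (K : nat) (dA : 'I_K -> measure_display).
Variables (A : forall k, measurableType (dA k)) (E : forall k, (A k -> R) -> R).
Variables (c : forall k, A k -> B -> R) (lam : 'I_K -> R) (C : R).
Hypotheses (pE : forall k, posfun (@E k)) (pJ : posfun J).
Hypothesis fEJ : forall k, fubini (@E k) J.
Hypotheses (E1 : forall k, @E k (fun=> 1) = 1) (V0 : 0 < J (fun=> 1)).
Hypothesis bc : forall k, bb2 (@c k).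
Hypotheses (C0 : 0 <= C) (cC : forall k x y, `|@c k x y| <= C).
Hypotheses (lam0 : forall k, 0 < lam k) (lam1 : \sum_k lam k = 1).

Let V := J (fun=> 1).

Notation Z f k := (gpart J (@c k) (f k)).
Notation q f k := (gmarg (@E k) J (@c k) (f k)).
Notation h f k := (gpot (@E k) J (@c k) (f k)).

Definition dual_val (f : 'I_K -> B -> R) : R :=
  \sum_k lam k * E (fun x => - ln (Z f k x)).

Definition dual_step (f : 'I_K -> B -> R) k y : R :=
  \sum_j lam j * ln (h f j y) - ln (h f k y).

(** The factor 2 counts the two terms of [dual_step], the average and the own potential, each of
    which varies by at most [e]. The hypothesis runs over all costs at once because the average
    mixes them. *)
Definition dual_feasible (f : 'I_K -> B -> R) :=
  [/\ forall k, bb (f k), forall y, \sum_k lam k * f k y = 0 &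
    forall y y' e, (forall k x, `|@c k x y - @c k x y'| <= e) ->
      forall k, `|f k y - f k y'| <= 2 * e].

(* Logarithm of the weighted geometric mean of the marginals. *)
Definition lngeo f y : R := \sum_j lam j * ln (q f j y).

Lemma convex_le (x : 'I_K -> R) b : (forall k, x k <= b) -> \sum_k lam k * x k <= b.
Proof.
move=> xb; rewrite -[b]mul1r -lam1 mulr_suml; apply: ler_sum => k _.
by rewrite ler_pM2l.
Qed.

Lemma dual_feasible0 : dual_feasible (fun _ _ => 0).
Proof.
split=> [k|y|y y' e ce k]; first exact: bb_cst.
  by rewrite big1// => k _; rewrite mulr0.
rewrite subrr normr0 mulr_ge0//.
(* An index and a point are needed to read off [0 <= e] from the bound on the costs. *)
have K0 : (0 < K)%N by case: (K) k => // -[].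
exact: le_trans (ce (Ordinal K0) point).
Qed.

Section step.
Variable f : 'I_K -> B -> R.
Hypothesis Ff : dual_feasible f.

Let bf k : bb (f k). Proof. by case: Ff. Qed.

Lemma dual_feasible_osc k y y' : f k y - f k y' <= 4 * C.
Proof.
have [_ _ /(_ y y' (2 * C)) H] := Ff.
apply: (le_trans (ler_norm _)); have -> : 4 * C = 2 * (2 * C) by ring.
apply: H => j x; rewrite (le_trans (ler_normB _ _))//.
by have := cC x y; have := cC x y'; lra.
Qed.

Lemma bbh k : bb (fun y => ln (h f k y)).
Proof. by apply: bb_ln; apply: gpot_bbp. Qed.

Lemma bbq k : bb (fun y => ln (q f k y)).
Proof. by apply: bb_ln; apply: gmarg_bbp. Qed.

Lemma lngeo_bb : bb (lngeo f).
Proof. by apply: bb_sum => j; apply: bbM (bbq j); exact: bb_cst. Qed.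

(** As the potentials have weighted sum zero, [lngeo] is also the weighted sum of the [ln h]. In
    this form the step rescales the weights of plan [k] by the ratio of the geometric mean to its
    marginal, as in iterative Bregman projections. *)
Lemma dual_stepE k y : dual_step f k y = f k y + lngeo f y - ln (q f k y).
Proof.
rewrite ln_gmarg// /dual_step /lngeo.
have -> : \sum_j lam j * ln (q f j y) = \sum_j lam j * ln (h f j y).
  have [_ f0 _] := Ff.
  under eq_bigr do rewrite ln_gmarg// mulrDr.
  by rewrite big_split /= f0 add0r.
by ring.
Qed.

Lemma dual_step_feasible : dual_feasible (dual_step f).
Proof.
split.
- move=> k; apply: bbB (bbh k); apply: bb_sum => j; apply: bbM (bbh j); exact: bb_cst.
- move=> y; rewrite /dual_step; under eq_bigr do rewrite mulrBr.
  by rewrite sumrB -mulr_suml lam1 mul1r subrr.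
- move=> y y' e ce k; rewrite /dual_step.
  have hm j : `|ln (h f j y) - ln (h f j y')| <= e by apply: gpot_modulus.
  have -> : \sum_j lam j * ln (h f j y) - ln (h f k y) -
    (\sum_j lam j * ln (h f j y') - ln (h f k y')) =
    \sum_j lam j * (ln (h f j y) - ln (h f j y')) - (ln (h f k y) - ln (h f k y')).
    under [in RHS]eq_bigr do rewrite mulrBr.
    by rewrite sumrB; ring.
  rewrite (le_trans (ler_normB _ _))// mulr_natl mulr2n lerD//.
  rewrite (le_trans (ler_norm_sum _ _ _))//.
  under eq_bigr do rewrite normrM gtr0_norm//.
  exact: convex_le.
Qed.

(** The step multiplies the partition function by the row integral of [gdens * r], where [r] is the
    geometric mean over [q k]. Jensen replaces [gdens] by [q k], and [q k * r] is the geometric mean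
    for every [k], so all indices share one bound and the weights sum out. *)
Lemma dual_step_val : dual_val f - ln (J (fun y => expR (lngeo f y))) <= dual_val (dual_step f).
Proof.
rewrite /dual_val -[X in _ - X]mul1r -lam1 mulr_suml -sumrB; apply: ler_sum => k _.
rewrite -mulrBr ler_pM2l//.
pose r y := expR (lngeo f y - ln (q f k y)).
have br : bbp r by apply: bbp_expR; apply: bbB (bbq k); exact: lngeo_bb.
have bd : bbp2 (fun x y => gdens J (@c k) (f k) x y * r y).
  apply: bbpM; first exact: (gdens_bbp pJ (fEJ k) V0 (bc k) (bf k)).
  exact: (bbp2_snd _ br).
have bw := fub_bbpl pJ (fEJ k) V0 bd.
have bZ := gpart_bbp pJ (fEJ k) V0 (bc k) (bf k).
have ZE x : gpart J (@c k) (dual_step f k) x =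
    Z f k x * J (fun y => gdens J (@c k) (f k) x y * r y).
  rewrite -pfZ//; last exact: (bb2_l x (bbp_bb bd)).
  congr J; apply/funext => y; rewrite /gdens /r /gweight dual_stepE.
  rewrite mulrA mulrCA divff ?mulr1; last by rewrite gt_eqF// (bbp_gt0 x bZ).
  by rewrite -expRD; congr expR; ring.
have -> : (fun x => - ln (gpart J (@c k) (dual_step f k) x)) =
   fun x => - ln (Z f k x) - ln (J (fun y => gdens J (@c k) (f k) x y * r y)).
  apply/funext => x; rewrite ZE lnM ?posrE ?opprD//; first exact: bbp_gt0 bZ.
  exact: bbp_gt0 bw.
rewrite pfB//; [|by apply: bbN; exact: bb_ln|exact: bb_ln].
rewrite lerD2l lerN2.
have := gibbs_jensen (pE k) pJ (fEJ k) (E1 k) V0 (bc k) (bf k) br.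
have -> // : (fun y => q f k y * r y) = (fun y => expR (lngeo f y)).
apply/funext => y; have q0 := gmarg_gt0 (pE k) pJ (fEJ k) (E1 k) V0 (bc k) (bf k) y.
by rewrite /r expRD expRN lnK ?posrE// mulrCA divff ?mulr1// gt_eqF.
Qed.

(* Jensen for the exponential. *)
Lemma dual_val_le : dual_val f <= C - ln V.
Proof.
have -> : C - ln V = \sum_k lam k * (C - ln V - J (f k) / V).
  under eq_bigr do rewrite mulrBr mulrA.
  rewrite sumrB -!mulr_suml lam1 mul1r.
  under [X in _ - X / _]eq_bigr do rewrite -pfZ//.
  rewrite -pf_sum//; last by move=> k; apply: bbM => //; exact: bb_cst.
  have [_ f0 _] := Ff; under [X in J X]eq_fun do rewrite f0.
  by rewrite pf0// mul0r subr0.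
apply: ler_sum => k _; rewrite ler_pM2l// -[leRHS]mulr1 -(E1 k) -pf_cst//.
have bZ := gpart_bbp pJ (fEJ k) V0 (bc k) (bf k).
apply: pf_le => //; [by apply: bbN; exact: bb_ln|exact: bb_cst|].
move=> x; set m := J (fun y => f k y - c x y) / V.
have bu : bb (fun y => f k y - c x y) by apply: bbB => //; exact: (bb2_l x (bc k)).
(* The tangent line of [exp] at the mean [m] of the exponent, integrated. *)
have Zm : V * expR m <= Z f k x.
  apply: (@le_trans _ _ (J (fun y => expR m * (f k y - c x y) + expR m * (1 - m)))).
    rewrite (pf_lin pJ)//; last exact: bb_cst.
    rewrite pf_cst// -/V.
    have -> : J (fun y => f k y - c x y) = m * V by rewrite /m divfK// gt_eqF.
    by rewrite le_eqVlt; apply/orP; left; apply/eqP; ring.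
  apply: pf_le => //.
  - by apply: bbD; [apply: bbM => //; exact: bb_cst|exact: bb_cst].
  - exact: (bb2_l x (bbp_bb (gweight_bbp (bc k) (bf k)))).
  - move=> y; rewrite -mulrDr /gweight.
    rewrite [leRHS](_ : _ = expR m * expR (f k y - c x y - m)); last first.
      by rewrite -expRD [m + _]addrC subrK.
    rewrite ler_wpM2l ?expR_ge0//.
    by have := expR_ge1Dx (f k y - c x y - m); lra.
have : ln V + m <= ln (Z f k x).
  rewrite -[m]expRK -lnM ?posrE ?expR_gt0//.
  by rewrite ler_ln ?posrE ?mulr_gt0 ?expR_gt0// (bbp_gt0 x bZ).
have : - J (fun y => f k y - c x y) <= - J (f k) + C * V.
  rewrite pfB//; last exact: (bb2_l x (bc k)).
  rewrite opprB addrC lerD2l.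
  rewrite (le_trans (ler_norm _))// pf_norm_le//; first exact: (bb2_l x (bc k)).
rewrite -(ler_pM2r (x := V^-1)) ?invr_gt0// mulrDl mulfK ?gt_eqF// !mulNr -/m.
lra.
Qed.

Let lnq_bound k y : - (6 * C) - ln V <= ln (q f k y) <= 6 * C - ln V.
Proof.
have q0 := gmarg_gt0 (pE k) pJ (fEJ k) (E1 k) V0 (bc k) (bf k) y.
have q1 := gmarg_le (pE k) pJ (fEJ k) (E1 k) V0 (bc k) (bf k) (cC (k := k)) (dual_feasible_osc k) y.
have q2 := gmarg_ge (pE k) pJ (fEJ k) (E1 k) V0 (bc k) (bf k) (cC (k := k)) (dual_feasible_osc k) y.
have e0 a : 0 < expR a / V by rewrite divr_gt0 ?expR_gt0.
rewrite -[- (6 * C)]expRK -[6 * C in X in _ && X]expRK -!ln_div ?posrE ?expR_gt0//.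
by rewrite !ler_ln ?posrE// q1 q2.
Qed.

Let lngeo_bound y : - (6 * C) - ln V <= lngeo f y <= 6 * C - ln V.
Proof.
apply/andP; split; last by apply: convex_le => k; case/andP: (lnq_bound k y).
rewrite -lerN2 /lngeo -sumrN; under eq_bigr do rewrite -mulrN.
by apply: convex_le => k; rewrite lerN2; case/andP: (lnq_bound k y).
Qed.

Definition lndev k y := ln (q f k y) - lngeo f y.
Definition totdev y := \sum_k `|lndev k y|.

Let lndev_bb k : bb (lndev k). Proof. exact: bbB (bbq k) lngeo_bb. Qed.

Let totdev_bb : bb totdev. Proof. by apply: bb_sum => k; exact: bb_norm. Qed.

Let lndev_le k y : `|lndev k y| <= 12 * C.
Proof.
rewrite /lndev ler_norml; have := lngeo_bound y; have := lnq_bound k y.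
by move=> /andP[? ?] /andP[? ?]; lra.
Qed.

Let geo_bb : bb (fun y => expR (lngeo f y)).
Proof. exact: bbp_bb (bbp_expR lngeo_bb). Qed.

(** Since the [lndev k] have weighted mean zero, the arithmetic minus the geometric mean of the
    marginals is the geometric mean times the weighted sum of [e^t - 1 - t] at [t = lndev k y]. By
    [norm_le_expR] this controls each [|t|]; the inverses of the weights pay for passing to an
    unweighted sum. Arithmetic means have mass one. *)
Lemma totdev_int th : 0 < th -> J (fun y => expR (lngeo f y) * totdev y) <=
  expR (6 * C) * K%:R * th +
  expR (12 * C) / th * (\sum_k (lam k)^-1) * (1 - J (fun y => expR (lngeo f y))).
Proof.
move=> th0; set W := \sum_k _.
pose G := expR (12 * C) / th * W.
have bsum : bb (fun y => \sum_k lam k * q f k y).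
  apply: bb_sum => k; apply: bbM; first exact: bb_cst.
  exact: (bbp_bb (gmarg_bbp (pE k) pJ (fEJ k) (E1 k) V0 (bc k) (bf k))).
pose rhs y := expR (6 * C) / V * K%:R * th +
  G * (\sum_k lam k * q f k y - expR (lngeo f y)).
have -> : expR (6 * C) * K%:R * th + G * (1 - J (fun y => expR (lngeo f y))) = J rhs.
  rewrite /rhs pfD//; [|exact: bb_cst|by apply: bbM; [exact: bb_cst|exact: bbB]].
  rewrite pf_cst// pfZ//; last exact: bbB.
  rewrite pfB// pf_sum//; last first.
    move=> k; apply: bbM; first exact: bb_cst.
    exact: (bbp_bb (gmarg_bbp (pE k) pJ (fEJ k) (E1 k) V0 (bc k) (bf k))).
  have -> : \sum_k J (fun y => lam k * q f k y) = 1.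
    rewrite -[RHS]lam1; apply: eq_bigr => k _; rewrite pfZ//.
      by rewrite gmarg_int// mulr1.
    exact: (bbp_bb (gmarg_bbp (pE k) pJ (fEJ k) (E1 k) V0 (bc k) (bf k))).
  by rewrite -/V; field; rewrite gt_eqF.
apply: pf_le => //; [exact: bbM| |].
  apply: bbD; first exact: bb_cst.
  by apply: bbM; [exact: bb_cst|exact: bbB].
move=> y; rewrite /rhs.
have gy : expR (lngeo f y) <= expR (6 * C) / V.
  rewrite -[V in leRHS]lnK ?posrE// -expRN -expRD ler_expR.
  by case/andP: (lngeo_bound y).
have W1 k : 1 <= W * lam k.
  rewrite -ler_pdivrMr// div1r /W (bigD1 k)//= lerDl sumr_ge0// => j _.
  by rewrite invr_ge0 ltW.
have qE k : q f k y = expR (lngeo f y) * expR (lndev k y).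
  rewrite -expRD /lndev addrC subrK lnK// posrE.
  exact: (gmarg_gt0 (pE k) pJ (fEJ k) (E1 k) V0 (bc k) (bf k) y).
have dev0 : \sum_k lam k * lndev k y = 0.
  under eq_bigr do rewrite /lndev mulrBr.
  by rewrite sumrB -mulr_suml lam1 mul1r -/(lngeo f y) subrr.
have -> : \sum_k lam k * q f k y - expR (lngeo f y) =
    expR (lngeo f y) * \sum_k lam k * (expR (lndev k y) - 1 - lndev k y).
  have -> : \sum_k lam k * (expR (lndev k y) - 1 - lndev k y) =
      \sum_k (lam k * expR (lndev k y) - lam k - lam k * lndev k y).
    by apply: eq_bigr => k _; ring.
  rewrite !sumrB lam1 dev0 subr0 mulrBr mulr1; congr (_ - _).
  rewrite mulr_sumr; apply: eq_bigr => k _; rewrite qE; ring.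
have td : totdev y <= K%:R * th + G * \sum_k lam k * (expR (lndev k y) - 1 - lndev k y).
  have -> : K%:R * th = \sum_(k < K) th by rewrite sumr_const card_ord mulr_natl.
  rewrite mulr_sumr -big_split /=; apply: ler_sum => k _.
  apply: (le_trans (norm_le_expR th0 (lndev_le k y))).
  rewrite lerD2l.
  have -> : G * (lam k * (expR (lndev k y) - 1 - lndev k y)) =
    W * lam k * (expR (12 * C) / th * (expR (lndev k y) - 1 - lndev k y)).
    by rewrite /G; ring.
  rewrite ler_peMl//; apply: mulr_ge0; first by rewrite divr_ge0 ?expR_ge0 ?(ltW th0).
  by have := expR_ge1Dx (lndev k y); lra.
apply: (@le_trans _ _ (expR (lngeo f y) *
    (K%:R * th + G * \sum_k lam k * (expR (lndev k y) - 1 - lndev k y)))).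
  by rewrite ler_wpM2l ?expR_ge0.
rewrite mulrDr lerD//; last by rewrite mulrCA.
by rewrite -mulrA ler_wpM2r// mulr_ge0// ltW.
Qed.
(** The geometric mean over [q k], damped by [totdev]. The damping dominates every [|lndev k y|], so
    the ratio is at most 1 and really thins; being the same for all [k], it leaves the product with
    [q k] independent of [k]. *)
Definition thin_ratio k y := expR (- lndev k y - totdev y).

Definition thin_marg y := expR (lngeo f y - totdev y).

Definition thin_plan k : A k -> B -> R := gthin J (@c k) (f k) (thin_ratio k).

Let ratio_bbp k : bbp (thin_ratio k).
Proof. by apply: bbp_expR; apply: bbB => //; exact: bbN. Qed.

Let ratio_le1 k y : thin_ratio k y <= 1.
Proof.
rewrite -expR0 ler_expR subr_le0 (le_trans (ler_norm _))// normrN.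
by rewrite /totdev (bigD1 k)//= lerDl sumr_ge0.
Qed.

Let margE k : (fun y => q f k y * thin_ratio k y) = thin_marg.
Proof.
apply/funext => y; have q0 := gmarg_gt0 (pE k) pJ (fEJ k) (E1 k) V0 (bc k) (bf k) y.
rewrite -[q f k y]lnK ?posrE// -expRD /thin_marg /lndev; congr expR; ring.
Qed.

Lemma thin_plan_bbp k : bbp2 (@thin_plan k).
Proof. exact: (gthin_bbp pJ (fEJ k) V0 (bc k) (bf k) (ratio_bbp k) (ratio_le1 k)). Qed.

Lemma thin_plan_int k x : J (@thin_plan k x) = 1.
Proof. exact: (gthin_int pJ (fEJ k) V0 (bc k) (bf k) (ratio_bbp k)). Qed.

Lemma thin_plan_marg k y :
  E (fun x => @thin_plan k x y) = thin_marg y + (1 - J thin_marg) / V.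
Proof.
rewrite (gthin_marg (pE k) pJ (fEJ k) (E1 k) V0 (bc k) (bf k) (ratio_bbp k)).
by rewrite margE -(margE k).
Qed.

(** In [gibbs_cost] the potential terms cancel after weighting, because the plans share the marginal
    [m] and the potentials sum to zero; the divergences are bounded by [gthin_kl]. *)
Lemma thin_plan_cost :
  \sum_k lam k * E (fun x => J (fun y => c x y * @thin_plan k x y +
     @thin_plan k x y * ln (@thin_plan k x y)))
  <= dual_val f + 2 * (1 + expR (6 * C)) * (1 - J thin_marg).
Proof.
set G := _ * (1 - _).
pose m y := thin_marg y + (1 - J thin_marg) / V.
have bm : bb m.
  by apply: bbD; [apply/bbp_bb/bbp_expR; exact: (bbB lngeo_bb totdev_bb)|exact: bb_cst].
have m0 : \sum_k lam k * J (fun y => f k y * m y) = 0.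
  have -> : \sum_k lam k * J (fun y => f k y * m y) =
      \sum_k J (fun y => lam k * (f k y * m y)).
    by apply: eq_bigr => k _; rewrite pfZ//; exact: bbM.
  rewrite -pf_sum//; last by move=> k; apply: bbM; [exact: bb_cst|exact: bbM].
  rewrite -[RHS](pf0 pJ); congr J; apply/funext => y.
  have [_ f0 _] := Ff; under eq_bigr do rewrite mulrA.
  by rewrite -mulr_suml f0 mul0r.
have -> : dual_val f + G =
    \sum_k lam k * (G + J (fun y => f k y * m y) - E (fun x => ln (Z f k x))).
  under [RHS]eq_bigr do rewrite mulrBr mulrDr.
  rewrite sumrB big_split /= m0 addr0 -mulr_suml lam1 mul1r addrC; congr (_ + _).
  rewrite /dual_val -sumrN; apply: eq_bigr => k _; rewrite -mulrN pfN//.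
  apply: bb_ln; exact: (gpart_bbp pJ (fEJ k) V0 (bc k) (bf k)).
apply: ler_sum => k _; rewrite ler_pM2l//.
rewrite (gibbs_cost (pE k) pJ (fEJ k) V0 (bc k) (bf k) (thin_plan_bbp k) (@thin_plan_int k)).
rewrite lerD2r; under [X in _ + J X]eq_fun do rewrite thin_plan_marg.
rewrite lerD2r /G -(margE k).
apply: (gthin_kl (pE k) pJ (fEJ k) (E1 k) V0 (bc k) (bf k)) => //.
exact: dual_feasible_osc.
Qed.

(** By [e^-t >= 1 - t], the mass lost to damping is at most the integral bounded in [totdev_int]. *)
Lemma thin_marg_ge th : 0 < th -> 1 - J thin_marg <=
  expR (6 * C) * K%:R * th + (1 + expR (12 * C) / th * (\sum_k (lam k)^-1)) *
    (1 - J (fun y => expR (lngeo f y))).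
Proof.
move=> th0; have := totdev_int th0.
have : J (fun y => expR (lngeo f y)) - J (fun y => expR (lngeo f y) * totdev y) <= J thin_marg.
  rewrite -pfB//; last exact: bbM.
  apply: pf_le => //; first by apply: bbB => //; exact: bbM.
    by apply/bbp_bb/bbp_expR; exact: (bbB lngeo_bb totdev_bb).
  move=> y; rewrite -[X in X - _]mulr1 -mulrBr /thin_marg expRD ler_wpM2l ?expR_ge0//.
  by have := expR_ge1Dx (- totdev y).
by set W := _ / th * _ => h1 h2; lra.
Qed.

End step.

Theorem near_optimal_plans (e : R) : 0 < e ->
  exists (f : 'I_K -> B -> R) (p : forall k, A k -> B -> R) (m : B -> R),
  [/\ dual_feasible f, forall k, bbp2 (p k), forall k x, J (p k x) = 1,
      forall k y, E (fun x => p k x y) = m y &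
      \sum_k lam k * E (fun x => J (fun y => c x y * p k x y + p k x y * ln (p k x y)))
        <= dual_val f + e].
Proof.
move=> e0; pose G := 2 * (1 + expR (6 * C)).
have G0 : 0 < G by rewrite mulr_gt0// ltr_wpDr// expR_ge0.
(* Each of the two terms of [thin_marg_ge] may use half of [e / G]. [th] is fixed before [eta],
   since [W] contains its inverse. *)
pose th := e / G / 2 / (expR (6 * C) * K%:R + 1).
have K1 : 0 < expR (6 * C) * K%:R + 1 by rewrite ltr_wpDl// mulr_ge0// expR_ge0.
have th0 : 0 < th by rewrite !divr_gt0.
pose W := 1 + expR (12 * C) / th * (\sum_k (lam k)^-1).
have W0 : 0 < W.
  rewrite ltr_wpDr//; apply: mulr_ge0; first by rewrite divr_ge0 ?expR_ge0 ?(ltW th0).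
  by apply: sumr_ge0 => k _; rewrite invr_ge0 ltW.
pose eta := e / G / 2 / W.
have eta0 : 0 < eta by rewrite !divr_gt0.
pose S := [set dual_val f | f in dual_feasible].
have Ssup : has_sup S.
  split; first by exists (dual_val (fun _ _ => 0)), (fun _ _ => 0) => //; exact: dual_feasible0.
  by exists (C - ln V) => _ [f Ff <-]; exact: dual_val_le.
have [_ [f Ff <-] fS] := sup_adherent eta0 Ssup.
have geo0 : 0 < J (fun y => expR (lngeo f y)).
  have [_ [a a0 ha]] := bbp_expR (lngeo_bb Ff).
  apply: (lt_le_trans (mulr_gt0 a0 V0)); rewrite -pf_cst//.
  by apply: pf_le => //; [exact: bb_cst|exact: bbp_bb (bbp_expR (lngeo_bb Ff))].
(* The step cannot exceed the supremum, so its gain [- ln J] is below [eta], and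
   [1 - J <= - ln J]. *)
have Jg : 1 - J (fun y => expR (lngeo f y)) <= eta.
  have h1 := dual_step_val Ff.
  have h2 : dual_val (dual_step f) <= sup S.
    by apply: ub_le_sup; [case: Ssup|exists (dual_step f) => //; exact: dual_step_feasible].
  have h3 := expR_ge1Dx (ln (J (fun y => expR (lngeo f y)))).
  by rewrite lnK ?posrE// in h3; lra.
exists f, (@thin_plan f), (fun y => thin_marg f y + (1 - J (thin_marg f)) / V); split => //.
- by move=> k; exact: thin_plan_bbp.
- by move=> k x; exact: thin_plan_int.
- by move=> k y; exact: thin_plan_marg.
apply: (le_trans (thin_plan_cost Ff)); rewrite lerD2l.
have := thin_marg_ge Ff th0; rewrite -/W => h.
have h1 : expR (6 * C) * K%:R * th <= e / G / 2.
  by rewrite /th mulrA ler_pdivrMr// mulrC ler_wpM2l ?divr_ge0 ?(ltW e0) ?(ltW G0)// lerDl.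
have h2 : W * (1 - J (fun y => expR (lngeo f y))) <= e / G / 2.
  by rewrite mulrC -ler_pdivlMr.
rewrite -/G -ler_pdivlMl// mulrC; lra.
Qed.

End dual.

(** * Borel sets and iterated Lebesgue integrals *)

Section countable_bases.

(** Second countability makes every open set of a product a countable union of open rectangles,
    hence measurable for the product sigma-algebra. *)
Definition cbase (T : topologicalType) (b : nat -> set T) :=
  (forall i, open (b i)) /\
  forall (U : set T) x, open U -> U x -> exists i, b i x /\ b i `<=` U.

Lemma cbase_dense (R : realType) (T : pseudoMetricType R) (C : countType) (D : C -> T) :
  (forall x (r : R), 0 < r -> exists q, ball x r (D q)) -> exists b : nat -> set T, cbase b.
Proof.
move=> dD.
(* Interiors are taken because balls of a pseudometric type need not be open. *)
exists (fun i => if (unpickle i : option (C * nat)) is Some qm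
  then (ball (D qm.1) (qm.2.+1%:R^-1))^° else set0); split.
  by move=> i; case: unpickle => [qm|]; [exact: open_interior|exact: open0].
move=> U x oU Ux; have /nbhs_ballP[r /= r0 rU] : nbhs x U by exact: open_nbhs_nbhs.
pose m := Num.truncn (2 / r).
have m0 : 0 < m.+1%:R :> R by rewrite ltr0n.
have mr : m.+1%:R^-1 <= r / 2.
  rewrite -[r / 2]invrK lef_pV2 ?posrE ?invr_gt0 ?divr_gt0//.
  by rewrite invf_div ltW// truncnS_gt.
have e0 : 0 < m.+1%:R^-1 / 2 :> R by rewrite divr_gt0// invr_gt0.
have [q xq] := dD x _ e0.
exists (pickle (q, m)); rewrite pickleK /=; split.
  apply/nbhs_ballP; exists (m.+1%:R^-1 / 2) => //= y xy.
  exact: ball_split (ball_sym xq) xy.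
move=> y /interior_subset qy; apply: rU.
apply: (@le_ball _ _ x (m.+1%:R^-1 / 2 + m.+1%:R^-1)); last exact: ball_triangle xq qy.
by move: mr; move: (m.+1%:R^-1) => i; lra.
Qed.

Lemma cbase_R (R : realType) : exists b : nat -> set R, cbase b.
Proof.
apply: (@cbase_dense R R rat (fun q => ratr q)) => x r r0.
have xr : x - r < x + r by lra.
have [q] := rat_in_itvoo xr; rewrite in_itv/= => /andP[h1 h2].
by exists q; rewrite /ball/= ltr_distlC h1 h2.
Qed.

Lemma cbase_rV (R : realType) n : exists b : nat -> set 'rV[R]_n, cbase b.
Proof.
apply: (@cbase_dense R 'rV[R]_n 'rV[rat]_n (fun q => map_mx ratr q)) => x r r0.
have H j : exists q : rat, ball (x 0 j) r (ratr q).
  have xr : x 0 j - r < x 0 j + r by lra.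
  have [q] := rat_in_itvoo xr; rewrite in_itv/= => /andP[h1 h2].
  by exists q; rewrite /ball/= ltr_distlC h1 h2.
have [q qP] := choice H.
exists (\row_j q j); split => // i j; rewrite !mxE (ord1 i); exact: qP.
Qed.

Lemma measurable_rectangles d1 d2 (A : measurableType d1) (B : measurableType d2)
    (b1 : nat -> set A) (b2 : nat -> set B) (U : set (A * B)) :
  (forall i, measurable (b1 i)) -> (forall i, measurable (b2 i)) ->
  (forall z, U z -> exists i j, [/\ b1 i z.1, b2 j z.2 & b1 i `*` b2 j `<=` U]) ->
  measurable U.
Proof.
move=> m1 m2 HU.
pose r k := if (unpickle k : option (nat * nat)) is Some ij
  then (if pselect (b1 ij.1 `*` b2 ij.2 `<=` U) then b1 ij.1 `*` b2 ij.2 else set0)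
  else set0.
have -> : U = \bigcup_k r k.
  rewrite eqEsubset; split => z.
    move=> Uz; have [i [j [h1 h2 h3]]] := HU _ Uz.
    exists (pickle (i, j)) => //; rewrite /r pickleK /=.
    by case: pselect.
  move=> [k _]; rewrite /r; case: unpickle => [ij|//]; case: pselect => //.
  by move=> h /h.
apply: bigcupT_measurable => k; rewrite /r; case: unpickle => [ij|//].
case: pselect => h; last exact: measurable0.
exact: measurableX.
Qed.

Lemma cbase_prod (X Y : topologicalType) (b1 : nat -> set X) (b2 : nat -> set Y)
    (U : set (X * Y)) : cbase b1 -> cbase b2 -> open U ->
  forall z, U z -> exists i j, [/\ b1 i z.1, b2 j z.2 & b1 i `*` b2 j `<=` U].
Proof.
move=> [_ h1] [_ h2] oU [x y] Uz.
have [[P Q] /= [Px Qy] PQ] : nbhs (x, y) U by exact: open_nbhs_nbhs.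
have [i [ix iP]] := h1 P^° x (@open_interior _ P) Px.
have [j [jy jQ]] := h2 Q^° y (@open_interior _ Q) Qy.
exists i, j; split => // -[u v] [/= iu jv]; apply: PQ; split => /=.
  by apply: interior_subset; exact: iP.
by apply: interior_subset; exact: jQ.
Qed.

End countable_bases.

Section borel.
Variable R : realType.

Definition Rn n := g_sigma_algebraType (open : set_system 'rV[R]_n).

Lemma borel_setR (B : set R) : borel_set B <-> measurable (B : set (measurableTypeR R)).
Proof.
split; last first.
  apply: smallest_sub; first exact: smallest_sigma_algebra.
  move=> _ [[a b] _ <-] /=.
  have oU U : open U -> borel_set U by move=> ?; exact: sub_sigma_algebra.
  rewrite (_ : `]a, b]%classic = `]a, +oo[%classic `\` `]b, +oo[%classic); last first.
    rewrite eqEsubset; split => x /=; rewrite !in_itv/= !andbT.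
      by move=> /andP[-> xb]; split => //; apply/negP; rewrite -leNgt.
    by move=> [-> /negP]; rewrite -leNgt => ->.
  by apply: (@measurableD _ (g_sigma_algebraType (@open R))); apply: oU; rewrite set_itvoy; exact: open_gt.
apply: smallest_sub; first exact: sigma_algebra_measurable.
by move=> U oU; exact: open_measurable.
Qed.

Lemma measurable_continuous n (f : 'rV[R]_n -> R) : continuous f ->
  measurable_fun [set: Rn n] (f : Rn n -> measurableTypeR R).
Proof.
move=> cf; apply: (@measurability _ _ _ _ _ _ (@open R)).
  by apply/seteqP; split => B /borel_setR.
move=> _ [U oU <-]; rewrite setTI; apply: sub_sigma_algebra.
by apply: open_comp => // z _; exact: cf.
Qed.

Lemma borel_fun_measurable n (f : 'rV[R]_n -> R) :
  borel_fun f <-> measurable_fun [set: Rn n] (f : Rn n -> measurableTypeR R).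
Proof.
split => [bf _ B mB|mf B bB].
  by rewrite setTI; apply: bf; apply/borel_setR.
by have := mf measurableT B; rewrite setTI; apply; apply/borel_setR.
Qed.

Lemma borel_fun2_measurable a b (f : 'rV[R]_a * 'rV[R]_b -> R) : borel_fun f ->
  measurable_fun [set: Rn a * Rn b] (f : Rn a * Rn b -> measurableTypeR R).
Proof.
move=> bf _ B mB; rewrite setTI.
have /bf : borel_set B by apply/borel_setR.
have [b1 cb1] := cbase_rV R a; have [b2 cb2] := cbase_rV R b.
move: (f @^-1` B); apply: smallest_sub; first exact: sigma_algebra_measurable.
move=> U oU; apply: (@measurable_rectangles _ _ (Rn a) (Rn b) b1 b2).
- by move=> i; apply: sub_sigma_algebra; case: cb1.
- by move=> i; apply: sub_sigma_algebra; case: cb2.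
- exact: cbase_prod.
Qed.

(** The identification of [R * R^n] with [R^(n+1)] along which [lintp] recurses. *)
Definition consv n (z : R * 'rV[R]_n) : 'rV[R]_n.+1 :=
  row_mx (const_mx z.1 : 'rV[R]_1) z.2.

Lemma consv_ball n (z z' : R * 'rV[R]_n) e : ball z e z' -> ball (consv z) e (consv z').
Proof.
move=> zz'; have [h1 h] : ball z.1 e z'.1 /\ ball z.2 e z'.2 := zz'.
have [e0 h2] : 0 < e /\ forall i j, ball (z.2 i j) e (z'.2 i j) := h.
split => // i j; rewrite /consv !mxE.
by case: (@fintype.split 1 n j) => k; rewrite ?mxE //; exact: h2.
Qed.

Lemma consv_continuous n : continuous (@consv n).
Proof.
move=> z; apply/cvg_ballP => e e0; apply: filterS (nbhsx_ballx z e e0) => z' zz'.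
exact: consv_ball.
Qed.

Lemma measurable_consv n :
  measurable_fun [set: measurableTypeR R * Rn n] (@consv n : _ -> Rn n.+1).
Proof.
apply: (@measurability _ _ (measurableTypeR R * Rn n)%type (Rn n.+1) setT (@consv n)
  (@open 'rV[R]_n.+1) erefl) => _ [U oU <-]; rewrite setTI.
have [b1 cb1] := cbase_R R; have [b2 cb2] := cbase_rV R n.
apply: (@measurable_rectangles _ _ (measurableTypeR R) (Rn n) b1 b2).
- by move=> i; apply: open_measurable; case: cb1.
- by move=> i; apply: sub_sigma_algebra; case: cb2.
- apply: cbase_prod => //; apply: open_comp => // z _; exact: consv_continuous.
Qed.

Definition headv n (v : 'rV[R]_n.+1) : R := v 0 0.
Definition tailv n (v : 'rV[R]_n.+1) : 'rV[R]_n := rsubmx (v : 'rV[R]_(1 + n)).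

Lemma headv_cons n z : headv (@consv n z) = z.1.
Proof.
transitivity (row_mx (const_mx z.1 : 'rV[R]_1) z.2 0 (lshift n 0)).
  by rewrite /headv /consv; congr (row_mx _ _ _ _); exact: val_inj.
by rewrite row_mxEl mxE.
Qed.

Lemma tailv_cons n z : tailv (@consv n z) = z.2.
Proof. exact: row_mxKr. Qed.

Lemma headv_continuous n : continuous (@headv n).
Proof.
move=> v; have F := nbhs_filter v; apply/cvg_ballP => e e0.
apply: (@filterS _ _ (nbhs_filter v) (ball v e) _ _ (nbhsx_ballx v e e0)) => v' [_ vv'].
exact: vv'.
Qed.

Lemma tailv_continuous n : continuous (@tailv n).
Proof.
move=> v; have F := nbhs_filter v; apply/cvg_ballP => e e0.
apply: (@filterS _ _ (nbhs_filter v) (ball v e) _ _ (nbhsx_ballx v e e0)) => v' [_ vv'].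
by split => // i j; rewrite !mxE; exact: vv'.
Qed.

Lemma measurable_headtail n : measurable_fun [set: Rn n.+1]
  ((fun v => (headv v, tailv v)) : Rn n.+1 -> measurableTypeR R * Rn n).
Proof.
apply: (@measurable_fun_pair _ _ _ (Rn n.+1) (measurableTypeR R) (Rn n)).
  by apply: measurable_continuous; exact: headv_continuous.
apply: (@measurability _ _ (Rn n.+1) (Rn n) setT (@tailv n) (@open 'rV[R]_n) erefl).
move=> _ [U oU <-]; rewrite setTI; apply: sub_sigma_algebra.
by apply: open_comp => // z _; exact: tailv_continuous.
Qed.

End borel.

(** * Iterated integrals as integrals against a sigma-finite measure *)

Section lebesgue_rV.
Variable R : realType.
Local Open Scope ereal_scope.

(** Induction on the dimension: a unit mass on [R^0], then the image under [consv] of the product of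
    Lebesgue measure with the measure already built. Tonelli matches the recursion of [lintp], and
    sigma-finiteness is carried along for the next product. *)
Lemma lintp_measure n : exists M : {sigma_finite_measure set (Rn R n) -> \bar R},
  forall f : Rn R n -> \bar R, measurable_fun setT f -> (forall x, 0 <= f x) ->
    lintp f = \int[M]_x f x.
Proof.
elim: n => [|n [M MP]].
  exists (\d_(0%R : Rn R 0)) => f mf f0.
  by rewrite integral_dirac//= diracT mul1e.
pose P : {measure set (measurableTypeR R * Rn R n)%type -> \bar R} :=
  lebesgue_integral_fubini_product_measure1__canonical__measure_function_Measure
    (@lebesgue_measure R) M.
pose c : measurableTypeR R * Rn R n -> Rn R n.+1 := @consv R n.
have mc : measurable_fun setT c by exact: measurable_consv.
pose N : {measure set (Rn R n.+1) -> \bar R} :=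
  measure_function_pushforward__canonical__measure_function_Measure P mc.
have sN : sigma_finite setT N.
  have /sigma_finiteP[F [FT ndF Foo]] := sigma_finiteT (@lebesgue_measure R).
  have /sigma_finiteP[G [GT ndG Goo]] := sigma_finiteT M.
  pose u (v : Rn R n.+1) : measurableTypeR R * Rn R n := (headv v, tailv v).
  exists (fun i => u @^-1` (F i `*` G i)).
    apply/seteqP; split => // v _.
    have [i _ Fi] : (\bigcup_i F i) (headv v) by rewrite -FT.
    have [j _ Gj] : (\bigcup_i G i) (tailv v) by rewrite -GT.
    exists (maxn i j) => //; split => /=.
      by move: Fi; exact/subsetPset/ndF/leq_maxl.
    by move: Gj; exact/subsetPset/ndG/leq_maxr.
  move=> i; have [mF Fi] := Foo i; have [mG Gi] := Goo i.
  have mFG := measurableX mF mG; split.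
    by have := @measurable_headtail R n measurableT _ mFG; rewrite setTI.
  rewrite /N /= /pushforward (_ : c @^-1` _ = F i `*` G i); last first.
    by apply/seteqP; split => z /=; rewrite /c headv_cons tailv_cons.
  by rewrite /P /= product_measure1E// lte_mul_pinfty// ge0_fin_numE.
pose N' : {sigma_finite_measure set (Rn R n.+1) -> \bar R} :=
  HB.pack_for {sigma_finite_measure set (Rn R n.+1) -> \bar R} (Measure.sort N)
    (Measure_isSigmaFinite.Build _ _ _ N sN).
exists N' => f mf f0.
have mfc2 : measurable_fun setT (f \o c) by apply: measurableT_comp.
have -> : \int[N']_x f x = \int[P]_z f (c z).
  by rewrite ge0_integral_pushforward.
rewrite fubini_tonelli1//=; apply: eq_integral => x _.
rewrite /fubini_F -MP//.
exact: (measurable_fun_pair2 x mfc2).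
Qed.

Definition lebn n := sval (cid (lintp_measure n)).

Lemma lintpE n (f : Rn R n -> \bar R) : measurable_fun setT f -> (forall x, 0 <= f x) ->
  lintp f = \int[lebn n]_x f x.
Proof. exact: (svalP (cid (lintp_measure n))). Qed.

Lemma maxe_funepos T (f : T -> \bar R) : f^\+ = fun x => maxe (f x) 0.
Proof. by apply/funext => x; rewrite funeposE. Qed.

Lemma maxe_funeneg T (f : T -> \bar R) : f^\- = fun x => maxe (- f x) 0.
Proof. by apply/funext => x; rewrite funenegE. Qed.

Lemma lintE n (f : Rn R n -> \bar R) : measurable_fun setT f ->
  lint f = \int[lebn n]_x f x.
Proof.
move=> mf; rewrite integralE.
rewrite -(@lintpE n f^\+ (measurable_funepos mf) (funepos_ge0 f)).
rewrite -(@lintpE n f^\- (measurable_funeneg mf) (funeneg_ge0 f)) /lint.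
by rewrite maxe_funepos maxe_funeneg.
Qed.

Lemma lint2pE a b (f : Rn R a * Rn R b -> \bar R) :
  measurable_fun setT f -> (forall x, 0 <= f x) ->
  lint2p (fun x y => f (x, y)) = \int[lebn a \x lebn b]_z f z.
Proof.
move=> mf f0; rewrite /lint2p fubini_tonelli1//.
have -> : (fun x => lintp (fun y => f (x, y))) = fubini_F (lebn b) f.
  by apply/funext => x; rewrite lintpE//; exact: (measurable_fun_pair2 x mf).
rewrite lintpE//; first exact: measurable_fun_fubini_tonelli_F.
by move=> x; apply: integral_ge0.
Qed.

Lemma lint2E a b (f : Rn R a * Rn R b -> \bar R) : measurable_fun setT f ->
  lint2 (fun x y => f (x, y)) = \int[lebn a \x lebn b]_z f z.
Proof.
move=> mf; rewrite integralE /lint2.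
have := @lint2pE a b f^\+ (measurable_funepos mf) (funepos_ge0 f).
have := @lint2pE a b f^\- (measurable_funeneg mf) (funeneg_ge0 f).
by rewrite maxe_funepos maxe_funeneg => <- <-.
Qed.

End lebesgue_rV.

(** * Weighted integrals as positive functionals *)

Section weighted_integral.
Variables (R : realType) (d : measure_display) (T : measurableType d).
Variables (m : {measure set T -> \bar R}) (w : T -> R).

(** The weight is a density, the indicator of [Y], or the joint density of a plan; these give all
    concrete instances of [posfun]. *)
Definition wint (g : T -> R) : R := \int[m]_x (w x * g x).

Hypotheses (w0 : forall x, 0 <= w x) (iw : m.-integrable setT (EFin \o w)).

Lemma wint_integrable g : bb g -> m.-integrable setT (EFin \o (fun x => w x * g x)).
Proof.
move=> [mg [C gC]].
have mw : measurable_fun setT w by apply/measurable_EFinP; exact: measurable_int iw.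
apply: (@le_integrable _ _ _ _ _ measurableT _ (fun x => C%:E * (w x)%:E)%E).
- by apply/measurable_EFinP; exact: measurable_funM.
- move=> x _; rewrite /= lee_fin !normrM (ger0_norm (w0 x)) mulrC ler_wpM2r//.
  by rewrite (le_trans (gC x))// ler_norm.
- exact: integrableZl.
Qed.

Lemma wintE g : bb g -> (\int[m]_x (w x * g x)%:E)%E = (wint g)%:E.
Proof.
move=> bg; rewrite /wint /Rintegral fineK//.
exact: integrable_fin_num (wint_integrable bg).
Qed.

Lemma wint_posfun : posfun wint.
Proof.
split=> [a f g bf bg|f bf f0]; last first.
  by apply: Rintegral_ge0 => x _; exact: mulr_ge0.
rewrite /wint; have if_ := wint_integrable bf; have ig := wint_integrable bg.
transitivity (\int[m]_x (a * (w x * f x) + w x * g x)).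
  by apply: eq_Rintegral => x _; ring.
rewrite RintegralD//; last exact: (integrableZl measurableT a if_).
by rewrite RintegralZl.
Qed.

End weighted_integral.

Section weighted_fubini.
Variables (R : realType) (d1 d2 : measure_display).
Variables (T1 : measurableType d1) (T2 : measurableType d2).
Variables (m1 : {sigma_finite_measure set T1 -> \bar R}).
Variables (m2 : {sigma_finite_measure set T2 -> \bar R}).
Variables (w1 : T1 -> R) (w2 : T2 -> R).
Hypotheses (w10 : forall x, 0 <= w1 x) (iw1 : m1.-integrable setT (EFin \o w1)).
Hypotheses (w20 : forall x, 0 <= w2 x) (iw2 : m2.-integrable setT (EFin \o w2)).

Let mw1 : measurable_fun setT w1.
Proof. by apply/measurable_EFinP; exact: measurable_int iw1. Qed.
Let mw2 : measurable_fun setT w2.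
Proof. by apply/measurable_EFinP; exact: measurable_int iw2. Qed.

Let ww (z : T1 * T2) := w1 z.1 * w2 z.2.

Lemma weight_prod_ge0 z : 0 <= ww z. Proof. exact: mulr_ge0. Qed.

Lemma weight_prod_integrable : (m1 \x m2)%E.-integrable setT (EFin \o ww).
Proof.
have mww : measurable_fun setT ww.
  by apply: measurable_funM; apply: measurableT_comp.
have mE : measurable_fun setT (EFin \o ww) by exact/measurable_EFinP.
apply/integrableP; split => //.
under eq_integral do rewrite /= ger0_norm ?weight_prod_ge0//.
rewrite fubini_tonelli1//; last by move=> z; rewrite lee_fin weight_prod_ge0.
rewrite /fubini_F /=.
have E x : (\int[m2]_y (ww (x, y))%:E)%E = ((w1 x)%:E * \int[m2]_y (w2 y)%:E)%E.
  by rewrite -integralZl//.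
under eq_integral do rewrite E.
have := integrable_fin_num measurableT iw2; rewrite fin_numE => /andP[_ _].
have fw2 := integrable_fin_num measurableT iw2.
have fw1 := integrable_fin_num measurableT iw1.
rewrite -(fineK fw2) integralZr// -(fineK fw1) -EFinM ltry//.
Qed.

Lemma wint_fubini : fubini (wint m1 w1) (wint m2 w2).
Proof.
have ml (h : T1 -> T2 -> R) : bb2 h -> (forall x y, 0 <= h x y) ->
    measurable_fun setT (fun x => wint m2 w2 (h x)).
  move=> [mh _] h0; apply: measurableT_comp => //.
  apply: (@measurable_fun_fubini_tonelli_F _ _ _ _ _ m2
    (fun z => (w2 z.2 * h z.1 z.2)%:E)).
    apply/measurable_EFinP; apply: measurable_funM => //.
    exact: measurableT_comp.
  by move=> z; rewrite lee_fin mulr_ge0.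
have mr (h : T1 -> T2 -> R) : bb2 h -> (forall x y, 0 <= h x y) ->
    measurable_fun setT (fun y => wint m1 w1 (fun x => h x y)).
  move=> [mh _] h0; apply: measurableT_comp => //.
  apply: (@measurable_fun_fubini_tonelli_G _ _ _ _ _ m1
    (fun z => (w1 z.1 * h z.1 z.2)%:E)).
    apply/measurable_EFinP; apply: measurable_funM => //.
    exact: measurableT_comp.
  by move=> z; rewrite lee_fin mulr_ge0.
have p1 := wint_posfun w10 iw1; have p2 := wint_posfun w20 iw2.
(* Tonelli gives measurability of partial integrals of nonnegative functions; a constant reduces
   bounded functions to these. *)
have shift (h : T1 -> T2 -> R) : bb2 h -> exists2 C, bb2 (fun x y => h x y + C) &
    forall x y, 0 <= h x y + C.
  move=> bh; have [_ [C hC]] := bh; exists C; first exact: bbD bh (bb_cst _ _).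
  by move=> x y; have := hC (x, y); rewrite ler_norml /= => /andP[]; lra.
split.
- move=> h bh; have [C bC hC] := shift h bh.
  have -> : (fun x => wint m2 w2 (h x)) = fun x =>
     wint m2 w2 (fun y => h x y + C) - wint m2 w2 (fun=> C).
    apply/funext => x; rewrite -(pfB p2) ?addrK//; last exact: bb_cst.
      by congr wint; apply/funext => y; rewrite addrK.
    by apply: bbD (bb_cst _ _); exact: bb2_l.
  by apply: measurable_funB => //; exact: ml.
- move=> h bh; have [C bC hC] := shift h bh.
  have -> : (fun y => wint m1 w1 (fun x => h x y)) = fun y =>
     wint m1 w1 (fun x => h x y + C) - wint m1 w1 (fun=> C).
    apply/funext => y; rewrite -(pfB p1)//; last exact: bb_cst.
      by congr wint; apply/funext => x; rewrite addrK.
    by apply: bbD (bb_cst _ _); exact: bb2_r.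
  by apply: measurable_funB => //; exact: mr.
- move=> h bh.
  have ih := wint_integrable weight_prod_ge0 weight_prod_integrable bh.
  have := Fubini ih.
  have -> : (fun x => \int[m2]_y (EFin \o (fun z => ww z * h z.1 z.2)%R) (x, y))%E =
      fun x => (w1 x * wint m2 w2 (h x))%:E.
    apply/funext => x; rewrite EFinM -wintE//; last exact: bb2_l.
    rewrite -integralZl//; last by apply: wint_integrable => //; exact: bb2_l.
    by apply: eq_integral => y _; rewrite /= -EFinM mulrA.
  have -> : (fun y => \int[m1]_x (EFin \o (fun z => ww z * h z.1 z.2)%R) (x, y))%E =
      fun y => (w2 y * wint m1 w1 (fun x => h x y))%:E.
    apply/funext => y; rewrite EFinM -wintE//; last exact: bb2_r.
    rewrite -integralZl//; last by apply: wint_integrable => //; exact: bb2_r.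
    by apply: eq_integral => x _; rewrite /= -EFinM /ww /=; congr EFin; ring.
  by move=> /(congr1 fine).
Qed.

Lemma wint_prod (h : T1 -> T2 -> R) : bb2 h ->
  (\int[m1 \x m2]_z (w1 z.1 * w2 z.2 * h z.1 z.2)%:E)%E =
  (wint m1 w1 (fun x => wint m2 w2 (h x)))%:E.
Proof.
move=> bh; have ih := wint_integrable weight_prod_ge0 weight_prod_integrable bh.
have p2 := wint_posfun w20 iw2.
rewrite -(integral12_prod_meas1 ih) -(wintE w10 iw1); last first.
  exact: (fub_bbl p2 wint_fubini bh).
apply: eq_integral => x _; rewrite EFinM -wintE//; last exact: bb2_l.
rewrite -integralZl//; last by apply: wint_integrable => //; exact: bb2_l.
by apply: eq_integral => y _; rewrite /= -EFinM mulrA.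
Qed.

End weighted_fubini.

Section box.
Variable R : realType.

Lemma ind_ge0 T (A : set T) x : 0 <= Defs.indic R A x.
Proof. by rewrite /Defs.indic; case: (`[< A x >]) => /=; rewrite ?lexx ?ler01. Qed.

Lemma ind_le1 T (A : set T) x : Defs.indic R A x <= 1.
Proof. by rewrite /Defs.indic; case: (`[< A x >]) => /=; rewrite ?lexx ?ler01. Qed.

Lemma ind1 T (A : set T) x : A x -> Defs.indic R A x = 1.
Proof. by move=> Ax; rewrite /Defs.indic asboolT. Qed.

Lemma ind0 T (A : set T) x : ~ A x -> Defs.indic R A x = 0.
Proof. by move=> Ax; rewrite /Defs.indic asboolF. Qed.

Lemma measurable_ind d (T : measurableType d) (A : set T) :
  measurable A -> measurable_fun setT (Defs.indic R A).
Proof.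
move=> mA; have -> : Defs.indic R A = \1_A; last exact: measurable_indic.
apply/funext => x; rewrite indicE; have [Ax|Ax] := pselect (A x).
  by rewrite ind1// mem_set.
by rewrite ind0// memNset.
Qed.

Lemma lintp0 n : lintp (fun _ : 'rV[R]_n => 0%E) = 0%E.
Proof. by elim: n => //= n IH; rewrite IH integral0. Qed.

Lemma lintp_ge0 n (f : 'rV[R]_n -> \bar R) : (forall v, 0 <= f v)%E -> (0 <= lintp f)%E.
Proof.
elim: n f => [|n IH] f f0 /=; first exact: f0.
by apply: integral_ge0 => x _; apply: IH.
Qed.

Lemma bnd_consv n (M : R) z : bnd M (@consv R n z) <-> `|z.1| <= M /\ bnd M z.2.
Proof.
split=> [h|[h1 h2] i j].
  split; first by rewrite -(headv_cons z); apply: h.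
  by move=> i j; rewrite -(tailv_cons z) /tailv mxE; apply: h.
by rewrite /consv mxE; case: (@fintype.split 1 n j) => k; rewrite ?mxE.
Qed.

(** It gives compact sets finite volume, so that the indicator of [Y] is an integrable weight. *)
Lemma box_volume n (M : R) : (lintp (fun v : 'rV[R]_n => (Defs.indic R (bnd M) v)%:E) < +oo)%E.
Proof.
elim: n => [|n IH] /=; first exact: ltry.
set c := lintp _ in IH.
have c0 : (0 <= c)%E by apply: lintp_ge0 => v; rewrite lee_fin ind_ge0.
have cE : c = (fine c)%:E by rewrite fineK// ge0_fin_numE.
have -> : (fun x : measurableTypeR R =>
    lintp (fun v : 'rV[R]_n => (Defs.indic R (bnd M) (row_mx (const_mx x : 'rV[R]_1) v))%:E)) =
    fun x => ((fine c)%:E * (\1_(`[- M, M]%classic) x)%:E)%E.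
  apply/funext => x; rewrite indicE mem_setE in_itv/= -ler_norml.
  have [xM|xM] := boolP (`|x| <= M).
    rewrite mule1 -cE; congr lintp; apply/funext => v; congr EFin.
    have [vM|vM] := pselect (bnd M v).
      by rewrite !ind1//; apply/(@bnd_consv n M (x, v)).
    by rewrite !ind0// => /(@bnd_consv n M (x, v))[].
  rewrite mule0 -(lintp0 n); congr lintp; apply/funext => v; congr EFin.
  by rewrite ind0// => /(@bnd_consv n M (x, v))[/= xM']; rewrite xM' in xM.
rewrite integralZl//; last exact: integrable_indic_itv.
rewrite integral_indic// setIT; apply: lte_mul_pinfty; rewrite -?cE// ?ge0_fin_numE//.
have : (@lebesgue_measure R `[(- M)%R, M]%classic < +oo)%E by
  rewrite lebesgue_measure_itv/=; case: ifP => _; rewrite ?ltry// -EFinB ltry.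
exact.
Qed.

End box.

Section quasi_integrable.
Variables (R : realType) (d : measure_display) (T : measurableType d).
Variable m : {measure set T -> \bar R}.
Local Open Scope ereal_scope.

(** [g] may have infinite integral, as the entropy integrand of a plan may before its cost is known
    to be finite. Since [h] is integrable, no indeterminate difference arises. *)
Lemma integral_ge0B (g : T -> \bar R) (h : T -> R) :
  measurable_fun setT g -> (forall x, 0 <= g x) -> (forall x, (0 <= h x)%R) ->
  m.-integrable setT (EFin \o h) ->
  \int[m]_x (g x - (h x)%:E) = \int[m]_x g x - \int[m]_x (h x)%:E /\
  \int[m]_x ((h x)%:E - g x) = \int[m]_x (h x)%:E - \int[m]_x g x.
Proof.
move=> mg g0 h0 ih.
have mh : measurable_fun setT (EFin \o h) by exact: measurable_int ih.
have fh : \int[m]_x (h x)%:E \is a fin_num := integrable_fin_num measurableT ih.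
have ig0 : 0 <= \int[m]_x g x by exact: integral_ge0.
have [goo|goo] := ltP (\int[m]_x g x) +oo.
  have ig : m.-integrable setT g.
    by apply/integrableP; split => //; under eq_integral do rewrite gee0_abs//.
  by split; rewrite integralB.
have {}goo : \int[m]_x g x = +oo by apply/eqP; rewrite -leye_eq.
have mgh : measurable_fun setT (fun x => g x - (h x)%:E) by exact: emeasurable_funB.
set u := fun x => g x - (h x)%:E in mgh *.
have um : \int[m]_x u^\- x < +oo.
  apply: (@le_lt_trans _ _ (\int[m]_x (h x)%:E)); last by rewrite ltey_eq fh.
  apply: ge0_le_integral => //; first exact: measurable_funeneg.
  move=> x _; rewrite funenegE /u ge_max lee_fin h0 andbT.
  by rewrite fin_num_oppeB// -[leRHS]add0e leeD2r// oppe_le0.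
have up : \int[m]_x u^\+ x = +oo.
  apply/eqP; rewrite -leye_eq leNgt; apply/negP => upoo.
  have : \int[m]_x g x <= \int[m]_x u^\+ x + \int[m]_x (h x)%:E.
    have mup := measurable_funepos mgh.
    rewrite -ge0_integralD//; last by move=> x _; rewrite lee_fin.
    apply: ge0_le_integral => //.
      by exact: emeasurable_funD.
    by move=> x _; rewrite -leeBlDr// funeposE le_max lexx.
  by rewrite goo leye_eq => /eqP E; move: upoo fh; case: (\int[m]_x u^\+ x) E => [r| |] //;
    case: (\int[m]_x (h x)%:E).
have fum : \int[m]_x u^\- x \is a fin_num.
  by rewrite ge0_fin_numE//; apply: integral_ge0.
split.
  rewrite -/u integralE up goo; move: fum fh.
  by case: (\int[m]_x u^\- x) => // r _; case: (\int[m]_x (h x)%:E).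
have -> : (fun x => (h x)%:E - g x) = fun x => - u x.
  by apply/funext => x; rewrite /u fin_num_oppeB// addeC.
rewrite integralN; last by rewrite up; move: fum; case: (\int[m]_x u^\- x).
rewrite integralE up goo; move: fum fh.
by case: (\int[m]_x u^\- x) => // r _; case: (\int[m]_x (h x)%:E).
Qed.

End quasi_integrable.

Section plan_marginals.
Variables (R : realType) (d1 d2 : measure_display).
Variables (T1 : measurableType d1) (T2 : measurableType d2).
Variables (m1 : {sigma_finite_measure set T1 -> \bar R}).
Variables (m2 : {sigma_finite_measure set T2 -> \bar R}).
Variable F : T1 * T2 -> R.
Hypotheses (F0 : forall z, 0 <= F z) (iF : (m1 \x m2)%E.-integrable setT (EFin \o F)).

Let mF : measurable_fun setT F.
Proof. by apply/measurable_EFinP; exact: measurable_int iF. Qed.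

Lemma wint_fst (p : T1 -> R) (g : T1 -> R) : measurable_fun setT p ->
  (forall x, 0 <= p x) -> m1.-integrable setT (EFin \o p) ->
  (forall x, (\int[m2]_y (F (x, y))%:E)%E = (p x)%:E) -> bb g ->
  wint (m1 \x m2)%E F (fun z => g z.1) = wint m1 p g.
Proof.
move=> mp p0 ip pF bg.
have i1 := wint_integrable F0 iF (bb2_fst T2 bg).
apply: EFin_inj; rewrite -!wintE//; last exact: (bb2_fst T2 bg).
rewrite -(integral12_prod_meas1 i1); apply: eq_integral => x _.
rewrite EFinM -pF -integralZr//.
apply/integrableP; split.
  by apply/measurable_EFinP; exact: (measurable_fun_pair2 x mF).
under eq_integral do rewrite gee0_abs ?lee_fin//.
by rewrite pF ltry.
Qed.

(** A coupling is tested only on sets [B]. This determines the density of the second marginal almost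
    everywhere, which is then tested against nonnegative bounded functions and, after adding a
    constant, against all bounded ones. *)
Lemma wint_snd (q : T2 -> R) (g : T2 -> R) : (forall y, 0 <= q y) ->
  m2.-integrable setT (EFin \o q) ->
  (forall B, measurable B -> (\int[m1 \x m2]_z (F z * Defs.indic R B z.2)%:E)%E =
    (\int[m2]_y (q y * Defs.indic R B y)%:E)%E) -> bb g ->
  wint (m1 \x m2)%E F (fun z => g z.2) = wint m2 q g.
Proof.
move=> q0 iq Fq.
have mq : measurable_fun setT q by apply/measurable_EFinP; exact: measurable_int iq.
pose G := fubini_G m1 (EFin \o F).
have mG : measurable_fun setT G by exact: (measurable_fubini_G iF).
have G0 y : (0 <= G y)%E by apply: integral_ge0 => x _; rewrite lee_fin.
have restr (B : set T2) (f : T2 -> \bar R) : measurable B ->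
    (\int[m2]_(y in B) f y = \int[m2]_y (f y * (Defs.indic R B y)%:E))%E.
  move=> mB; rewrite integral_mkcond; apply: eq_integral => y _.
  rewrite patchE; have [yB|yB] := pselect (B y).
    by rewrite ind1// mem_set// mule1.
  by rewrite ind0// memNset// mule0.
have slice (h : T2 -> R) : measurable_fun setT h -> (forall y, 0 <= h y) ->
    (\int[m1 \x m2]_z (F z * h z.2)%:E = \int[m2]_y (G y * (h y)%:E))%E.
  move=> mh h0; rewrite fubini_tonelli2//; last 2 first.
  - by apply/measurable_EFinP; apply: measurable_funM => //; exact: measurableT_comp.
  - by move=> z; rewrite lee_fin mulr_ge0.
  apply: eq_integral => y _; rewrite muleC -ge0_integralZl//.
  - by apply: eq_integral => x _; rewrite /= -EFinM mulrC.
  - by apply/measurable_EFinP; exact: (measurable_fun_pair1 y mF).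
  - by move=> x _; rewrite lee_fin.
  - by rewrite lee_fin.
have GqB (B : set T2) : measurable B ->
    (\int[m2]_(y in B) (EFin \o q) y = \int[m2]_(y in B) G y)%E.
  move=> mB; rewrite (restr B G mB) (restr B (EFin \o q) mB).
  have mi : measurable_fun setT (Defs.indic R B) by exact: measurable_ind.
  by rewrite -(slice _ mi (ind_ge0 R B)) Fq.
have Gq : ae_eq m2 setT (EFin \o q) G.
  exact: (integral_ae_eq measurableT iq mG (fun D _ mD => GqB D mD)).
have pN := wint_posfun F0 iF; have pQ := wint_posfun q0 iq.
have ge0 (h : T2 -> R) : bb h -> (forall y, 0 <= h y) ->
    wint (m1 \x m2)%E F (fun z => h z.2) = wint m2 q h.
  move=> bh h0; have [mh _] := bh.
  apply: EFin_inj; rewrite -!wintE//; last exact: (bb2_snd T1 bh).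
  rewrite slice//; symmetry.
  under eq_integral do rewrite EFinM.
  apply: ae_eq_integral => //.
  - by apply: emeasurable_funM; exact/measurable_EFinP.
  - by apply: emeasurable_funM => //; exact/measurable_EFinP.
  - by apply: filterS Gq => y /= H _; rewrite H.
move=> bg; have [_ [C gC]] := bg.
have bgC : bb (fun y => g y + C) by apply: bbD => //; exact: bb_cst.
have h0 y : 0 <= g y + C by have := gC y; rewrite ler_norml => /andP[]; lra.
have := ge0 _ bgC h0; rewrite !pfD//; [|exact: bb_cst|exact: (bb2_snd T1 bg)|exact: bb_cst].
have -> : wint (m1 \x m2)%E F (fun=> C) = wint m2 q (fun=> C).
  have [C0|C0] := leP 0 C.
    by have := @ge0 (fun=> C) (bb_cst _ _) (fun=> C0).
  have := @ge0 (fun=> - C) (bb_cst _ _) (fun _ => _).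
  rewrite !pfN//; [|exact: bb_cst|exact: bb_cst].
  by rewrite oppr_ge0 => /(_ (fun _ => ltW C0))/oppr_inj.
exact: addIr.
Qed.

End plan_marginals.

(** * Compact sets and costs extended by zero *)

Section compact_sets.
Variable R : realType.

Lemma compact_rV_measurable n (Y : set 'rV[R]_n) : compact Y -> measurable (Y : set (Rn R n)).
Proof.
move=> cY; have clY : closed Y by apply: compact_closed => //; exact: norm_hausdorff.
rewrite -[Y]setCK; apply: measurableC; apply: sub_sigma_algebra.
by apply: closed_openC.
Qed.

Lemma compact_bnd n (Y : set 'rV[R]_n) : compact Y -> exists M, forall y, Y y -> bnd M y.
Proof.
move=> cY.
have H j : exists M, forall y, Y y -> `|y 0 j| <= M.
  have cf : {within Y, continuous (fun y : 'rV[R]_n => y 0 j)}.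
    by apply: continuous_subspaceT => y; exact: coord_continuous.
  have [/= S [Sr SP]] := compact_bounded (continuous_compact cf cY).
  exists (S + 1) => y Yy; apply: (SP (S + 1)); first by rewrite ltrDl.
  by exists y.
have [M MP] := choice H.
exists (\sum_j `|M j|) => y Yy i j; rewrite (ord1 i).
rewrite (le_trans (MP j y Yy))// (le_trans (ler_norm _))// (bigD1 j)//= lerDl.
exact: sumr_ge0.
Qed.

Lemma measurable_open2 a b (V : set ('rV[R]_a * 'rV[R]_b)) : open V ->
  measurable (V : set (Rn R a * Rn R b)).
Proof.
move=> oV.
have [b1 cb1] := cbase_rV R a; have [b2 cb2] := cbase_rV R b.
apply: (@measurable_rectangles _ _ (Rn R a) (Rn R b) b1 b2).
- by move=> i; apply: sub_sigma_algebra; case: cb1.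
- by move=> i; apply: sub_sigma_algebra; case: cb2.
- exact: cbase_prod.
Qed.

(** The costs are continuous only on [X * Y]; extended by zero they are bounded and measurable
    everywhere. *)
Definition restr2 a b (X : set 'rV[R]_a) (Y : set 'rV[R]_b)
    (c : 'rV[R]_a -> 'rV[R]_b -> R) x y : R :=
  Defs.indic R X x * Defs.indic R Y y * c x y.

Lemma restr2E a b (X : set 'rV[R]_a) (Y : set 'rV[R]_b) c x y :
  X x -> Y y -> restr2 X Y c x y = c x y.
Proof. by move=> Xx Yy; rewrite /restr2 !ind1// !mul1r. Qed.

Lemma restr2_bb a b (X : set 'rV[R]_a) (Y : set 'rV[R]_b) c :
  compact X -> compact Y -> {within X `*` Y, continuous (fun z => c z.1 z.2)} ->
  bb2 (restr2 X Y c : Rn R a -> Rn R b -> R).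
Proof.
move=> cX cY cc.
have cXY : compact (X `*` Y) by exact: compact_setX.
pose f (z : Rn R a * Rn R b) := restr2 X Y c z.1 z.2.
have fin z : (X `*` Y) z -> f z = c z.1 z.2 by move=> [? ?]; rewrite /f restr2E.
have fout z : ~ (X `*` Y) z -> f z = 0.
  move=> h; rewrite /f /restr2; have [Xx|Xx] := pselect (X z.1); last by rewrite ind0// !mul0r.
  by rewrite [X in _ * X * _]ind0 ?mulr0 ?mul0r// => Yy; apply: h.
split; last first.
  have [/= S [Sr SP]] := compact_bounded (continuous_compact cc cXY).
  exists (`|S| + 1) => z; rewrite -/(f z).
  have [h|h] := pselect ((X `*` Y) z); last by rewrite fout// normr0 addr_ge0.
  rewrite fin//; apply: SP; last by exists z.
  by rewrite (le_lt_trans (ler_norm _))// ltrDl.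
have mXY : measurable (X `*` Y : set (Rn R a * Rn R b)).
  by apply: measurableX; exact: compact_rV_measurable.
apply: (@measurability _ _ (Rn R a * Rn R b)%type (measurableTypeR R) setT f (@open R)).
  by apply/seteqP; split => B /borel_setR.
move=> _ [U oU <-]; rewrite setTI.
have /open_subspaceP[V oV VE] : open ((fun z => c z.1 z.2) @^-1` U : set (subspace (X `*` Y))).
  by move/continuousP : cc; apply.
(* Relative openness describes the preimage inside [X * Y]; outside, the value 0 decides for the
   whole complement. *)
have -> : f @^-1` U = (V `&` (X `*` Y)) `|` (if `[< U 0 >] then ~` (X `*` Y) else set0).
  rewrite VE; apply/seteqP; split => z /=.
    have [h|h] := pselect ((X `*` Y) z); first by rewrite fin//; left.
    by rewrite fout// => U0; right; rewrite asboolT.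
  move=> [[Uz h]|]; first by rewrite fin.
  by have [U0|U0] := pselect (U 0); [rewrite asboolT// => /= h; rewrite fout|rewrite asboolF].
apply: measurableU.
  by apply: measurableI => //; exact: measurable_open2.
by case: `[< U 0 >]; [exact: measurableC|exact: measurable0].
Qed.

Lemma restr2_modulus a b (X : set 'rV[R]_a) (Y : set 'rV[R]_b) c (e : R) :
  compact X -> compact Y -> {within X `*` Y, continuous (fun z => c z.1 z.2)} ->
  0 < e -> exists2 d : R, 0 < d & forall x y y', Y y -> Y y' -> bnd d (y - y') ->
    `|restr2 X Y c x y - restr2 X Y c x y'| <= e.
Proof.
move=> cX cY cc e0.
have cXY : compact (X `*` Y) by exact: compact_setX.
have [d d0 dP] := compact_unif_cont cXY cc e0.
have d20 : 0 < d / 2 by rewrite divr_gt0.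
exists (d / 2) => // x y y' Yy Yy' yy'.
have [Xx|Xx] := pselect (X x); last first.
  by rewrite /restr2 ind0// !mul0r subrr normr0 ltW.
rewrite !restr2E//; apply/ltW/(dP (x, y) (x, y')) => //.
split; first exact: ballxx.
split => // i j; have := yy' i j; rewrite !mxE => h.
by rewrite /ball/= (le_lt_trans h)//; lra.
Qed.

(* The product of the Borel structures is contained in the Borel structure of
   the product. *)
Lemma measurable_borel_fun2 a b (f : Rn R a * Rn R b -> R) :
  measurable_fun setT f -> borel_fun (f : 'rV[R]_a * 'rV[R]_b -> R).
Proof.
move=> mf B /borel_setR mB; have := mf measurableT B mB; rewrite setTI.
have fstB : measurable_fun [set: g_sigma_algebraType (@open ('rV[R]_a * 'rV[R]_b)%type)]
    (fst : _ -> Rn R a).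
  apply: (@measurability _ _ (g_sigma_algebraType (@open ('rV[R]_a * 'rV[R]_b)%type))
    (Rn R a) setT fst open erefl) => _ [U oU <-]; rewrite setTI.
  by apply: sub_sigma_algebra; apply: open_comp => // z _; exact: cvg_fst.
have sndB : measurable_fun [set: g_sigma_algebraType (@open ('rV[R]_a * 'rV[R]_b)%type)]
    (snd : _ -> Rn R b).
  apply: (@measurability _ _ (g_sigma_algebraType (@open ('rV[R]_a * 'rV[R]_b)%type))
    (Rn R b) setT snd open erefl) => _ [U oU <-]; rewrite setTI.
  by apply: sub_sigma_algebra; apply: open_comp => // z _; exact: cvg_snd.
move: (f @^-1` B); apply: smallest_sub; first exact: smallest_sigma_algebra.
move=> A [] [C mC <-].
  by have := fstB measurableT C mC; rewrite !setTI.
by have := sndB measurableT C mC; rewrite !setTI.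
Qed.

End compact_sets.

(** * Transport costs, couplings and the barycenter *)

Section densities.
Variables (R : realType) (n : nat) (A : set 'rV[R]_n) (p : 'rV[R]_n -> R).
Hypothesis dp : is_density A p.

Lemma density_measurable : measurable_fun setT (p : Rn R n -> R).
Proof. by case: dp => /borel_fun_measurable. Qed.

Lemma density_ge0 x : 0 <= p x. Proof. by case: dp. Qed.

Lemma density_neq0 x : p x != 0 -> A x.
Proof.
case: dp => _ _ h _; apply: contraNP => /h ->.
by rewrite eqxx.
Qed.

Lemma density_int : (\int[lebn R n]_x (p x)%:E = 1)%E.
Proof.
case: dp => _ _ _ <-; rewrite lintE//.
by apply/measurable_EFinP; exact: density_measurable.
Qed.

Lemma density_integrable : (lebn R n).-integrable setT (EFin \o p).
Proof.
apply/integrableP; split; first by apply/measurable_EFinP; exact: density_measurable.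
under eq_integral do rewrite gee0_abs ?lee_fin ?density_ge0//.
by rewrite density_int ltry.
Qed.

Lemma density_wint1 : wint (lebn R n) p (fun=> 1) = 1.
Proof.
apply: EFin_inj; rewrite -wintE; [|exact: density_ge0|exact: density_integrable|exact: bb_cst].
by rewrite -density_int; apply: eq_integral => x _; rewrite mulr1.
Qed.

End densities.

Section volume.
Variables (R : realType) (n : nat) (Y : set 'rV[R]_n).
Hypothesis cY : compact Y.

Lemma ind_measurable : measurable_fun setT (Defs.indic R Y : Rn R n -> R).
Proof. exact: (@measurable_ind R _ (Rn R n) Y (compact_rV_measurable cY)). Qed.

Lemma ind_integrable : (lebn R n).-integrable setT (EFin \o (Defs.indic R Y)).
Proof.
have mE : measurable_fun setT (EFin \o (Defs.indic R Y : Rn R n -> R)).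
  by apply/measurable_EFinP; exact: ind_measurable.
apply/integrableP; split => //.
under eq_integral do rewrite gee0_abs ?lee_fin ?ind_ge0//.
have [M MY] := compact_bnd cY.
apply: le_lt_trans (box_volume n M).
have mB : measurable (bnd M : set (Rn R n)).
  have -> : bnd M = \bigcap_(j in [set: 'I_n]) [set x : Rn R n | `|x 0 j| <= M].
    apply/seteqP; split => x h; first by move=> j _; exact: h.
    by move=> i j; rewrite (ord1 i); exact: h.
  apply: fin_bigcap_measurable => // j _.
  have mf : measurable_fun [set: Rn R n] ((fun x => `|x 0 j|) : Rn R n -> measurableTypeR R).
    apply: measurable_continuous => x.
    by apply: continuous_comp; [exact: coord_continuous|exact: norm_continuous].
  have := mf measurableT _ (measurable_itv `]-oo, M]); rewrite setTI.
  by congr measurable; apply/seteqP; split => x /=; rewrite in_itv.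
rewrite lintpE; [|by apply/measurable_EFinP; exact: measurable_ind|]; last first.
  by move=> x; rewrite lee_fin ind_ge0.
have mBE : measurable_fun setT (EFin \o (Defs.indic R (bnd M) : Rn R n -> R)).
  by apply/measurable_EFinP; exact: measurable_ind.
apply: ge0_le_integral => //; try by move=> x _; rewrite lee_fin ind_ge0.
move=> x _; rewrite lee_fin; have [Yx|Yx] := pselect (Y x).
  by rewrite !ind1//; exact: MY.
by rewrite ind0// ind_ge0.
Qed.

Lemma ind_wint1 : ((wint (lebn R n) (Defs.indic R Y) (fun=> 1))%:E = leb_vol Y)%E.
Proof.
rewrite -wintE; [|exact: ind_ge0|exact: ind_integrable|exact: bb_cst].
rewrite /leb_vol lintpE.
- by apply: eq_integral => x _; rewrite mulr1.
- by apply/measurable_EFinP; exact: ind_measurable.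
- by move=> x; rewrite lee_fin ind_ge0.
Qed.

End volume.

Section marginal.
Variables (R : realType) (a b : nat) (X : set 'rV[R]_a) (Y : set 'rV[R]_b).
Variables (p : 'rV[R]_a -> R) (c : 'rV[R]_a -> 'rV[R]_b -> R) (eps : R).
Hypotheses (cX : compact X) (cY : compact Y) (Vpos : (0 < leb_vol Y)%E).
Hypotheses (dp : is_density X p) (eps0 : 0 < eps).
Hypothesis cc : {within X `*` Y, continuous (fun z => c z.1 z.2)}.

Local Notation wY := (Defs.indic R Y).
Local Notation A := (Rn R a).
Local Notation B := (Rn R b).
Local Notation m := ((lebn R a) \x (lebn R b))%E.

Definition Efun (g : A -> R) := wint (lebn R a) p g.
Definition Jfun (g : B -> R) := wint (lebn R b) wY g.
(** Dividing costs and potentials by [eps] reduces to the kernels [expR (f y - c x y)] of the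
    abstract part. *)
Definition ncost (x : A) (y : B) : R := restr2 X Y c x y / eps.
Local Notation gw := (@gweight R _ _ A B ncost).
Local Notation gp := (@gpart R _ _ A B Jfun ncost).
Local Notation gd := (@gdens R _ _ A B Jfun ncost).

Definition npot (f : 'rV[R]_b -> R) (y : B) : R := wY y * f y / eps.

Let V := Jfun (fun=> 1).
Let ip := density_integrable dp.
Let p0 := density_ge0 dp.
Let iY := ind_integrable cY.
Let w0 y : 0 <= wY y. Proof. exact: ind_ge0. Qed.
Let mp := density_measurable dp.
Let mY := ind_measurable cY.

Lemma Jfun1_gt0 : 0 < V.
Proof. by rewrite -lte_fin /V /Jfun ind_wint1. Qed.

Lemma Efun_posfun : posfun Efun. Proof. exact: wint_posfun. Qed.
Lemma Jfun_posfun : posfun Jfun. Proof. exact: wint_posfun. Qed.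
Lemma EJ_fubini : fubini Efun Jfun. Proof. exact: wint_fubini. Qed.
Lemma Efun1 : Efun (fun=> 1) = 1. Proof. exact: (density_wint1 dp). Qed.

Lemma ncost_bb : bb2 ncost.
Proof. by apply: bbM; [exact: restr2_bb|exact: bb_cst]. Qed.

Lemma ncostE (x : A) (y : B) : X x -> Y y -> ncost x y = c x y / eps.
Proof. by move=> Xx Yy; rewrite /ncost restr2E. Qed.

Section potential.
Variable f : 'rV[R]_b -> R.
Hypothesis bf : bb (npot f).

Let pJ := Jfun_posfun.
Let fEJ := EJ_fubini.
Let bc := ncost_bb.

Lemma npotE y : Y y -> npot f y = f y / eps.
Proof. by move=> Yy; rewrite /npot ind1// mul1r. Qed.

Lemma Zpart_gpart (x : A) : X x -> Zpart Y c eps f x = gp (npot f) x.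
Proof.
move=> Xx; rewrite /Zpart /lint_on.
have -> : (fun v => if `[< Y v >] then (expR ((f v - c x v) / eps))%:E else 0%E) =
    fun v : B => (wY v * gw (npot f) x v)%:E.
  apply/funext => v; have [Yv|Yv] := pselect (Y v).
    by rewrite asboolT// ind1// mul1r /gweight npotE// ncostE// mulrBl.
  by rewrite asboolF// ind0// mul0r.
have bw := bb2_l x (bbp_bb (gweight_bbp bc bf)).
rewrite lintE; first by rewrite wintE.
apply/measurable_EFinP; apply: measurable_funM => //.
by case: bw.
Qed.

Lemma mu_gdens (x : A) (y : B) : X x -> Y y -> mu_dens Y c eps f x y = gd (npot f) x y.
Proof.
move=> Xx Yy; rewrite /mu_dens Zpart_gpart// ind1// mul1r /gdens /gweight.
by rewrite npotE// ncostE// mulrBl.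
Qed.

Let bZ := gpart_bbp pJ fEJ Jfun1_gt0 bc bf.

Lemma Ctrans_int :
  lint (fun x => (p x * Ctrans Y c eps f x)%:E) =
  (- eps * Efun (fun x => ln (gp (npot f) x)))%:E.
Proof.
have bl : bb (fun x => ln (gp (npot f) x)) by exact: bb_ln.
have -> : (fun x => (p x * Ctrans Y c eps f x)%:E) =
    fun x : A => (p x * (- eps * ln (gp (npot f) x)))%:E.
  apply/funext => x; congr EFin.
  have [->|/(density_neq0 dp) Xx] := eqVneq (p x) 0; first by rewrite !mul0r.
  by rewrite /Ctrans Zpart_gpart.
have ble : bb (fun x => - eps * ln (gp (npot f) x)).
  by apply: bbM => //; exact: bb_cst.
rewrite lintE; last first.
  by apply/measurable_EFinP; apply: measurable_funM => //; case: ble.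
by rewrite wintE// -pfZ//; exact: Efun_posfun.
Qed.

End potential.

Section coupling.
Variables (q : 'rV[R]_b -> R) (kap : 'rV[R]_a -> 'rV[R]_b -> R).
Hypotheses (dq : is_density Y q) (ck : is_coupling X Y p q kap).

Let F (z : A * B) : R := p z.1 * kap z.1 z.2.

Let k0 x y : 0 <= kap x y. Proof. by case: ck. Qed.
Let kY x y : ~ Y y -> kap x y = 0. Proof. by case: ck => _ _ h _ _; exact: h. Qed.

Let mk : measurable_fun setT (fun z : A * B => kap z.1 z.2).
Proof. by case: ck => h _ _ _ _; exact: (borel_fun2_measurable h). Qed.

Let mF : measurable_fun setT F.
Proof. by apply: measurable_funM => //; exact: measurableT_comp. Qed.

Let F0 z : 0 <= F z. Proof. exact: mulr_ge0. Qed.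

Let Fout z : ~ (X z.1 /\ Y z.2) -> F z = 0.
Proof.
move=> h; rewrite /F; have [->|/(density_neq0 dp) Xx] := eqVneq (p z.1) 0.
  by rewrite mul0r.
by rewrite kY ?mulr0// => Yy; apply: h.
Qed.

Let marg D : measurable D -> (\int[m]_z (F z * Defs.indic R D z.2)%:E)%E =
    (\int[lebn R b]_y (q y * Defs.indic R D y)%:E)%E.
Proof.
move=> mD; case: ck => _ _ _ _ /(_ D mD).
have mi : measurable_fun setT (Defs.indic R D : B -> R) by exact: measurable_ind.
rewrite lintE; last first.
  apply/measurable_EFinP; apply: measurable_funM => //.
  exact: density_measurable dq.
move=> <-; rewrite -(@lint2E R a b (fun z => (F z * Defs.indic R D z.2)%:E))//.
apply/measurable_EFinP; apply: measurable_funM => //.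
exact: measurableT_comp.
Qed.

Let iF : m.-integrable setT (EFin \o F).
Proof.
apply/integrableP; split; first exact/measurable_EFinP.
under eq_integral do rewrite gee0_abs ?lee_fin//.
have -> : (\int[m]_z (F z)%:E = \int[m]_z (F z * Defs.indic R setT z.2)%:E)%E.
  by apply: eq_integral => z _; rewrite ind1// mulr1.
rewrite marg//; have -> : (\int[lebn R b]_y (q y * Defs.indic R setT y)%:E = 1)%E.
  by rewrite -(density_int dq); apply: eq_integral => y _; rewrite ind1// mulr1.
by rewrite ltry.
Qed.

Let row (x : A) : (\int[lebn R b]_y (F (x, y))%:E)%E = (p x)%:E.
Proof.
have mkx : measurable_fun setT (fun y : B => kap x y) := measurable_fun_pair2 x mk.
under eq_integral do rewrite /F /= EFinM.
rewrite ge0_integralZl//; [|exact/measurable_EFinP|by move=> y _; rewrite lee_fin|by rewrite lee_fin].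
have [->|/(density_neq0 dp) Xx] := eqVneq (p x) 0; first by rewrite mul0e.
case: ck => _ _ _ /(_ x Xx) + _; rewrite lintE; last exact/measurable_EFinP.
by move=> ->; rewrite mule1.
Qed.

Definition plan_int (g : A * B -> R) := wint m F g.

Let pN : posfun plan_int. Proof. exact: wint_posfun. Qed.

Lemma plan_int_fst g : bb g -> plan_int (fun z => g z.1) = Efun g.
Proof. by move=> bg; apply: wint_fst. Qed.

Lemma plan_int_snd g : bb g -> plan_int (fun z => g z.2) = wint (lebn R b) q g.
Proof.
move=> bg; apply: wint_snd => //; [exact: density_ge0 dq|exact: density_integrable dq].
Qed.

(* [t ln t + 1 >= t] makes the entropy integrand nonnegative after adding the
   indicator of [Y]. *)
Definition ent_int (z : A * B) : R := F z * ln (kap z.1 z.2) + p z.1 * wY z.2.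

Let kent (x : A) (y : B) : 0 <= kap x y * ln (kap x y) + wY y.
Proof.
have [->|kn] := eqVneq (kap x y) 0; first by rewrite mul0r add0r.
have kp : 0 < kap x y by rewrite lt_neqAle eq_sym kn k0.
have Yy : Y y by apply: contrapT => /(kY x) E; rewrite E eqxx in kn.
have := le_ln1M ltr01 kp; rewrite ln1 div1r ind1// => h.
have : 0 <= kap x y * (ln (kap x y) + (kap x y)^-1 - 1) by rewrite mulr_ge0.
by rewrite mulrBr mulrDr divff// mulr1; have := ltW kp; lra.
Qed.

Let mlnk : measurable_fun setT (fun z : A * B => ln (kap z.1 z.2)).
Proof. exact: measurableT_comp. Qed.

Let mH : measurable_fun setT ent_int.
Proof.
apply: measurable_funD; first exact: measurable_funM.
by apply: measurable_funM; exact: measurableT_comp.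
Qed.

Let ent_intE z : ent_int z = p z.1 * (kap z.1 z.2 * ln (kap z.1 z.2) + wY z.2).
Proof. by rewrite /ent_int /F mulrDr mulrA. Qed.

Let H0 z : 0 <= ent_int z.
Proof. by rewrite ent_intE mulr_ge0. Qed.

Let iVY : (\int[lebn R b]_y (wY y)%:E = V%:E)%E.
Proof.
rewrite /V /Jfun -wintE//; last exact: bb_cst.
by apply: eq_integral => y _; rewrite mulr1.
Qed.

Let entropy_row (x : A) : ((p x)%:E * entropy (kap x) =
  (p x * V)%:E - \int[lebn R b]_y (ent_int (x, y))%:E)%E.
Proof.
have mkx : measurable_fun setT (fun y : B => kap x y) := measurable_fun_pair2 x mk.
have mg : measurable_fun setT (fun y : B => (kap x y * ln (kap x y) + wY y)%:E).
  apply/measurable_EFinP; apply: measurable_funD => //.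
  by apply: measurable_funM => //; exact: measurableT_comp.
have g0 y : (0 <= (kap x y * ln (kap x y) + wY y)%:E)%E by rewrite lee_fin.
under eq_integral do rewrite ent_intE /= EFinM.
rewrite ge0_integralZl// ?lee_fin//.
(* The entropy may be infinite; where [p x = 0] the convention that 0 times infinity is 0 settles
   the case. *)
have [px|px] := eqVneq (p x) 0; first by rewrite px !mul0r !mul0e sube0.
rewrite /entropy lintE; last first.
  by apply/measurable_EFinP; apply: measurable_funM => //; exact: measurableT_comp.
have -> : (\int[lebn R b]_y (kap x y * ln (kap x y))%:E =
    \int[lebn R b]_y ((kap x y * ln (kap x y) + wY y)%:E - (wY y)%:E))%E.
  by apply: eq_integral => y _; rewrite -EFinB addrK.
have [-> _] := integral_ge0B mg g0 w0 iY.
rewrite iVY.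
have : (0 <= \int[lebn R b]_y (kap x y * ln (kap x y) + wY y)%:E)%E by exact: integral_ge0.
have pp : 0 < p x by rewrite lt_neqAle eq_sym px p0.
case: (\int[lebn R b]_y _)%E => [r| |//] _.
  by rewrite -EFinB -!EFinN -!EFinM -EFinB; congr EFin; ring.
by rewrite /= !gt0_muley ?lte_fin//= gt0_muleNy ?lte_fin.
Qed.

Let int_pwY : (\int[m]_z (p z.1 * wY z.2)%:E)%E = V%:E.
Proof.
have := @wint_prod R _ _ A B (lebn R a) (lebn R b) p wY p0 ip w0 iY (fun _ _ => 1)
  (bb_cst _ 1).
rewrite -/(Jfun _) -/V -/(Efun _) (pf_cst Efun_posfun) Efun1 mulr1 => <-.
by apply: eq_integral => z _; rewrite mulr1.
Qed.

(** All possible infinity is isolated in one nonnegative integral: the transport part is finite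
    because the cost is bounded and the plan has mass one. *)
Lemma eot_costE : eot_cost p c eps kap =
  ((plan_int (fun z => restr2 X Y c z.1 z.2))%:E +
   eps%:E * (\int[m]_z (ent_int z)%:E - V%:E))%E.
Proof.
rewrite /eot_cost.
have bc := restr2_bb cX cY cc.
have -> : lint2 (fun x y => (c x y * (p x * kap x y))%:E) =
    (plan_int (fun z => restr2 X Y c z.1 z.2))%:E.
  rewrite -wintE//.
  rewrite -(@lint2E R a b (fun z => (F z * restr2 X Y c z.1 z.2)%:E)); last first.
    by apply/measurable_EFinP; apply: measurable_funM => //; case: bc.
  congr lint2; apply/funext => x; apply/funext => y; congr EFin; rewrite -/(F (x, y)).
  have [[Xx Yy]|h] := pselect (X x /\ Y y); first by rewrite restr2E// mulrC.
  by rewrite (@Fout (x, y))// mul0r mulr0.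
have mG := @measurable_fun_fubini_tonelli_F _ _ A B R (lebn R b) (fun z => (ent_int z)%:E)
   (proj2 (measurable_EFinP _ _) mH) (fun z => H0 z).
have -> : (fun x => (p x)%:E * entropy (kap x))%E =
    fun x : A => ((p x * V)%:E - fubini_F (lebn R b) (fun z => (ent_int z)%:E) x)%E.
  by apply/funext => x; rewrite entropy_row.
have ipV : (lebn R a).-integrable setT (EFin \o (fun x => p x * V)).
  exact: (integrableZr measurableT V ip).
rewrite lintE; last first.
  by apply: emeasurable_funB => //; apply/measurable_EFinP; apply: measurable_funM.
have G0 x : (0 <= fubini_F (lebn R b) (fun z => (ent_int z)%:E) x)%E.
  by apply: integral_ge0 => y _; rewrite lee_fin.
have pV0 x : 0 <= p x * V by rewrite mulr_ge0// ltW// Jfun1_gt0.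
have [_ ->] := integral_ge0B mG G0 pV0 ipV.
have -> : (\int[lebn R a]_x (p x * V)%:E = V%:E)%E.
  by under eq_integral do rewrite EFinM; rewrite integralZr// (density_int dp) mul1e.
rewrite -fubini_tonelli1//; last exact/measurable_EFinP.
have : (0 <= \int[m]_z (ent_int z)%:E)%E by apply: integral_ge0 => z _; rewrite lee_fin.
case: (\int[m]_z _)%E => [r| |//] _.
  set N := plan_int _.
  have E : N - eps * (V - r) = N + eps * (r - V) by ring.
  exact: (congr1 EFin E).
by rewrite /= gt0_muleNy ?lte_fin// gt0_muley ?lte_fin.
Qed.

Lemma eot_cost_Ny : eot_cost p c eps kap != -oo%E.
Proof.
rewrite eot_costE.
have : (0 <= \int[m]_z (ent_int z)%:E)%E by apply: integral_ge0 => z _; rewrite lee_fin.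
case: (\int[m]_z _)%E => [r| |//] _ //.
by rewrite /= gt0_muley ?lte_fin.
Qed.

(** A finite cost makes [ent_int] integrable. The logarithm of the Gibbs density is bounded, so the
    divergence splits into finite integrals, and the terms in [f] and in the partition function
    reduce to the two marginals. *)
Lemma eot_cost_fin : (eot_cost p c eps kap < +oo)%E -> exists v : R,
  eot_cost p c eps kap = v%:E /\
  forall f, bb (npot f) ->
    KL2 (fun x y => p x * kap x y) (fun x y => p x * mu_dens Y c eps f x y) =
    (v / eps - wint (lebn R b) q (npot f)
       + Efun (fun x => ln (gp (npot f) x)))%:E.
Proof.
rewrite eot_costE => Hoo.
have Hfin : (\int[m]_z (ent_int z)%:E < +oo)%E.
  rewrite ltey; apply/eqP => E; move: Hoo.
  by rewrite E /= gt0_muley ?lte_fin// addey.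
have iH : m.-integrable setT (EFin \o ent_int).
  apply/integrableP; split; first exact/measurable_EFinP.
  by under eq_integral do rewrite gee0_abs ?lee_fin//.
have [S SE] : exists S : R, (\int[m]_z (ent_int z)%:E)%E = S%:E.
  exists (fine (\int[m]_z (ent_int z)%:E)); rewrite fineK//.
  exact: integrable_fin_num iH.
rewrite SE; eexists; split; first by rewrite -EFinB -EFinM -EFinD.
move=> f bf.
have bZ := gpart_bbp Jfun_posfun EJ_fubini Jfun1_gt0 ncost_bb bf.
have bl : bb (fun x => ln (gp (npot f) x)) by exact: bb_ln.
pose be (z : A * B) := npot f z.2 - ncost z.1 z.2 - ln (gp (npot f) z.1).
have b1 : bb (fun z : A * B => npot f z.2) by exact: (bb2_snd A bf).
have b2 : bb (fun z : A * B => ln (gp (npot f) z.1)) by exact: (bb2_fst B bl).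
have bbe : bb be by apply: bbB => //; apply: bbB => //; exact: ncost_bb.
have ipw : m.-integrable setT (EFin \o (fun z : A * B => p z.1 * wY z.2)).
  by apply: weight_prod_integrable.
have iFb := wint_integrable F0 iF bbe.
have -> : KL2 (fun x y => p x * kap x y) (fun x y => p x * mu_dens Y c eps f x y) =
   lint2 (fun x y => (ent_int (x, y) - (p x * wY y + F (x, y) * be (x, y)))%:E).
  rewrite /KL2; congr lint2; apply/funext => x; apply/funext => y.
  (* Where [F] vanishes, both integrands are zero. Elsewhere [x] lies in [X] and [y] in [Y], and the
     Gibbs density is positive, so the infinite branch of [KL2] is not taken. *)
  rewrite -/(F (x, y)); case: eqP => [E|/eqP E].
    by rewrite /ent_int E !mul0r add0r addr0 subrr.
  have [Xx Yy] : X x /\ Y y by apply: contrapT => /(@Fout (x, y)) E'; rewrite E' eqxx in E.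
  have pn : p x != 0 by apply: contraNneq E; rewrite /F /= => ->; rewrite mul0r.
  have kn : kap x y != 0 by apply: contraNneq E; rewrite /F /= => ->; rewrite mulr0.
  have g0 := gdens_gt0 Jfun_posfun EJ_fubini Jfun1_gt0 ncost_bb bf x y.
  rewrite mu_gdens//.
  rewrite mulf_eq0 (negbTE pn) (gt_eqF g0) /=; congr EFin.
  have -> : F (x, y) / (p x * gd (npot f) x y) = kap x y / gd (npot f) x y.
    by rewrite /F /=; field; rewrite pn gt_eqF.
  have kp : 0 < kap x y by rewrite lt_neqAle eq_sym kn k0.
  have Z0 : 0 < gp (npot f) x by exact: (bbp_gt0 _ bZ).
  rewrite ln_div ?posrE// /gdens ln_div ?posrE ?expR_gt0//.
  by rewrite /gweight expRK /ent_int /be /=; ring.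
rewrite (@lint2E R a b (fun z => (ent_int z - (p z.1 * wY z.2 + F z * be z))%:E)); last first.
  apply/measurable_EFinP; apply: measurable_funB => //; apply: measurable_funD.
    by apply: measurable_funM; exact: measurableT_comp.
  by apply: measurable_funM => //; case: bbe.
under eq_integral do rewrite EFinB.
rewrite integralB//; last first.
  exact: (integrableD measurableT ipw iFb).
rewrite SE; under eq_integral do rewrite EFinD.
rewrite integralD// int_pwY wintE// -/(plan_int be).
transitivity (S - (V + plan_int be))%:E => //; congr EFin.
have -> : plan_int be = wint (lebn R b) q (npot f) -
    plan_int (fun z => restr2 X Y c z.1 z.2) / eps -
    Efun (fun x => ln (gp (npot f) x)).
  rewrite -plan_int_fst// -plan_int_snd// -pfZr//; last exact: restr2_bb.
  have b3 : bb (fun z : A * B => restr2 X Y c z.1 z.2 / eps) := ncost_bb.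
  by rewrite -!pfB//; exact: bbB.
by field; rewrite gt_eqF.
Qed.

End coupling.
End marginal.

(** * Competitors from abstract plans *)

Section competitor.
Variables (R : realType) (a b : nat) (X : set 'rV[R]_a) (Y : set 'rV[R]_b).
Variables (p : 'rV[R]_a -> R) (c : 'rV[R]_a -> 'rV[R]_b -> R) (eps : R).
Hypotheses (cX : compact X) (cY : compact Y) (Vpos : (0 < leb_vol Y)%E).
Hypotheses (dp : is_density X p) (eps0 : 0 < eps).
Hypothesis cc : {within X `*` Y, continuous (fun z => c z.1 z.2)}.

Local Notation wY := (Defs.indic R Y).
Local Notation A := (Rn R a).
Local Notation B := (Rn R b).
Local Notation m := ((lebn R a) \x (lebn R b))%E.

Variable k : A -> B -> R.
Hypotheses (bk : bbp2 k) (kJ : forall x, Jfun Y (k x) = 1).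

(** [k] is a density relative to Lebesgue measure restricted to [Y]; the indicator turns it into a
    Lebesgue density on the whole space. *)
Definition cut_plan (x : 'rV[R]_a) (y : 'rV[R]_b) : R := wY y * k x y.
Definition cut_marg (y : 'rV[R]_b) : R := wY y * Efun p (fun x => k x y).

Let pE := Efun_posfun dp.
Let pJ := Jfun_posfun cY.
Let fEJ := EJ_fubini cY dp.
Let bk' : bb2 k := bbp_bb bk.
Let w0 (y : B) : 0 <= wY y. Proof. exact: ind_ge0. Qed.
Let p0 (x : A) : 0 <= p x. Proof. exact: density_ge0 dp x. Qed.
Let ip := density_integrable dp.
Let iY := ind_integrable cY.
Let mY := ind_measurable cY.
Let wp := @wint_prod R _ _ A B (lebn R a) (lebn R b) p wY p0 ip w0 iY.
Let kp (x : A) (y : B) : 0 < k x y := bbp_gt0 (x, y) bk.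
Let bm : bb (fun y => Efun p (fun x => k x y)) := fub_bbr pE fEJ bk'.

Lemma lint_ind (h : B -> R) : bb h -> lint (fun y => (wY y * h y)%:E) = (Jfun Y h)%:E.
Proof.
move=> bh; rewrite lintE ?wintE//.
case: (bh) => mh _; apply/measurable_EFinP; exact: (measurable_funM mY mh).
Qed.

Lemma cut_density : is_density Y cut_marg.
Proof.
split.
- apply/borel_fun_measurable; apply: measurable_funM => //.
  by case: bm.
- move=> y; rewrite mulr_ge0//; apply: (pf_ge0 pE); first exact: (bb2_r (y : B) bk').
  by move=> x; rewrite ltW// kp.
- by move=> y Yy; rewrite /cut_marg ind0// mul0r.
- rewrite lint_ind// -(fub_swap fEJ bk').
  by under eq_fun do rewrite kJ; rewrite (Efun1 dp).
Qed.

Lemma cut_coupling : is_coupling X Y p cut_marg cut_plan.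
Proof.
split.
- apply: measurable_borel_fun2; apply: (@measurable_funM _ (A * B)%type R setT (fun z => wY z.2)
    (fun z => k z.1 z.2)); last by case: bk'.
  exact: (measurableT_comp mY measurable_snd).
- by move=> x y; rewrite mulr_ge0// ltW// kp.
- by move=> x y Yy; rewrite /cut_plan ind0// mul0r.
- by move=> x _; rewrite lint_ind ?kJ//; exact: (bb2_l (x : A) bk').
move=> D bD; have mi : measurable_fun setT (Defs.indic R D : B -> R).
  exact: (@measurable_ind R _ B D bD).
have bi : bb (Defs.indic R D : B -> R).
  by split => //; exists 1 => y; rewrite ger0_norm ?ind_ge0// ind_le1.
have bki : bb2 (fun (x : A) (y : B) => k x y * Defs.indic R D y).
  by apply: bbM => //; exact: (bb2_snd A bi).
have -> : (fun y => (cut_marg y * Defs.indic R D y)%:E) =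
    fun y : B => (wY y * (Efun p (fun x => k x y) * Defs.indic R D y))%:E.
  by apply/funext => y; rewrite /cut_marg mulrA.
rewrite lint_ind; last exact: bbM.
have -> : (fun x y => (p x * cut_plan x y * Defs.indic R D y)%:E) =
   fun (x : A) (y : B) => (p x * wY y * (k x y * Defs.indic R D y))%:E.
  by apply/funext => x; apply/funext => y; rewrite /cut_plan; congr EFin; ring.
rewrite (@lint2E R a b (fun z => (p z.1 * wY z.2 * (k z.1 z.2 * Defs.indic R D z.2))%:E)).
  rewrite (wp bki).
  congr EFin; rewrite -/(Efun p _) -/(Jfun Y _) (fub_swap fEJ bki).
  congr (Jfun Y); apply/funext => y.
  by rewrite pfZr//; exact: (bb2_r y bk').
apply/measurable_EFinP; apply: measurable_funM; last by case: bki.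
apply: measurable_funM; last exact: (measurableT_comp mY measurable_snd).
exact: (measurableT_comp (density_measurable dp) measurable_fst).
Qed.

Lemma cut_cost : eot_cost p c eps cut_plan = (eps * Efun p (fun x =>
  Jfun Y (fun y => ncost X Y c eps x y * k x y + k x y * ln (k x y))))%:E.
Proof.
rewrite (eot_costE cX cY Vpos dp eps0 cc cut_density cut_coupling).
have bl : bb2 (fun x y => k x y * ln (k x y)) by apply: bbM => //; exact: bb_ln bk.
have br : bb2 (restr2 X Y c : A -> B -> R) := restr2_bb cX cY cc.
have brk : bb2 (fun (x : A) (y : B) => restr2 X Y c x y * k x y) by exact: bbM.
have bl1 : bb2 (fun (x : A) (y : B) => k x y * ln (k x y) + 1).
  by apply: bbD => //; exact: bb_cst.
have -> : plan_int p cut_plan (fun z => restr2 X Y c z.1 z.2) =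
    Efun p (fun x => Jfun Y (fun y => restr2 X Y c x y * k x y)).
  transitivity (fine (\int[m]_z (p z.1 * wY z.2 * (restr2 X Y c z.1 z.2 * k z.1 z.2))%:E)%E).
    by congr fine; apply: eq_integral => z _; congr EFin; rewrite /cut_plan; ring.
  by rewrite (wp brk).
have -> : (\int[m]_z (ent_int Y p cut_plan z)%:E)%E =
    (Efun p (fun x => Jfun Y (fun y => k x y * ln (k x y) + 1)))%:E.
  rewrite -(wp bl1); apply: eq_integral => z _; congr EFin.
  rewrite /ent_int /cut_plan; have [Yz|Yz] := pselect (Y z.2).
    by rewrite ind1// !mul1r mulr1; ring.
  by rewrite ind0// !mul0r !mulr0 !mul0r addr0.
set V := Jfun Y (fun=> 1).
have JE x : Jfun Y (fun y => k x y * ln (k x y) + 1) = Jfun Y (fun y => k x y * ln (k x y)) + V.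
  by rewrite pfD//; [exact: (bb2_l x bl)|exact: bb_cst].
have -> : Efun p (fun x => Jfun Y (fun y => k x y * ln (k x y) + 1)) =
    Efun p (fun x => Jfun Y (fun y => k x y * ln (k x y))) + V.
  under eq_fun do rewrite JE.
  rewrite pfD//; [|exact: (fub_bbl pJ fEJ bl)|exact: bb_cst].
  by rewrite (pf_cst pE) (Efun1 dp) mulr1.
have -> : Efun p (fun x => Jfun Y (fun y => ncost X Y c eps x y * k x y + k x y * ln (k x y)))
  = eps^-1 * Efun p (fun x => Jfun Y (fun y => restr2 X Y c x y * k x y)) +
    Efun p (fun x => Jfun Y (fun y => k x y * ln (k x y))).
  rewrite -pfZ//; last exact: (fub_bbl pJ fEJ brk).
  rewrite -pfD//; [|by apply: bbM; [exact: bb_cst|exact: (fub_bbl pJ fEJ brk)]|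
    exact: (fub_bbl pJ fEJ bl)].
  congr (Efun p); apply/funext => x.
  rewrite -pfZ//; last exact: (bb2_l x brk).
  rewrite -pfD//; [|by apply: bbM; [exact: bb_cst|exact: (bb2_l x brk)]|exact: (bb2_l x bl)].
  by congr (Jfun Y); apply/funext => y; rewrite /ncost; ring.
set e1 := Efun p _; set e2 := Efun p _.
have E : e1 + eps * (e2 + V - V) = eps * (eps^-1 * e1 + e2) by field; rewrite gt_eqF.
exact: (congr1 EFin E).
Qed.

End competitor.

Lemma mlp_continuous (R : realType) (sigma : R -> R) n (g : mlp R n) :
  continuous sigma -> continuous (mlp_eval sigma g).
Proof.
move=> cs x; have F := nbhs_filter x; apply/cvgrPdist_le => /= e e0.
have [d d0 dP] := mlp_unif_cont cs g (mxsum1 x + 1) e0.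
have m0 : 0 < Num.min d 1 by rewrite lt_min d0/=.
apply: (@filterS _ _ (nbhs_filter x) (ball x (Num.min d 1)) _ _ (nbhsx_ballx x _ m0)) => y xy.
have h i j : `|x i j - y i j| < Num.min d 1 by case: xy => _ xy; exact: xy.
apply: dP; first by apply: bnd_ge (@bnd_mxsum1 R _ _ x); rewrite lerDl.
  move=> i j; have -> : y i j = x i j - (x i j - y i j) by rewrite subKr.
  rewrite (le_trans (ler_normB _ _))// lerD//; first exact: bnd_mxsum1.
  by rewrite (le_trans (ltW (h i j)))// ge_min lexx orbT.
by move=> i j; rewrite !mxE (le_trans (ltW (h i j)))// ge_min lexx.
Qed.

Section approximation.
Variables (R : realType) (a b : nat) (X : set 'rV[R]_a) (Y : set 'rV[R]_b).
Variables (p : 'rV[R]_a -> R) (c : 'rV[R]_a -> 'rV[R]_b -> R) (eps : R).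
Hypotheses (cX : compact X) (cY : compact Y) (Vpos : (0 < leb_vol Y)%E).
Hypotheses (dp : is_density X p) (eps0 : 0 < eps).
Hypothesis cc : {within X `*` Y, continuous (fun z => c z.1 z.2)}.

Lemma Jfun_le (h1 h2 : Rn R b -> R) : bb h1 -> bb h2 ->
  (forall y, Y y -> h1 y <= h2 y) -> Jfun Y h1 <= Jfun Y h2.
Proof.
move=> b1 b2 h.
have bi : bb (Defs.indic R Y : Rn R b -> R).
  split; first exact: ind_measurable.
  by exists 1 => y; rewrite ger0_norm ?ind_ge0// ind_le1.
have JE g : Jfun Y g = Jfun Y (fun y => Defs.indic R Y y * g y).
  congr fine; apply: eq_integral => y _; congr EFin.
  have [Yy|Yy] := pselect (Y y); first by rewrite ind1// !mul1r.
  by rewrite ind0// !mul0r.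
rewrite (JE h1) (JE h2); apply: (pf_le (Jfun_posfun cY)); try exact: bbM.
move=> y; have [Yy|Yy] := pselect (Y y); first by rewrite ind1// !mul1r h.
by rewrite ind0// !mul0r.
Qed.

(** The logarithm of the partition function is monotone in the potential and shifts with constants.
    The comparison is asked on [Y] only, where networks approximate. *)
Lemma Efun_ln_gpart_le (u f : Rn R b -> R) (e : R) : bb u -> bb f ->
  (forall y, Y y -> u y <= f y + e) ->
  Efun p (fun x => ln (gpart (Jfun Y) (ncost X Y c eps) u x)) <=
  Efun p (fun x => ln (gpart (Jfun Y) (ncost X Y c eps) f x)) + e.
Proof.
move=> bu bf uf.
have pJ := Jfun_posfun cY; have pE := Efun_posfun dp.
have bc := ncost_bb eps cX cY cc.
have Z g : bb g -> bbp (gpart (Jfun Y) (ncost X Y c eps) g).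
  by move=> bg; exact: (gpart_bbp pJ (EJ_fubini cY dp) (Jfun1_gt0 cY Vpos) bc bg).
have bZu := Z u bu; have bZf := Z f bf.
have -> : e = Efun p (fun=> e) by rewrite (pf_cst pE) (Efun1 dp) mulr1.
rewrite -pfD//; [|exact: bb_ln|exact: bb_cst].
apply: (pf_le pE); [exact: bb_ln|by apply: bbD; [exact: bb_ln|exact: bb_cst]|].
move=> x; have Zf0 := bbp_gt0 x bZf; have Zu0 := bbp_gt0 x bZu.
rewrite -[X in _ + X]expRK -lnM ?posrE ?expR_gt0// ler_ln ?posrE ?mulr_gt0 ?expR_gt0//.
have bw g : bb g -> bb (gweight (ncost X Y c eps) g x).
  by move=> bg; exact: (bb2_l x (bbp_bb (gweight_bbp bc bg))).
rewrite [X in _ <= X]mulrC /gpart -pfZ//; last exact: bw.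
apply: Jfun_le; [exact: bw|by apply: bbM; [exact: bb_cst|exact: bw]|].
move=> y Yy; rewrite /gweight -expRD ler_expR; have := uf y Yy; lra.
Qed.

End approximation.

(** * The barycenter problem and its network potentials *)

Section barycenter.
Variables (R : realType) (K : nat) (Dk : 'I_K -> nat) (D : nat).
Variables (X : forall k : 'I_K, set 'rV[R]_(Dk k)) (Y : set 'rV[R]_D).
Variables (P : forall k : 'I_K, 'rV[R]_(Dk k) -> R).
Variables (c : forall k : 'I_K, 'rV[R]_(Dk k) -> 'rV[R]_D -> R).
Variables (lam : 'I_K -> R) (eps : R).
Arguments X : clear implicits.
Arguments P : clear implicits.
Arguments c : clear implicits.
Hypotheses (cX : forall k, compact (X k)) (cY : compact Y) (Vpos : (0 < leb_vol Y)%E).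
Hypothesis dP : forall k, is_density (X k) (P k).
Hypothesis cc : forall k, {within X k `*` Y, continuous (fun z => c k z.1 z.2)}.
Hypotheses (lam0 : forall k, 0 < lam k) (lam1 : \sum_k lam k = 1) (eps0 : 0 < eps).

Local Notation A := (fun k : 'I_K => Rn R (Dk k)).
Local Notation B := (Rn R D).
Local Notation nc := (fun k : 'I_K => ncost (X k) Y (c k) eps).

(** The common marginal [m], cut to [Y], competes for the barycenter, and each cut plan competes in
    its transport problem. *)
Lemma Lstar_le (k : forall k, A k -> B -> R) (m : B -> R) :
  (forall i, bbp2 (k i)) -> (forall i x, Jfun Y (k i x) = 1) ->
  (forall i y, Efun (P i) (fun x => k i x y) = m y) ->
  (Lstar X Y P c lam eps <= (eps * \sum_i lam i * Efun (P i) (fun x =>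
     Jfun Y (fun y => nc i x y * k i x y + k i x y * ln (k i x y))))%:E)%E.
Proof.
move=> bk kJ km.
(* An index is needed to see the common marginal as the marginal of some plan, hence as a density;
   [lam1] excludes [K = 0]. *)
have [i0 _] : exists i0 : 'I_K, True.
  apply: contrapT => h; have := lam1; rewrite big1 => [/eqP|i _].
    by rewrite eq_sym oner_eq0.
  by exfalso; apply: h; exists i.
have qE i : (fun y => Defs.indic R Y y * m y) = cut_marg Y (P i) (k i).
  by apply/funext => y; rewrite /cut_marg km.
apply: (@le_trans _ _ (bary_obj X Y P c lam eps (fun y => Defs.indic R Y y * m y))).
  apply: ereal_inf_lbound; exists (fun y => Defs.indic R Y y * m y) => //.
  rewrite (qE i0); exact: (cut_density cY (dP i0) (bk i0) (kJ i0)).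
rewrite mulr_sumr -sumEFin; apply: lee_sum => i _.
rewrite mulrCA EFinM lee_pmul2l// ?lte_fin//.
rewrite -(cut_cost (@cX i) cY Vpos (dP i) eps0 (@cc i) (bk i) (kJ i)).
apply: ereal_inf_lbound; exists (cut_plan Y (k i)) => //.
rewrite (qE i); exact: (cut_coupling cY (dP i) (bk i) (kJ i)).
Qed.

Lemma mlp_near_dual (sigma : R -> R) (xt : R) (f : 'I_K -> B -> R) (e : R) :
  continuous sigma -> ~ affine_fun sigma -> derivable sigma xt 1 ->
  derive1 sigma xt != 0 -> dual_feasible nc lam f -> 0 < e ->
  exists g : 'I_K -> mlp R D, forall k, (mlp_width (g k) <= D + 4)%N /\
    forall y, Y y -> `|mlp_eval sigma (g k) y - eps * f k y| <= e.
Proof.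
move=> cs na ds ds0 [bf _ fmod] e0.
suff /choice[g gP] : forall k, exists g : mlp R D, (mlp_width g <= D + 4)%N /\
    forall y, Y y -> `|mlp_eval sigma g y - eps * f k y| <= e by exists g.
move=> k.
have [M MY] := compact_bnd cY.
have [_ [C fC]] := bf k.
apply: (@mlp_universal R sigma xt D Y (fun y => eps * f k y) M (eps * C)) => //.
  by move=> y _; rewrite normrM gtr0_norm// ler_pM2l// fC.
move=> r r0; have r20 : 0 < r / 2 by rewrite divr_gt0.
have /choice[d dd] : forall i, exists d : R, 0 < d /\ forall x y y', Y y -> Y y' ->
    bnd d (y - y') -> `|restr2 (X i) Y (c i) x y - restr2 (X i) Y (c i) x y'| <= r / 2.
  by move=> i; have [d d0 h] := restr2_modulus (@cX i) cY (@cc i) r20; exists d.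
(* The inverse of this sum is below every [d i], and so replaces their minimum. *)
have S0 : 0 < \sum_i (d i)^-1 + 1.
  by rewrite ltr_wpDl// sumr_ge0// => i _; rewrite invr_ge0 ltW//; case: (dd i).
exists (\sum_i (d i)^-1 + 1)^-1; first by rewrite invr_gt0.
move=> y y' Yy Yy' yy'; rewrite -mulrBr normrM gtr0_norm// mulrC -ler_pdivlMr//.
have -> : r / eps = 2 * (r / 2 / eps) by field; rewrite gt_eqF.
apply: fmod => i x; have [d0 h] := dd i.
rewrite /ncost -mulrBl normrM [X in _ * X]gtr0_norm ?invr_gt0//.
rewrite ler_pM2r ?invr_gt0//; apply: h => //.
apply: bnd_ge yy'; rewrite -[X in _ <= X]invrK lef_pV2 ?posrE ?invr_gt0//.
rewrite (bigD1 i)//= -addrA lerDl addr_ge0// sumr_ge0// => j _.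
by rewrite invr_ge0 ltW//; case: (dd j).
Qed.

Lemma congruent_npot_bb (sigma : R -> R) (g : 'I_K -> mlp R D) k : continuous sigma ->
  bb (npot Y eps (fun y => mlp_eval sigma (g k) y - \sum_j lam j * mlp_eval sigma (g j) y)).
Proof.
move=> cs; have bg j : bb (fun y : B => Defs.indic R Y y * mlp_eval sigma (g j) y).
  have cg := @mlp_continuous R sigma D (g j) cs.
  split; first by apply: measurable_funM; [exact: ind_measurable|exact: measurable_continuous].
  have cf : {within Y, continuous (mlp_eval sigma (g j))} by exact: continuous_subspaceT.
  have [/= S [Sr SP]] := compact_bounded (continuous_compact cf cY).
  exists (`|S| + 1) => y; have [Yy|Yy] := pselect (Y y); last first.
    by rewrite ind0// mul0r normr0 addr_ge0.
  rewrite ind1// mul1r; apply: SP; last by exists y.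
  by rewrite (le_lt_trans (ler_norm _))// ltrDl.
have -> : npot Y eps (fun y => mlp_eval sigma (g k) y - \sum_j lam j * mlp_eval sigma (g j) y)
   = fun y : B => (Defs.indic R Y y * mlp_eval sigma (g k) y -
       \sum_j lam j * (Defs.indic R Y y * mlp_eval sigma (g j) y)) * eps^-1.
  apply/funext => y; rewrite /npot mulrBr mulr_sumr; congr ((_ - _) / _).
  by apply: eq_bigr => j _; rewrite mulrCA.
apply: bbM; last exact: bb_cst.
apply: bbB => //; apply: bb_sum => j; apply: bbM => //; exact: bb_cst.
Qed.

Lemma congruent_sum0 (g : 'I_K -> R) : \sum_k lam k * (g k - \sum_j lam j * g j) = 0.
Proof.
under eq_bigr do rewrite mulrBr.
by rewrite sumrB -mulr_suml lam1 mul1r subrr.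
Qed.

(** The targets have weighted mean zero, so centring the approximants costs only the weighted mean
    of the errors, a second [e]. *)
Lemma congruent_near (g h : 'I_K -> R) e : \sum_k lam k * h k = 0 ->
  (forall k, `|g k - h k| <= e) ->
  forall k, `|g k - \sum_j lam j * g j - h k| <= 2 * e.
Proof.
move=> h0 gh k.
have -> : g k - \sum_j lam j * g j - h k = (g k - h k) - \sum_j lam j * (g j - h j).
  under [X in _ = _ - X]eq_bigr do rewrite mulrBr.
  by rewrite sumrB h0; ring.
rewrite (le_trans (ler_normB _ _))// mulr2n mulrDl mul1r lerD//.
rewrite (le_trans (ler_norm_sum _ _ _))// -[e]mul1r -lam1 mulr_suml ler_sum// => j _.
by rewrite normrM gtr0_norm// ler_wpM2l// ltW.
Qed.

Lemma Ldual_npot (f : 'I_K -> 'rV[R]_D -> R) : (forall k, bb (npot Y eps (f k))) ->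
  Ldual Y P c lam eps f = (eps * dual_val (Jfun Y) (fun k => Efun (P k)) nc lam
    (fun k => npot Y eps (f k)))%:E.
Proof.
move=> bf; rewrite /Ldual /dual_val mulr_sumr -sumEFin; apply: eq_bigr => k _.
rewrite (Ctrans_int (@cX k) cY Vpos (dP k) (@cc k) (bf k)) -EFinM; congr EFin.
have bZ := gpart_bbp (Jfun_posfun cY) (EJ_fubini cY (dP k)) (Jfun1_gt0 cY Vpos)
  (ncost_bb eps (@cX k) cY (@cc k)) (bf k).
rewrite (pfN (Efun_posfun (dP k))); last exact: bb_ln.
by ring.
Qed.

End barycenter.

Theorem theorem5 (R : realType) (K : nat) (Dk : 'I_K -> nat) (D : nat)
    (X : forall k : 'I_K, set 'rV[R]_(Dk k)) (Y : set 'rV[R]_D)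
    (P : forall k : 'I_K, 'rV[R]_(Dk k) -> R)
    (c : forall k : 'I_K, 'rV[R]_(Dk k) -> 'rV[R]_D -> R)
    (lam : 'I_K -> R) (eps : R)
    (Qstar : 'rV[R]_D -> R)
    (pistar : forall k : 'I_K, 'rV[R]_(Dk k) -> 'rV[R]_D -> R)
    (sigma : R -> R) (xt : R) :
  (* setting *)
  (forall k, compact (X k)) ->
  compact Y ->
  (0 < leb_vol Y)%E ->
  (forall k, is_density (X k) (P k)) ->
  (forall k, {within X k `*` Y, continuous (fun z => c k z.1 z.2)}) ->
  (forall k, 0 < lam k) ->
  \sum_(k < K) lam k = 1 ->
  0 < eps ->
  (exists Q, is_density Y Q /\ (bary_obj X Y P c lam eps Q < +oo)%E) ->
  (* Q* is the barycenter and pi*_k the EOT-optimal coupling of P_k and Q* *)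
  is_density Y Qstar ->
  bary_obj X Y P c lam eps Qstar = Lstar X Y P c lam eps ->
  (forall k, is_coupling (X k) Y (P k) Qstar (pistar k) /\
             eot_cost (P k) (c k) eps (pistar k) = EOT (X k) Y (P k) Qstar (c k) eps) ->
  (* activation *)
  continuous sigma ->
  ~ affine_fun sigma ->
  derivable sigma xt 1 ->
  derive1 sigma xt != 0 ->
  forall delta : R, 0 < delta ->
  exists g : forall k : 'I_K, mlp R D,
    (forall k, (mlp_width (g k) <= D + 4)%N) /\
    let f := fun (k : 'I_K) (y : 'rV[R]_D) =>
      mlp_eval sigma (g k) y - \sum_(j < K) lam j * mlp_eval sigma (g j) y in
    (\sum_(k < K) (lam k)%:E *
        KL2 (fun x y => (P k x * pistar k x y)%R)
            (fun x y => (P k x * mu_dens Y (c k) eps (f k) x y)%R)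
      = (Lstar X Y P c lam eps - Ldual Y P c lam eps f) / eps%:E)%E /\
    ((Lstar X Y P c lam eps - Ldual Y P c lam eps f) / eps%:E < (delta / eps)%:E)%E.
Proof.
have gap (s t w d r : R) : s <= t + d -> t - r <= w -> 0 < d -> s - w < d + r + d by lra.
move=> cX cY Vpos dP cc lam0 lam1 eps0 _ dQ QL pistarP cs na ds ds0 delta delta0.
pose nc k := ncost (X k) Y (c k) eps.
pose E k := Efun (P k); pose J := Jfun Y.
have pE k : posfun (E k) := Efun_posfun (dP k).
have pJ : posfun J := Jfun_posfun cY.
have fEJ k : fubini (E k) J := EJ_fubini cY (dP k).
have E1 k : E k (fun=> 1) = 1 := Efun1 (dP k).
have V0 : 0 < J (fun=> 1) := Jfun1_gt0 cY Vpos.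
have bc k : bb2 (nc k) := ncost_bb eps (cX k) cY (cc k).
have /choice[Ck CkP] k : exists C, forall z, `|nc k z.1 z.2| <= C.
  by have [_ [C CP]] := bc k; exists C.
have cC k x y : `|nc k x y| <= \sum_i `|Ck i|.
  rewrite (le_trans (CkP k (x, y)))// (le_trans (ler_norm _))// (bigD1 k)//= lerDl.
  exact: sumr_ge0.
(* A quarter of [delta] goes to the plans and a quarter to the networks, which centring doubles to a
   half; the last quarter makes the final inequality strict. *)
have e0 : 0 < delta / 4 / eps by rewrite !divr_gt0.
have [h [p [m [hfeas bp pJ1 pm pcost]]]] :=
  near_optimal_plans pE pJ fEJ E1 V0 bc cC lam0 lam1 e0.
have eta0 : 0 < delta / 4 by rewrite divr_gt0.
have [g gP] := mlp_near_dual cX cY cc eps0 cs na ds ds0 hfeas eta0.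
exists g; split; first by move=> k; case: (gP k).
move=> f.
pose u k := npot Y eps (f k).
have bu k : bb (u k) by exact: congruent_npot_bb.
have [bh h0 _] := hfeas.
have uh k y : Y y -> u k y <= h k y + delta / 2 / eps.
  move=> Yy; rewrite /u npotE// ler_pdivrMr//.
  have -> : (h k y + delta / 2 / eps) * eps = eps * h k y + delta / 2.
    by field; rewrite gt_eqF.
  have hk i : `|mlp_eval sigma (g i) y - eps * h i y| <= delta / 4.
    by case: (gP i) => _; exact.
  have hs : \sum_i lam i * (eps * h i y) = 0.
    under eq_bigr do rewrite mulrCA.
    by rewrite -mulr_sumr h0 mulr0.
  have := congruent_near lam0 lam1 hs hk k; rewrite ler_distl => /andP[_].
  by rewrite -/(f k y) => hle; rewrite (le_trans hle)// lerD2l; lra.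
have LdE := Ldual_npot lam cX cY Vpos dP cc bu.
have LE : Lstar X Y P c lam eps =
    (\sum_k (lam k)%:E * eot_cost (P k) (c k) eps (pistar k))%E.
  by rewrite -QL; apply: eq_bigr => k _; case: (pistarP k) => _ ->.
have Lub := Lstar_le cX cY Vpos dP cc lam0 lam1 eps0 bp pJ1 pm.
(* The competitor bounds [Lstar] by a real number. Since no cost is [-oo], a single infinite cost
   would make the weighted sum infinite. *)
have cost_fin k : (eot_cost (P k) (c k) eps (pistar k) < +oo)%E.
  rewrite ltey; apply/eqP => Ek.
  have := le_lt_trans Lub (ltry _); rewrite LE.
  suff -> : (\sum_k (lam k)%:E * eot_cost (P k) (c k) eps (pistar k) = +oo)%E by [].
  apply/esum_eqyP => [i _|]; last first.
    by exists k; split; rewrite ?mem_index_enum// Ek gt0_muley// lte_fin.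
  have := eot_cost_Ny (cX i) cY Vpos (dP i) eps0 (cc i) dQ (proj1 (pistarP i)).
  case: (eot_cost _ _ _ _) => [r| |] //.
  by rewrite gt0_muley// lte_fin.
have /choice[v vP] k := eot_cost_fin (cX k) cY Vpos (dP k) eps0 (cc k) dQ
  (proj1 (pistarP k)) (cost_fin k).
have {}LE : Lstar X Y P c lam eps = (\sum_k lam k * v k)%:E.
  by rewrite LE -sumEFin; apply: eq_bigr => k _; case: (vP k) => ->.
have bl w k : bb (w : Rn R D -> R) -> bb (fun x => ln (gpart J (nc k) w x)).
  by move=> bw; apply: bb_ln; exact: (gpart_bbp pJ (fEJ k) V0 (bc k) bw).
have dvE w : (forall k, bb (w k)) -> dual_val J E nc lam w =
    - \sum_k lam k * E k (fun x => ln (gpart J (nc k) (w k) x)).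
  move=> bw; rewrite /dual_val -sumrN; apply: eq_bigr => k _.
  by rewrite (pfN (pE k)) ?mulrN//; exact: bl.
have Qu : \sum_k lam k * wint (lebn R D) Qstar (u k) = 0.
  have pQ : posfun (wint (lebn R D) Qstar) := Efun_posfun dQ.
  have u0 y : \sum_k lam k * u k y = 0.
    transitivity (Defs.indic R Y y / eps * \sum_k lam k * f k y); last first.
      by rewrite (congruent_sum0 lam1 (fun k => mlp_eval sigma (g k) y)) mulr0.
    by rewrite mulr_sumr; apply: eq_bigr => k _; rewrite /u /npot; ring.
  transitivity (wint (lebn R D) Qstar (fun y => \sum_k lam k * u k y)); last first.
    by under eq_fun do rewrite u0; rewrite (pf_cst pQ) mul0r.
  rewrite (pf_sum pQ); last by move=> k; apply: bbM => //; exact: bb_cst.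
  by apply: eq_bigr => k _; rewrite (pfZ pQ).
have -> : ((Lstar X Y P c lam eps - Ldual Y P c lam eps f) / eps%:E)%E =
    (\sum_k lam k * v k / eps - dual_val J E nc lam u)%:E.
  rewrite LE LdE inver gt_eqF// -EFinB -EFinM -mulr_suml; congr EFin.
  by field; rewrite gt_eqF.
split.
  transitivity (\sum_k (lam k)%:E * (v k / eps - wint (lebn R D) Qstar (u k) +
      E k (fun x => ln (gpart J (nc k) (u k) x)))%:E)%E.
    by apply: eq_bigr => k _; rewrite (proj2 (vP k) _ (bu k)).
  under eq_bigr do rewrite -EFinM.
  rewrite sumEFin; congr EFin; rewrite (dvE u bu) opprK.
  under eq_bigr do rewrite mulrDr mulrBr mulrA.
  by rewrite big_split sumrB Qu subr0.
rewrite lte_fin.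
(* Raising a potential lowers the dual value, so the one-sided bound [uh] is the one that counts. *)
have hu : dual_val J E nc lam h - delta / 2 / eps <= dual_val J E nc lam u.
  rewrite (dvE h bh) (dvE u bu) -opprD lerN2.
  have -> : delta / 2 / eps = \sum_k lam k * (delta / 2 / eps) by rewrite -mulr_suml lam1 mul1r.
  rewrite -big_split ler_sum//= => k _; rewrite -mulrDr ler_pM2l//.
  exact: (Efun_ln_gpart_le eps (cX k) cY Vpos (dP k) (cc k) (bu k) (bh k) (uh k)).
rewrite (_ : \sum_k lam k * v k / eps = (\sum_k lam k * v k) / eps); last by rewrite mulr_suml.
move: Lub; rewrite LE lee_fin -ler_pdivrMl// mulrC => Lub.
have -> : delta / eps = delta / 4 / eps + delta / 2 / eps + delta / 4 / eps by field; rewrite gt_eqF.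
exact: (gap _ _ _ _ _ (le_trans Lub pcost) hu e0).
Qed.
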